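(* For any closure $K$ of a positive braid and every integer $r\ge 1$, the head of the $r$-colored HOMFLY polynomial of $K$ is equal to the head of the unknot, i.e. it is equal to the first $r$ coefficients (those of $q^{0},q^{-1},\dots,q^{-(r-1)}$) of the power series in $q^{-1}$ $$\frac{(a^{-1};q^{-1})_{\infty}}{(q^{-1};q^{-1})_{\infty}}.$$
   Context: **Notation.** $(x;p)_\infty=\prod_{k=0}^\infty(1-xp^k)$. A positive braid is a braid that can be written as a word in the standard braid generators with positive exponents only. **The colored HOMFLY polynomial.** $P_r(L;a,q)$ is the unreduced $r$-colored HOMFLY polynomial of an oriented link $L$, in which every component of $L$ is colored by the $r$-th symmetric power of the standard representation. It is the rational function (in $a$ and $q$, up to fractional powers) that unifies the corresponding Reshetikhin–Turaev quantum $\mathfrak{sl}_N$ invariants: setting $a=q^N$ gives the $\mathfrak{sl}_N$ invariant of $L$ with all components colored by the $r$-th symmetric power. Unreduced means that one does not divide by the value of the unknot. **Head.** Expand $P_r(K;a,q)$ as a Laurent series in $q^{-1}$: $P_r(K;a,q)=\sum_{j\ge d_r}c^r_j(a)q^{-j}$, with $j\in d_r+\mathbb{Z}_{\ge0}$ ($d_r$ possibly fractional) and $c^r_{d_r}(a)\neq0$. The head is a rescaled version of the top $r$ coefficients: it is $a^{f_r}\sum_{j=0}^{r-1}c^r_{j+d_r}(a)q^{-j}$, where $a^{f_r}$ stands for a monomial in $a$ (a sign being allowed) chosen so that the leading (highest power of $a$) term of $a^{f_r}c^r_{d_r}(a)$ is $1$.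
   Formalization: The closure K is assumed non-split (every braid generator occurs in the positive word, as for every knot); for split closures the claim fails, e.g. the 2-component unlink has head (1-a^{-1})^2 for r=1. *)

(* Defs.v *)
From HB Require Import structures.
From mathcomp Require Import all_boot all_order all_fingroup all_algebra.

Set Implicit Arguments.
Unset Strict Implicit.
Unset Printing Implicit Defensive.

Import Order.TTheory GRing.Theory Num.Theory.

Local Open Scope ring_scope.

Notation "x %:F" := (@FracField.tofrac _ x).

(** * Braid words *)

(* A word in the generators of the braid group on [n.+1] strands: [(true, i)]
   is sigma_i and [(false, i)] its inverse, where sigma_i exchanges the strands
   [i] and [i.+1].  Every oriented link is the closure of such a word. *)
Definition braid_word (n : nat) := seq (bool * 'I_n).

Definition positive_word n (w : braid_word n) : bool := all (fun l => l.1) w.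

(* The closed diagram is connected iff every generator occurs in the word; for
   a positive word this means that the closure is not a split link.  It holds
   as soon as the closure is a knot. *)
Definition connected_closure n (w : braid_word n) : bool :=
  [forall i : 'I_n, i \in [seq l.2 | l <- w]].

Definition unknot_word : braid_word 0 := [::].

Definition writhe n (w : braid_word n) : int :=
  \sum_(l <- w) (if l.1 then 1 else -1).

(* Replacing every strand by [r] parallel ones, sigma_i becomes the positive
   word in which each strand of block [i] crosses each strand of block [i.+1]
   exactly once. *)
Definition cable_letter n (r : nat) (l : bool * 'I_n) : seq (bool * nat) :=
  let u := flatten [seq [seq (l.2 * r + (r.-1 - k) + j)%N | j <- iota 0 r]
                   | k <- iota 0 r] in
  if l.1 then [seq (true, p) | p <- u] else [seq (false, p) | p <- rev u].

Definition cable n (r : nat) (w : braid_word n) : seq (bool * nat) :=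
  flatten [seq cable_letter r l | l <- w].

(** * The sl_N invariants coloured by symmetric powers *)

(* [ratfun] is Q(x) and [rvar] is x.  In this section x is s = q^(1/2). *)
Notation ratfun := {fraction {poly rat}}.
Definition rvar : ratfun := 'X%:F.

Section SlN.

Variables (N m : nat).
Local Notation s := rvar.

(* V^{(x) m.+1}, with V the standard representation with basis indexed by
   ['I_N], given by coordinates in the product basis. *)
Definition tensor := {ffun {ffun 'I_m.+1 -> 'I_N} -> ratfun}.

Definition basis_tensor (x : {ffun 'I_m.+1 -> 'I_N}) : tensor :=
  [ffun y => (y == x)%:R].

(* The braiding of V (x) V at positions [p], [p.+1], rescaled by a power of q
   so as to satisfy (R - s)(R + s^-1) = 0:
     R (e_i e_i) = s e_i e_i,
     R (e_i e_j) = e_j e_i + (if i < j then (s - s^-1) e_i e_j). *)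
Definition Rmx (p : nat) (v : tensor) : tensor :=
  let p0 : 'I_m.+1 := inord p in let p1 : 'I_m.+1 := inord p.+1 in
  [ffun x : {ffun 'I_m.+1 -> 'I_N} =>
     if x p0 == x p1 then s * v x
     else v [ffun k => x (tperm p0 p1 k)]
          + (if (x p0 < x p1)%N then (s - s^-1) * v x else 0)].

(* The Hecke relation gives R^-1 = R - (s - s^-1). *)
Definition braid_letter (l : bool * nat) (v : tensor) : tensor :=
  if l.1 then Rmx l.2 v else [ffun x => Rmx l.2 v x - (s - s^-1) * v x].

Definition braid_act (w : seq (bool * nat)) (v : tensor) : tensor :=
  foldr braid_letter v w.

(* The projector (\sum_w s^l(w) T_w) / (\sum_w s^(2 l(w))), w in S_k, of
   V^{(x) k} onto its k-th quantum symmetric power {v | R_i v = s v}, acting on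
   the positions b, ..., b + k - 1.  For k = k'.+1 both sums are factored along
   the minimal coset representatives t_k' t_(k'-1) ... t_(k'-j+1), 0 <= j <= k',
   of S_k' in S_k, with t_i the i-th simple transposition. *)
Fixpoint symmetrizer (b k : nat) (v : tensor) : tensor :=
  if k is k'.+1 then
    symmetrizer b k' [ffun x =>
      (\sum_(j < k'.+1) s ^+ (2 * j))^-1 *
      \sum_(j < k'.+1) s ^+ j *
        braid_act [seq (true, (b + k'.-1 - i)%N) | i <- iota 0 j] v x]
  else v.

(* Trace of [A] composed with the action of K_{2 rho}. *)
Definition quantum_trace (A : tensor -> tensor) : ratfun :=
  \sum_(x : {ffun 'I_m.+1 -> 'I_N})
     (\prod_(p < m.+1) s ^ ((x p).*2%:Z - N.-1%:Z)) * A (basis_tensor x) x.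

End SlN.

(* The quantum sl_N invariant of the closure of [w], all components coloured by
   the [r]-th symmetric power, [0 < r]: the quantum trace of the [r]-cabled
   braid on (Sym^r V)^{(x) n.+1}, times theta^(- writhe) to cancel the
   dependence on the framing, where theta = q^((r N + r (r - 1)) / 2) is the
   twist of Sym^r V for the rescaled braiding. *)
Definition slN_invariant (N r n : nat) (w : braid_word n) : ratfun :=
  (rvar ^+ (r * N + r * r.-1)) ^ (- writhe w) *
  quantum_trace (fun v : tensor N (n.+1 * r).-1 =>
    braid_act (cable r w)
      (foldr (fun i => symmetrizer (i * r) r) v (iota 0 n.+1))).

(** * The coloured HOMFLY polynomial *)

(* Q(a^(1/2), q^(1/2)), as fractions of polynomials in s = q^(1/2) whose
   coefficients are polynomials in a^(1/2). *)
Notation ratfun2 := {fraction {poly {poly rat}}}.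

(* a^(1/2) := s^N *)
Definition specialize (N : nat) (u : {poly {poly rat}}) : {poly rat} :=
  \sum_(i < size u) (u`_i \Po 'X^N) * 'X^i.

Definition specializes_to (N : nat) (P : ratfun2) (x : ratfun) : Prop :=
  exists u v : {poly {poly rat}},
    [/\ specialize N v != 0, P = u%:F / v%:F
      & x = (specialize N u)%:F / (specialize N v)%:F].

(* [P] is the unreduced [r]-coloured HOMFLY polynomial of the closure of [w]. *)
Definition colored_homfly (r n : nat) (w : braid_word n) (P : ratfun2) : Prop :=
  forall N : nat, (2 <= N)%N -> specializes_to N P (slN_invariant N r w).

(** * The head *)

(* From here on [rvar] stands for a^(1/2). *)

(* P = \sum_j C j * s^(- j) in Q(a^(1/2))((s^-1)), after clearing the
   denominator. *)
Definition laurent_expansion (P : ratfun2) (C : int -> ratfun) : Prop :=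
  (exists D : int, forall j : int, j < D -> C j = 0) /\
  exists u v : {poly {poly rat}},
    [/\ v != 0, P = u%:F / v%:F
      & forall j : int, \sum_(i < size v) (v`_i)%:F * C (j + i%:Z)
                        = if j <= 0 then (u`_(absz j))%:F else 0].

(* A Laurent polynomial in a^(1/2) whose term of highest degree is 1. *)
Definition leading_term_one (x : ratfun) : Prop :=
  exists2 u : {poly rat}, u \is monic & x = u%:F / rvar ^+ (size u).-1.

(* [h] lists the coefficients of q^0, q^-1, ..., q^-(r-1) in the head of [P];
   D = 2 d_r, and the normalizing monomial is (-1)^e a^(f/2). *)
Definition is_head (r : nat) (P : ratfun2) (h : nat -> ratfun) : Prop :=
  exists (C : int -> ratfun) (D : int) (e : bool) (f : int),
    [/\ laurent_expansion P C,
        C D != 0 /\ (forall j : int, C j != 0 -> exists k : nat, j = D + k.*2%:Z),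
        leading_term_one ((-1) ^+ e * rvar ^ f * C D)
      & forall k : nat, (k < r)%N ->
          h k = (-1) ^+ e * rvar ^ f * C (D + k.*2%:Z)].

(* Coefficient of p^k in (x; p)_oo, for x a polynomial in the variable p = 'X:
   the factors 1 - x p^i with k < i do not contribute. *)
Definition qpoch_inf (K : fieldType) (x : {poly K}) (k : nat) : K :=
  (\prod_(i < k.+1) (1 - x * 'X^i))`_k.

(* The quotient of two power series, given by their coefficients, as the
   solution h of \sum_(i <= k) h i * g (k - i) = f k; here g 0 != 0. *)
Fixpoint series_quo_seq (K : fieldType) (f g : nat -> K) (k : nat) : seq K :=
  if k is k'.+1 then
    let h := series_quo_seq f g k' in
    rcons h ((f k' - \sum_(i < k') h`_i * g (k' - i)%N) / g 0%N)
  else [::].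

Definition series_quo (K : fieldType) (f g : nat -> K) (k : nat) : K :=
  (series_quo_seq f g k.+1)`_k.

(* (a^-1; p)_oo / (p; p)_oo with p = q^-1. *)
Definition unknot_series : nat -> ratfun :=
  series_quo (qpoch_inf (rvar ^- 2)%:P) (qpoch_inf 'X).

(* Main.v *)
Require Import Defs.
From mathcomp Require Import all_boot all_order all_fingroup all_algebra.
From mathcomp Require Import zify ring.

(** Write s = q^(1/2), A = a^(1/2) = s^N, and t for the braiding divided by s.
    The eigenvalues of t are 1 and -s^-2, so at s = oo a positive crossing
    becomes a projector.  On Sym^r (x) Sym^r the normalized cabled crossing is
    even the projector onto Sym^(2r) up to terms of order s^(-2r) = q^-r
    ([block_cross_qsym]).  To this order the cabled generators are idempotent,
    hence they satisfy the relations of the 0-Hecke monoid ([cable_idem],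
    [cable_demazure]).

    With these relations every positive word can be rewritten so that the last
    generator occurs at most once ([demazure_last_once]), and once when the
    closure is connected.  Then the Markov property of the quantum trace removes
    the last block of strands, at the price of the factor (A / s)^r
    ([cable_markov]).  Repeating this, the invariant of the closure agrees with
    that of the unknot, up to a monomial and to a relative error q^-r
    ([cable_trace_head]).  The invariant of the unknot is the quantum dimension
    of Sym^r, a quotient of two products with r factors ([qtr_qsym]); to the
    order q^-r these are the two infinite products of the theorem
    ([head_coefficients]).

    Two points need care.  First, estimates must bound entries of operators, not
    eigenvalues.  The t_i are symmetric matrices over Q(s), and in Q(s) a sum of
    squares is as small as the square of its largest term; so X is small as soon
    as X^T X is ([OO_gram]), and X^T X is computed in the Hecke algebra: for one
    strand crossing k symmetrized ones it is an encircling, with eigenvalues 1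
    and s^(-2k-2) ([encircle]).

    Second, the error must be bounded for a and q independent, and not for one N
    at a time.  The operators permute the letters of a state with coefficients
    depending only on the relative order of the letters.  Hence a trace is a sum
    over the finitely many order patterns, the same for all N, and N enters only
    through the generating function of the states with a given pattern
    ([qtr_patterns]).  This is a combination of powers of q^N = a whose
    coefficients are small at q = oo ([pattern_sum]).  Half-integral powers of q
    do not occur on the diagonal, because s comes with a change of the parity of
    the number of inversions ([even_diag]).

    Finally, the values at s^N for N >= 2 determine the rational function P
    ([colored_homfly_unique]), and its expansion at q = oo is read off from the
    fraction thus found ([expansionP]). *)

Set Implicit Arguments.
Unset Strict Implicit.
Unset Printing Implicit Defensive.

Import Order.TTheory GRing.Theory Num.Theory.

Local Open Scope ring_scope.

(** * The order of vanishing at s = oo *)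

Lemma rvar_neq0 : rvar != 0.
Proof. by rewrite tofrac_eq0 polyX_eq0. Qed.

Lemma ratfunP (R : idomainType) (x : {fraction R}) :
  exists u v : R, v != 0 /\ x = u%:F / v%:F.
Proof.
exists (\n_(generic_quotient.repr x))%R, (\d_(generic_quotient.repr x))%R; split; first exact: denom_ratioP.
have v0 : (\d_(generic_quotient.repr x))%:F != 0 by rewrite tofrac_eq0 denom_ratioP.
apply: (mulIf v0); rewrite divfK //.
rewrite -{1}[x]generic_quotient.reprK; unlock tofrac.
rewrite -[LHS]FracField.pi_mul; apply/generic_quotient.eqmodP.
rewrite /= FracField.equivfE /FracField.mulf.
rewrite !numden_Ratio ?mulf_neq0 ?oner_eq0 ?denom_ratioP ?mulr1 //.
all: by [exact: oner_neq0 | rewrite mulrC].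
Qed.

Section OrderAtInfinity.
Variable R : idomainType.
Implicit Types p q r : {poly R}.

Lemma size_pos p : p != 0 -> (0 < size p)%N.
Proof. by rewrite size_poly_gt0. Qed.

Lemma size_addL p q k : (size p <= k)%N -> (size q <= k)%N -> (size (p + q)%R <= k)%N.
Proof. by move=> hp hq; apply: leq_trans (size_polyD p q) _; rewrite geq_max hp hq. Qed.

Lemma size_mul_mono d (p q r : {poly R}) :
  q != 0 -> r != 0 -> (size p + d <= size r)%N -> (size (p * q)%R + d <= size (r * q)%R)%N.
Proof.
move=> q0 r0; rewrite (size_mul r0 q0); have := size_pos q0; have := size_pos r0.
have [->|p0] := eqVneq p 0; first by rewrite mul0r size_poly0; lia.
by have := size_pos p0; rewrite (size_mul p0 q0); lia.
Qed.

(** The order of vanishing at s = oo of a fraction is the degree of its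
    denominator minus that of its numerator. *)
Definition ord_ge (d : nat) (x : {fraction {poly R}}) : Prop :=
  exists u v : {poly R},
    [/\ v != 0, x = u%:F / v%:F & (size u + d <= size v)%N].

Lemma ord_ge0 d : ord_ge d 0.
Proof.
exists 0, ('X^d); rewrite monic_neq0 ?monicXn // tofrac0 mul0r size_poly0 size_polyXn.
by split.
Qed.

Lemma ord_geW d e x : (e <= d)%N -> ord_ge d x -> ord_ge e x.
Proof. by move=> led [u [v [v0 -> h]]]; exists u, v; split=> //; lia. Qed.

Lemma ord_geN d x : ord_ge d x -> ord_ge d (- x).
Proof.
move=> [u [v [v0 -> h]]]; exists (- u), v; split=> //; last by rewrite size_polyN.
by rewrite tofracN mulNr.
Qed.

Lemma ord_geD d x y : ord_ge d x -> ord_ge d y -> ord_ge d (x + y).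
Proof.
move=> [u [v [v0 -> h]]] [u' [v' [v0' -> h']]].
exists (u * v' + u' * v), (v * v'); split; first by rewrite mulf_neq0.
  by rewrite addf_div ?tofrac_eq0 // tofracD !tofracM.
have h1 := size_mul_mono v0' v0 h; have h2 := size_mul_mono v0 v0' h'.
have dv : (d <= size (v * v')%R)%N by move: h1; lia.
rewrite [v' * v]mulrC in h2; rewrite -(subnK dv) leq_add2r.
by apply: size_addL; rewrite leq_subRL // addnC.
Qed.

Lemma ord_geM d e x y : ord_ge d x -> ord_ge e y -> ord_ge (d + e) (x * y).
Proof.
move=> [u [v [v0 -> h]]] [u' [v' [v0' -> h']]].
have [->|u0] := eqVneq u 0; first by rewrite tofrac0 !mul0r; apply: ord_ge0.
have [->|u0'] := eqVneq u' 0.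
  by rewrite tofrac0 mul0r mulr0; apply: ord_ge0.
exists (u * u'), (v * v'); split; first by rewrite mulf_neq0.
  by rewrite mulf_div !tofracM.
have : (0 < size u)%N by exact: size_pos.
have : (0 < size u')%N by exact: size_pos.
rewrite !size_mul //; lia.
Qed.

Lemma ord_ge1 : ord_ge 0 1.
Proof. by exists 1, 1; rewrite tofrac1 divr1 oner_eq0 addn0. Qed.

Lemma ord_ge_unit x : ord_ge 1 x -> ord_ge 0 (1 + x)^-1 /\ 1 + x != 0.
Proof.
move=> [u [v [v0 -> h]]].
have sz : size (v + u) = size v by rewrite size_polyDl //; lia.
have vu0 : v + u != 0 by rewrite -size_poly_gt0 sz size_poly_gt0.
have E : 1 + u%:F / v%:F = (v + u)%:F / v%:F.
  by rewrite tofracD mulrDl divff ?tofrac_eq0.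
split; last by rewrite E mulf_neq0 ?invr_eq0 ?tofrac_eq0.
exists v, (v + u); split=> //; last by rewrite sz; lia.
by rewrite E invf_div.
Qed.

(** Clearing denominators reduces the bound to polynomials, for which it says
    that a sum of squares has twice the largest degree. *)
Lemma ord_ge_sum_sqr_of d (I : finType) (x : I -> {fraction {poly R}}) :
  (forall (w : I -> {poly R}) i, ((size (w i)).*2 <= (size (\sum_j w j ^+ 2)%R).+1)%N) ->
  ord_ge d.*2 (\sum_j x j ^+ 2) -> forall i, ord_ge d (x i).
Proof.
move=> sqR [a [b [b0 sE sab]]] i.
have /fin_all_exists2 [u u0 xE] :
    forall j, exists2 uv : {poly R} * {poly R}, uv.2 != 0 & x j = uv.1%:F / uv.2%:F.
  by move=> j; have [u [v [v0 E]]] := ratfunP (x j); exists (u, v).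
pose v : {poly R} := \prod_j (u j).2.
have v0 : v != 0 by apply/prodf_neq0 => j _; apply: u0.
pose w j : {poly R} := (u j).1 * \prod_(k | k != j) (u k).2.
have xw j : x j = (w j)%:F / v%:F.
  have -> : v = (u j).2 * \prod_(k | k != j) (u k).2 by rewrite /v (bigD1 j).
  rewrite xE /w !rmorphM /= -mulf_div divff ?mulr1 //.
  by rewrite tofrac_eq0; apply/prodf_neq0 => k _; apply: u0.
have E : (\sum_j w j ^+ 2) * b = a * v ^+ 2.
  have bF : b%:F != 0 by rewrite tofrac_eq0.
  have vF : v%:F != 0 by rewrite tofrac_eq0.
  have wE : (\sum_j w j ^+ 2)%:F = (\sum_j x j ^+ 2) * v%:F ^+ 2.
    rewrite rmorph_sum mulr_suml; apply: eq_bigr => j _.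
    by rewrite xw expr_div_n divfK ?expf_neq0 // rmorphXn.
  apply/eqP; rewrite -tofrac_eq rmorphM [X in _ == X]rmorphM rmorphXn /=; apply/eqP.
  rewrite wE sE; move: (a%:F) (b%:F) (v%:F) bF => a' b' v' bF.
  by rewrite mulrAC divfK.
have [wi0|wi0] := eqVneq (w i) 0.
  by rewrite xw wi0 tofrac0 mul0r; apply: ord_ge0.
exists (w i), v; split=> //.
have := sqR w i; move: E; set S : {poly R} := \sum_j w j ^+ 2 => E szS.
have wpos : (0 < size (w i))%N by exact: size_pos.
have S0 : S != 0 by rewrite -size_poly_gt0; lia.
have a0 : a != 0.
  by apply: contraNneq (mulf_neq0 S0 b0) => a0; rewrite E a0 mul0r.
have vpos : (0 < size v)%N by exact: size_pos.
have := congr1 (fun p : {poly R} => size p) E.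
rewrite expr2 (size_mul S0 b0) (size_mul a0 (mulf_neq0 v0 v0)) (size_mul v0 v0).
have : (0 < size a)%N by exact: size_pos.
have : (0 < size S)%N by exact: size_pos.
have : (0 < size b)%N by exact: size_pos.
lia.
Qed.

End OrderAtInfinity.

Lemma ord_ge_zX k : ord_ge k (rvar^-1 ^+ k).
Proof.
exists 1, 'X^k; rewrite monic_neq0 ?monicXn // tofrac1 div1r size_poly1 size_polyXn.
by split=> //; rewrite tofracXn exprVn.
Qed.

Lemma ord_ge_z : ord_ge 1 rvar^-1.
Proof. by have := ord_ge_zX 1; rewrite expr1. Qed.

(** Leading coefficients of squares are positive, so they do not cancel. *)
Lemma size_sum_sqr (R : realDomainType) (I : finType) (w : I -> {poly R}) i :
  ((size (w i)).*2 <= (size (\sum_j w j ^+ 2)%R).+1)%N.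
Proof.
pose M := \max_j size (w j).
have leM j : (size (w j) <= M)%N by apply: (@leq_bigmax _ (fun j => size (w j))).
case: (posnP M) => [M0|Mpos]; first by have := leM i; lia.
suff h : ((M.*2).-1 <= size (\sum_j w j ^+ 2)%R)%N by have := leM i; lia.
rewrite leqNgt; apply/negP => hh.
have c0 : (\sum_j w j ^+ 2)`_(M.-1).*2 = 0 by rewrite nth_default // -ltnS; apply: leq_trans hh _; lia.
have cE j : (w j ^+ 2)`_(M.-1).*2 = (w j)`_(M.-1) ^+ 2.
  rewrite expr2 coefM.
  have lt : (M.-1 < (M.-1).*2.+1)%N by lia.
  rewrite (bigD1 (Ordinal lt)) //= big1 => [|k].
    by rewrite addr0 expr2; congr (_ * _`_ _); lia.
  rewrite -val_eqE /= => /eqP kne.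
  have [lk|gk] := ltnP k M.-1; last first.
    by rewrite nth_default ?mul0r //; apply: leq_trans (leM j) _; lia.
  by rewrite [X in _ * X]nth_default ?mulr0 //; apply: leq_trans (leM j) _; lia.
have [i0 Mi0] : {i0 | M = size (w i0)}.
  by apply: (@bigop.eq_bigmax _ (fun j => size (w j))); apply/card_gt0P; exists i.
move: c0; rewrite coef_sum (eq_bigr (fun j => (w j)`_(M.-1) ^+ 2)) => [|j _ //].
move/eqP; rewrite psumr_eq0 => [/allP/(_ i0)|j _]; last exact: sqr_ge0.
rewrite mem_index_enum => /(_ isT) /=; rewrite sqrf_eq0 Mi0 -lead_coefE lead_coef_eq0.
by rewrite -size_poly_eq0 -Mi0; lia.
Qed.

Lemma ord_ge_sum_sqr d (I : finType) (x : I -> ratfun) :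
  ord_ge d.*2 (\sum_j x j ^+ 2) -> forall i, ord_ge d (x i).
Proof. by apply: ord_ge_sum_sqr_of => w i; apply: size_sum_sqr. Qed.

(** What the estimates on Hecke algebra operators use of the order of vanishing
    at s = oo. *)
Record order_at_infinity (F : fieldType) (s : F) (v : nat -> F -> Prop) : Prop :=
  OrderAtInfinity {
  oi_neq0 : s != 0;
  oi0 : forall d, v d 0;
  oiW : forall d e x, (e <= d)%N -> v d x -> v e x;
  oiN : forall d x, v d x -> v d (- x);
  oiD : forall d x y, v d x -> v d y -> v d (x + y);
  oiM : forall d e x y, v d x -> v e y -> v (d + e)%N (x * y);
  oi1 : v 0 1;
  oi_inv : v 1 s^-1;
  oi_unit : forall x, v 1 x -> v 0 (1 + x)^-1 /\ 1 + x != 0;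
  oi_sum_sqr : forall d (I : finType) (x : I -> F),
    v d.*2 (\sum_j x j ^+ 2) -> forall i, v d (x i) }.

Lemma rvar_order_at_infinity : order_at_infinity rvar (@ord_ge rat).
Proof.
split; [exact: rvar_neq0 | exact: ord_ge0 | exact: ord_geW | exact: ord_geN
  | exact: ord_geD | exact: ord_geM | exact: ord_ge1 | exact: ord_ge_z
  | exact: ord_ge_unit | exact: ord_ge_sum_sqr].
Qed.

(** * Matrices bounded at infinity *)

Section MatrixRing.
Variables (F : fieldType) (D : nat).
Implicit Types X Y : 'M[F]_D.

Lemma scMl a X Y : (a *: X) * Y = a *: (X * Y).
Proof. exact: esym (scalemxAl a X Y). Qed.

Lemma scMr a X Y : X * (a *: Y) = a *: (X * Y).
Proof. exact: esym (scalemxAr a X Y). Qed.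

Lemma trM X Y : (X * Y)^T = Y^T * X^T.
Proof. exact: trmx_mul. Qed.

Lemma trB X Y : (X - Y)^T = X^T - Y^T.
Proof. exact: linearB. Qed.

Lemma tr1 : (1 : 'M[F]_D)^T = 1.
Proof. exact: trmx1. Qed.

Lemma mxME X Y i j : (X * Y) i j = \sum_k X i k * Y k j.
Proof. by rewrite mxE. Qed.

Definition mx_ord_ge (v : nat -> F -> Prop) d X := forall i j, v d (X i j).

Variables (s : F) (v : nat -> F -> Prop).
Hypothesis V : order_at_infinity s v.
Local Notation OO := (mx_ord_ge v).
Local Notation z := (s^-1).

Lemma oi_sum d (I : Type) (l : seq I) (P : pred I) f :
  (forall i, P i -> v d (f i)) -> v d (\sum_(i <- l | P i) f i).
Proof.
by move=> h; apply: (big_ind (v d)) => //; [apply: (oi0 V)|move=> *; apply: (oiD V)].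
Qed.

Lemma oi_natr k : v 0 k%:R.
Proof.
elim: k => [|k IH]; first exact: (oi0 V).
by rewrite -natr1; apply: (oiD V) => //; apply: (oi1 V).
Qed.

Lemma oi_invX k : v k (z ^+ k).
Proof.
elim: k => [|k IH]; first by rewrite expr0; apply: (oi1 V).
by rewrite exprS -[k.+1]add1n; apply: (oiM V (oi_inv V) IH).
Qed.

Lemma oi_neq0X k : s ^+ k != 0.
Proof. by rewrite expf_neq0 ?(oi_neq0 V). Qed.

Lemma oi_sqr_neq1 : s ^+ 2 - 1 != 0.
Proof.
have h : v 1 (- z ^+ 2) by apply: (oiN V); apply: (oiW V) (oi_invX 2).
have [_] := oi_unit V h; apply: contraNneq => /eqP; rewrite subr_eq0 => /eqP E.
by rewrite exprVn E invr1 subrr.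
Qed.

Lemma OO0 d : OO d 0.
Proof. by move=> i j; rewrite mxE; apply: (oi0 V). Qed.

Lemma OO1 : OO 0 1.
Proof. by move=> i j; rewrite mxE; apply: oi_natr. Qed.

Lemma OOW d e X : (e <= d)%N -> OO d X -> OO e X.
Proof. by move=> le h i j; apply: (oiW V) le _. Qed.

Lemma OOD d X Y : OO d X -> OO d Y -> OO d (X + Y).
Proof. by move=> hX hY i j; rewrite mxE; apply: (oiD V). Qed.

Lemma OON d X : OO d X -> OO d (- X).
Proof. by move=> hX i j; rewrite mxE; apply: (oiN V). Qed.

Lemma OOB d X Y : OO d X -> OO d Y -> OO d (X - Y).
Proof. by move=> hX hY; apply: OOD => //; apply: OON. Qed.

Lemma OOM d e X Y : OO d X -> OO e Y -> OO (d + e) (X * Y).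
Proof. by move=> hX hY i j; rewrite mxME; apply: oi_sum => k _; apply: (oiM V). Qed.

Lemma OOMl d X Y : OO 0 X -> OO d Y -> OO d (X * Y).
Proof. by move=> hX hY; apply: OOW (OOM hX hY). Qed.

Lemma OOMr d X Y : OO d X -> OO 0 Y -> OO d (X * Y).
Proof. by move=> hX hY; apply: OOW (OOM hX hY); rewrite addn0. Qed.

Lemma OOZ d e a X : v d a -> OO e X -> OO (d + e) (a *: X).
Proof. by move=> ha hX i j; rewrite mxE; apply: (oiM V). Qed.

Lemma OO_sum d (I : Type) (l : seq I) (P : pred I) (f : I -> 'M[F]_D) :
  (forall i, P i -> OO d (f i)) -> OO d (\sum_(i <- l | P i) f i).
Proof. by move=> h; apply: (big_ind (OO d)) => //; [apply: OO0|move=> *; apply: OOD]. Qed.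

Lemma OO_prod (I : eqType) (l : seq I) (f : I -> 'M[F]_D) :
  (forall i, i \in l -> OO 0 (f i)) -> OO 0 (\prod_(i <- l) f i).
Proof.
elim: l => [|i l IH] h; first by rewrite big_nil; apply: OO1.
rewrite big_cons; apply: OOMl; first by apply: h; rewrite mem_head.
by apply: IH => j jl; apply: h; rewrite inE jl orbT.
Qed.

Lemma OO_trans d X Y Z' : OO d (X - Y) -> OO d (Y - Z') -> OO d (X - Z').
Proof. by move=> h1 h2; have := OOD h1 h2; rewrite addrA subrK. Qed.

(** The diagonal entries of X^T X are the sums of squares of the columns of X, so
    an identity for X^T X, which the Hecke relations can provide, bounds every
    entry of X. *)
Lemma OO_gram d X : OO d.*2 (X^T * X) -> OO d X.
Proof.
move=> h i j; have := h j j; rewrite mxME.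
rewrite (eq_bigr (fun k => X k j ^+ 2)) => [|k _]; last by rewrite mxE expr2.
by move/(oi_sum_sqr V); apply.
Qed.

End MatrixRing.

(** * Hecke algebra operators *)

(** A representation of the Hecke algebra by symmetric matrices, in the
    normalization t = s^-1 T for which the eigenvalues are 1 and - s^-2.  At
    s = oo the t_i become commuting idempotents. *)
Record hecke_rep (F : fieldType) (s : F) (v : nat -> F -> Prop) (D m : nat)
    (t : nat -> 'M[F]_D) : Prop := HeckeRep {
  hecke_sqr : forall i, (i < m)%N -> t i * t i = (1 - s^-1 ^+ 2) *: t i + s^-1 ^+ 2 *: (1 : 'M[F]_D);
  hecke_braid : forall i, (i.+1 < m)%N -> t i * t i.+1 * t i = t i.+1 * t i * t i.+1;
  hecke_far : forall i j, (i.+1 < j)%N -> (j < m)%N -> t i * t j = t j * t i;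
  hecke_sym : forall i, (i < m)%N -> (t i)^T = t i;
  hecke_int : forall i, (i < m)%N -> mx_ord_ge v 0 (t i);
  hecke_comm_lim : forall i, (i.+1 < m)%N -> mx_ord_ge v 1 (t i * t i.+1 - t i.+1 * t i) }.

Section Words.
Variables (F : fieldType) (s : F) (D : nat) (t : nat -> 'M[F]_D).

Definition tw (w : seq nat) : 'M[F]_D := \prod_(i <- w) t i.

(** The positive crossing of the [a] strands at [b] with the next strand. *)
Definition row_cross b a := tw (iota b a).

(** The positive crossing of the block of [a] strands at [b] with the next [k]
    strands.  Locked, like the projector below, since rewriting would otherwise
    unfold the recursion. *)
Fixpoint block_cross_rec b a k : 'M[F]_D :=
  if k is k'.+1 then row_cross (b + k') a * block_cross_rec b a k' else 1.

Definition block_cross b a k := locked (block_cross_rec b a k).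

Definition qint k : F := \sum_(j < k) s ^+ (2 * j).

(** The minimal coset representatives of S_k in S_(k+1), acting from [b] on. *)
Definition desc b k j := [seq (b + (k.-1 - i))%N | i <- iota 0 j].

(** The projector onto the k-th quantum symmetric power, built one strand at a
    time from the coset representatives. *)
Fixpoint qsym_rec b k : 'M[F]_D :=
  if k is k'.+1 then
    qsym_rec b k' * ((qint k'.+1)^-1 *: \sum_(j < k'.+1) s ^+ (2 * j) *: tw (desc b k' j))
  else 1.

Definition qsym b k := locked (qsym_rec b k).

Lemma tw_cat w1 w2 : tw (w1 ++ w2) = tw w1 * tw w2.
Proof. by rewrite /tw big_cat. Qed.

Lemma tw_cons i w : tw (i :: w) = t i * tw w.
Proof. by rewrite /tw big_cons. Qed.

Lemma tw_nil : tw [::] = 1.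
Proof. by rewrite /tw big_nil. Qed.

Lemma tw_seq1 i : tw [:: i] = t i.
Proof. by rewrite /tw big_seq1. Qed.

Lemma row_crossD b k l : row_cross b (k + l) = row_cross b k * row_cross (b + k) l.
Proof. by rewrite /row_cross iotaD tw_cat. Qed.

Lemma row_crossSr b k : row_cross b k.+1 = row_cross b k * t (b + k).
Proof. by rewrite -addn1 row_crossD /row_cross /= tw_seq1. Qed.

Lemma row_crossS b k : row_cross b k.+1 = t b * row_cross b.+1 k.
Proof. by rewrite /row_cross /= tw_cons. Qed.

Lemma row_cross0 b : row_cross b 0 = 1.
Proof. exact: tw_nil. Qed.

Lemma desc_recr b k j : desc b k j.+1 = rcons (desc b k j) (b + (k.-1 - j))%N.
Proof. by rewrite /desc -addn1 iotaD map_cat cats1. Qed.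

Lemma tw_descS b k j : tw (desc b k j.+1) = tw (desc b k j) * t (b + (k.-1 - j)).
Proof. by rewrite desc_recr -cats1 tw_cat tw_seq1. Qed.

Lemma qsymS b k : qsym b k.+1 =
  qsym b k * ((qint k.+1)^-1 *: \sum_(j < k.+1) s ^+ (2 * j) *: tw (desc b k j)).
Proof. by rewrite /qsym -!lock. Qed.

Lemma block_crossS b a k :
  block_cross b a k.+1 = row_cross (b + k) a * block_cross b a k.
Proof. by rewrite /block_cross -!lock. Qed.

Lemma qsym0 b : qsym b 0 = 1.
Proof. by rewrite /qsym -lock. Qed.

Lemma block_cross0 b a : block_cross b a 0 = 1.
Proof. by rewrite /block_cross -lock. Qed.

Lemma qint1 : qint 1 = 1.
Proof. by rewrite /qint big_ord1 expr0. Qed.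

Lemma qintS k : qint k.+1 = 1 + s ^+ 2 * qint k.
Proof.
rewrite /qint big_ord_recl expr0; congr (_ + _); rewrite mulr_sumr.
by apply: eq_bigr => j _; rewrite -exprD; rewrite mulnS.
Qed.

Lemma qintSr k : qint k.+1 = qint k + s ^+ (2 * k).
Proof. by rewrite /qint big_ord_recr. Qed.

Lemma qint_geom k : (s ^+ 2 - 1) * qint k = s ^+ (2 * k) - 1.
Proof.
elim: k => [|k IH]; first by rewrite /qint big_ord0 mulr0 expr0 subrr.
by rewrite qintSr mulrDr IH mulnS exprD; ring.
Qed.

(** The isotopy that slides a braid on [k] strands across [X].  Stated for the
    generators, it extends to every operator that they build. *)
Definition carries X b b' k :=
  forall i, (i.+1 < k)%N -> X * t (b + i) = t (b' + i) * X.

Lemma carriesW X b b' k l : (l <= k)%N -> carries X b b' k -> carries X b b' l.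
Proof. by move=> le h i il; apply: h; lia. Qed.

Lemma carries1 b k : carries 1 b b k.
Proof. by move=> i _; rewrite mul1r mulr1. Qed.

Lemma carriesM X Y b b' b'' k :
  carries X b b' k -> carries Y b' b'' k -> carries (Y * X) b b'' k.
Proof. by move=> hX hY i ik; rewrite -mulrA hX // !mulrA hY. Qed.

Lemma carries_shift X b b' k j l :
  (j + l <= k)%N -> carries X b b' k -> carries X (b + j) (b' + j) l.
Proof. by move=> le h i il; rewrite -!addnA; apply: h; lia. Qed.

Lemma carries_tw X b b' k w : carries X b b' k -> (all (fun i => i.+1 < k)%N w) ->
  X * tw [seq (b + i)%N | i <- w] = tw [seq (b' + i)%N | i <- w] * X.
Proof.
move=> h; elim: w => [_|i w IH /= /andP[ik wk]]; first by rewrite tw_nil mulr1 mul1r.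
by rewrite !tw_cons mulrA h // -mulrA IH // mulrA.
Qed.

Lemma carries_row X b b' k : carries X b b' k.+1 ->
  X * row_cross b k = row_cross b' k * X.
Proof.
have rowE c : row_cross c k = tw [seq (c + i)%N | i <- iota 0 k].
  by rewrite /row_cross -iotaDl addn0.
move=> h; rewrite !rowE; apply: (carries_tw h).
by apply/allP => i; rewrite mem_iota; lia.
Qed.

Lemma carries_desc X b b' k j : carries X b b' k.+1 -> (j <= k)%N ->
  X * tw (desc b k j) = tw (desc b' k j) * X.
Proof.
move=> h jk; rewrite /desc !(map_comp (addn _) (subn _)).
apply: (carries_tw h); apply/allP => i /mapP[l]; rewrite mem_iota => lj ->; lia.
Qed.

Lemma carries_qsym X b b' k : carries X b b' k -> X * qsym b k = qsym b' k * X.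
Proof.
elim: k => [|k IH] h; first by rewrite !qsym0 mulr1 mul1r.
rewrite !qsymS mulrA IH; last exact: carriesW h.
rewrite -!mulrA; congr (_ * _); rewrite scMr scMl; congr (_ *: _).
rewrite mulr_sumr mulr_suml; apply: eq_bigr => j _.
by rewrite scMr scMl (carries_desc h) // -ltnS ltn_ord.
Qed.

Lemma carries_block X b b' a k : carries X b b' (a + k) ->
  X * block_cross b a k = block_cross b' a k * X.
Proof.
elim: k => [|k IH] h; first by rewrite !block_cross0 mulr1 mul1r.
rewrite !block_crossS mulrA (carries_row (b' := b' + k)); last first.
  by apply: carries_shift h; lia.
by rewrite -mulrA IH ?mulrA //; apply: carriesW h; lia.
Qed.

(** The columns of [X] span copies of the representation t_i = 1, in which every
    braid and every symmetrizing projector acts as the identity. *)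
Definition fixes b k X := forall i, (i.+1 < k)%N -> t (b + i) * X = X.

Lemma fixes_tw b k w X :
  fixes b k X -> all (fun i => (b <= i)%N && (i.+1 < b + k)%N) w -> tw w * X = X.
Proof.
move=> h; elim: w => [_|i w IH /= /andP[/andP[bi ik] wk]]; first by rewrite tw_nil mul1r.
by rewrite tw_cons -mulrA IH // -(subnKC bi) h //; lia.
Qed.

Lemma fixes_row b k c l X : (b <= c)%N -> (c + l < b + k)%N ->
  fixes b k X -> row_cross c l * X = X.
Proof.
by move=> bc le h; apply: fixes_tw h _; apply/allP => i; rewrite mem_iota; lia.
Qed.

Lemma fixes_block b k c a l X : (b <= c)%N -> (c + a + l <= b + k)%N ->
  fixes b k X -> block_cross c a l * X = X.
Proof.
move=> bc; elim: l => [|l IH] le h; first by rewrite block_cross0 mul1r.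
by rewrite block_crossS -mulrA IH //; [apply: fixes_row h; lia|lia].
Qed.

Lemma fixes_qsym b k c l X : (forall j, qint j.+1 != 0) -> (b <= c)%N -> (c + l <= b + k)%N ->
  fixes b k X -> qsym c l * X = X.
Proof.
move=> q0 bc; elim: l => [|l IH] le h; first by rewrite qsym0 mul1r.
rewrite qsymS -mulrA scMl mulr_suml (eq_bigr (fun j : 'I_l.+1 => s ^+ (2 * j) *: X)).
  rewrite -scaler_suml scalerA mulVf ?scale1r //.
  by apply: IH => //; lia.
move=> j _; rewrite scMl; congr (_ *: _); apply: fixes_tw h _.
by apply/allP => i /mapP[i']; rewrite mem_iota => hi ->; have := ltn_ord j; lia.
Qed.

End Words.

(** * The symmetrizing projectors *)

Section HeckeTheory.
Variables (F : fieldType) (s : F) (v : nat -> F -> Prop).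
Hypothesis V : order_at_infinity s v.
Variables (D m : nat) (t : nat -> 'M[F]_D).
Hypothesis H : hecke_rep s v m t.
Local Notation z := (s^-1).
Local Notation OO := (mx_ord_ge v).

Local Notation tw := (tw t).
Local Notation row_cross := (row_cross t).
Local Notation block_cross := (block_cross t).
Local Notation qsym := (qsym s t).
Local Notation fixes := (fixes t).
Local Notation carries := (carries t).
Local Notation qint := (qint s).

(** After division by s^(2k) the quantum integer is 1 + s^-2 + ... + s^(-2k), a
    unit at s = oo. *)
Lemma qint_geom_inv k :
  let u := qint k.+1 / s ^+ (2 * k) in v 0 u^-1 /\ u != 0.
Proof.
pose u k := qint k.+1 / s ^+ (2 * k); rewrite /= -/(u k).
have uS l : u l.+1 = 1 + z ^+ 2 * u l.
  rewrite /u qintSr mulrDl divff ?(oi_neq0X V) // addrC; congr (_ + _).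
  by rewrite mulnS exprD invfM exprVn mulrCA.
have u0 : u 0 = 1 by rewrite /u qint1 muln0 expr0 divr1.
have z2u l : v 0 (u l) -> v 1 (z ^+ 2 * u l).
  by move=> h; apply: (oiW V) (oiM V (oi_invX V 2) h).
have ui l : v 0 (u l).
  elim: l => [|l IH]; first by rewrite u0; apply: (oi1 V).
  by rewrite uS; apply: (oiD V); [apply: (oi1 V)|apply: (oiW V) (z2u _ IH)].
case: k => [|l]; first by rewrite u0 invr1 oner_neq0; split=> //; apply: (oi1 V).
by rewrite uS; apply: (oi_unit V); apply: z2u.
Qed.

Lemma qint_neq0 k : qint k.+1 != 0.
Proof. by have [_] := qint_geom_inv k; apply: contraNneq => ->; rewrite mul0r. Qed.

Lemma far_comm i j : (i.+1 < j)%N || (j.+1 < i)%N -> (i < m)%N -> (j < m)%N ->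
  t i * t j = t j * t i.
Proof.
by case/orP => h im jm; [apply: (hecke_far H)|apply: esym (hecke_far H h im)].
Qed.

Lemma far_comm_tw i w : (i < m)%N ->
  all (fun j => ((i.+1 < j)%N || (j.+1 < i)%N) && (j < m)%N) w ->
  t i * tw w = tw w * t i.
Proof.
move=> im; elim: w => [_|j w IH /= /andP[/andP[fj jm] wm]].
  by rewrite tw_nil mulr1 mul1r.
by rewrite !tw_cons mulrA far_comm // -mulrA IH // mulrA.
Qed.

(** A strand that crosses over a window slides the braids of that window one
    step along. *)
Lemma row_carries b k : (b + k <= m)%N -> carries (row_cross b k) b b.+1 k.
Proof.
move=> bk i ik.
have -> : k = (i + (2 + (k - i.+2)))%N by lia.
rewrite !row_crossD /= 2!row_crossS row_cross0 mulr1.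
set L := row_cross b i; set R := row_cross _ _.
have RC : t (b + i) * R = R * t (b + i).
  apply: far_comm_tw; first by lia.
  by apply/allP => j; rewrite mem_iota; lia.
have LC : t (b + i).+1 * L = L * t (b + i).+1.
  apply: far_comm_tw; first by lia.
  by apply/allP => j; rewrite mem_iota; lia.
rewrite -!mulrA -RC addSn !mulrA LC -(mulrA L) -(mulrA L).
by rewrite (hecke_braid H) ?mulrA //; lia.
Qed.

Lemma block_carries b a k : (b + a + k <= m.+1)%N ->
  carries (block_cross b a k) b (b + k) a.
Proof.
elim: k => [|k IH] h; first by rewrite addn0 block_cross0; apply: carries1.
rewrite addnS block_crossS; apply: carriesM (row_carries _); last by lia.
by apply: IH; lia.
Qed.

Lemma far_comm_block j b a k : (b + a + k <= j)%N -> (j < m)%N ->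
  t j * block_cross b a k = block_cross b a k * t j.
Proof.
move=> + jm; elim: k => [|k IH] h; first by rewrite block_cross0 mul1r mulr1.
rewrite block_crossS mulrA far_comm_tw //; last first.
  by apply/allP => i; rewrite mem_iota; lia.
rewrite -[LHS]mulrA IH; last by lia.
by rewrite mulrA.
Qed.

(** The strands crossed by the block slide the other way. *)
Lemma block_carries_under b a k : (b + a + k <= m.+1)%N ->
  carries (block_cross b a k) (b + a) b k.
Proof.
elim: k => [|k IH] h i ik; first by lia.
have [lt|ge] := ltnP i.+1 k.
  rewrite block_crossS -mulrA IH //; last by lia.
  rewrite !mulrA; congr (_ * _); apply: esym; apply: far_comm_tw; first by lia.
  by apply/allP => j; rewrite mem_iota; lia.
have {ge ik} ek : k = i.+1 by lia.
move: h; rewrite {}ek {IH k} => h.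
have C := carries_row (@row_carries (b + i) a.+1 ltac:(lia)).
rewrite !block_crossS -!mulrA -far_comm_block; try lia.
rewrite (_ : (b + a + i)%N = (b + i + a)%N); last by lia.
rewrite [LHS]mulrA [LHS]mulrA -[X in X * _ = _]mulrA -row_crossSr addnS -C row_crossS -!mulrA.
by [].
Qed.

Section Absorb.
Variables (b k : nat).
Hypothesis bk : (b + k <= m)%N.
Local Notation e j := (tw (desc b k j)).

Lemma desc_far i j : (i.+1 < k - j)%N -> (j <= k)%N -> e j * t (b + i) = t (b + i) * e j.
Proof.
move=> ij jk; apply: esym; apply: far_comm_tw; first by lia.
by apply/allP => l /mapP[l']; rewrite mem_iota => hl ->; lia.
Qed.

Lemma desc_slide i j : (k - j < i)%N -> (i < k)%N -> (j <= k)%N ->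
  e j * t (b + i) = t (b + i.-1) * e j.
Proof.
elim: j => [|j IH] ij ik jk; first by lia.
rewrite tw_descS.
have [lt|ge] := ltnP (k - j) i.
  rewrite -mulrA (far_comm (i := b + (k.-1 - j))) //; try lia.
  by rewrite mulrA IH ?mulrA //; lia.
case: j => [|j] in IH ij jk ge *; first by lia.
have ei : i = (k.-1 - j)%N by lia.
have ei' : (k.-1 - j.+1)%N = i.-1 by lia.
rewrite tw_descS -ei ei' -!mulrA.
have := hecke_braid H (i := b + i.-1); rewrite -addnS prednK; last by lia.
rewrite -!mulrA => <-; last by lia.
rewrite [LHS]mulrA desc_far; try lia.
by rewrite -!mulrA.
Qed.

(** Multiplied by a generator on the right, a coset representative either lets it
    slide through to the smaller window, whose projector absorbs it, or is
    exchanged with a neighbouring representative; the weights s^(2j) are those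
    for which the quadratic relation fixes such a pair. *)
Lemma qsym_fixesR_step :
  (forall i, (i.+1 < k)%N -> qsym b k * t (b + i) = qsym b k) ->
  forall i, (i < k)%N -> qsym b k.+1 * t (b + i) = qsym b k.+1.
Proof.
move=> IH i ik; rewrite qsymS -mulrA scMl mulr_suml !scMr; congr (_ *: _).
set p := qsym b k in IH *; rewrite !mulr_sumr.
have j1 : (k - i < k.+1)%N by lia.
have j2 : (k - i.+1 < k.+1)%N by lia.
have ne : Ordinal j2 != Ordinal j1 by rewrite -val_eqE /=; lia.
rewrite (bigD1 (Ordinal j1)) // (bigD1 (Ordinal j2)) //=.
rewrite [RHS](bigD1 (Ordinal j1)) //= [X in _ = _ + X](bigD1 (Ordinal j2)) //=.
rewrite !addrA; congr (_ + _); last first.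
  apply: eq_bigr => j /andP[]; rewrite -!val_eqE /= => ne1 ne2.
  rewrite scMl !scMr; congr (_ *: _); have := ltn_ord j => lj.
  have [lt|ge] := ltnP (k - j) i.
    by rewrite desc_slide // mulrA IH //; lia.
  by rewrite desc_far; [rewrite mulrA IH //; lia|lia|lia].
have -> : (k - i)%N = (k - i.+1).+1 by lia.
set j := (k - i.+1)%N; have ij : (k.-1 - j)%N = i by rewrite /j; lia.
rewrite !scMl tw_descS ij -[_ * t _ * t _]mulrA (hecke_sqr H); last by lia.
rewrite mulrDr !scMr mulr1 !mulrDr !scMr !scalerDr !scalerA addrAC.
rewrite -scalerDl; congr (_ *: _ + _ *: _).
  by rewrite mulnS exprD; have s0 := oi_neq0 V; field.
by rewrite mulnS exprD mulrC mulrA exprVn mulVf ?mul1r // (oi_neq0X V).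
Qed.

End Absorb.

Lemma qsym_fixesR b k i : (b + k <= m.+1)%N -> (i.+1 < k)%N ->
  qsym b k * t (b + i) = qsym b k.
Proof.
elim: k i => [|k IH] i // bk ik.
by apply: qsym_fixesR_step => //; [lia|move=> j jk; apply: IH; lia].
Qed.

Lemma tr_qsym_fixes b k : (b + k <= m.+1)%N -> fixes b k (qsym b k)^T.
Proof.
by move=> bk i ik; rewrite -(hecke_sym H) -?trM ?qsym_fixesR //; lia.
Qed.

(** Both the projector and its transpose absorb the window, one from the right
    and one from the left, so their product equals each of them. *)
Lemma tr_qsym b k : (b + k <= m.+1)%N -> (qsym b k)^T = qsym b k.
Proof.
move=> bk.
have E : qsym b k * (qsym b k)^T = (qsym b k)^T.
  by apply: (fixes_qsym qint_neq0) (tr_qsym_fixes bk).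
by have := congr1 trmx E; rewrite trM !trmxK E.
Qed.

Lemma qsym_fixes b k : (b + k <= m.+1)%N -> fixes b k (qsym b k).
Proof. by move=> bk; have := tr_qsym_fixes bk; rewrite tr_qsym. Qed.

Lemma qsym_absl b k c l : (b + k <= m.+1)%N -> (b <= c)%N -> (c + l <= b + k)%N ->
  qsym c l * qsym b k = qsym b k.
Proof. by move=> bk bc le; apply: (fixes_qsym qint_neq0) (qsym_fixes bk). Qed.

Lemma qsym_absr b k c l : (b + k <= m.+1)%N -> (b <= c)%N -> (c + l <= b + k)%N ->
  qsym b k * qsym c l = qsym b k.
Proof.
move=> bk bc le; have := congr1 trmx (qsym_absl bk bc le).
by rewrite trM !tr_qsym //; lia.
Qed.

Lemma qsym_idem b k : (b + k <= m.+1)%N -> qsym b k * qsym b k = qsym b k.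
Proof. by move=> bk; apply: qsym_absl. Qed.

Lemma qsym_tw_absr b k w : (b + k <= m.+1)%N ->
  all (fun i => (b <= i)%N && (i.+1 < b + k)%N) w -> qsym b k * tw w = qsym b k.
Proof.
move=> bk; elim: w => [_|i w IH /= /andP[/andP[bi ik] wk]]; first by rewrite tw_nil mulr1.
by rewrite tw_cons mulrA -(subnKC bi) qsym_fixesR ?IH //; lia.
Qed.

Lemma int_tw w : all (fun i => i < m)%N w -> OO 0 (tw w).
Proof. by move=> /allP wm; apply: (OO_prod V) => i iw; apply: (hecke_int H); apply: wm. Qed.

Lemma int_row b k : (b + k <= m)%N -> OO 0 (row_cross b k).
Proof. by move=> bk; apply: int_tw; apply/allP => i; rewrite mem_iota; lia. Qed.

Lemma int_block b a k : (b + a + k <= m.+1)%N -> OO 0 (block_cross b a k).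
Proof.
elim: k => [|k IH] h; first by rewrite block_cross0; apply: (OO1 V).
by rewrite block_crossS; apply: (OOMl V); [apply: int_row; lia|apply: IH; lia].
Qed.

Lemma qint_coef_sum k : \sum_(j < k.+1) s ^+ (2 * j) / qint k.+1 = 1.
Proof. by rewrite -mulr_suml divff ?qint_neq0. Qed.

Lemma oi_qint_coef k j : (j <= k)%N -> v (2 * (k - j))%N (s ^+ (2 * j) / qint k.+1).
Proof.
move=> jk; have [+ _] := qint_geom_inv k.
have -> : s ^+ (2 * j) / qint k.+1 = z ^+ (2 * (k - j)) * (qint k.+1 / s ^+ (2 * k))^-1.
  have kE : s ^+ (2 * k) = s ^+ (2 * (k - j)) * s ^+ (2 * j).
    by rewrite -exprD; congr (_ ^+ _); lia.
  by rewrite invf_div kE !mulrA exprVn mulVf ?mul1r // (oi_neq0X V).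
by move=> h; have := oiM V (oi_invX V (2 * (k - j))) h; rewrite addn0.
Qed.

Lemma all_desc b k j : (j <= k)%N -> (b + k <= m)%N -> all (fun i => i < m)%N (desc b k j).
Proof. by move=> jk bk; apply/allP => l /mapP[l']; rewrite mem_iota => hl ->; lia. Qed.

Lemma int_qsym b k : (b + k <= m.+1)%N -> OO 0 (qsym b k).
Proof.
elim: k => [|k IH] bk; first by rewrite qsym0; apply: (OO1 V).
rewrite qsymS scaler_sumr; apply: (OOMl V); first by apply: IH; lia.
apply: (OO_sum V) => j _; rewrite scalerA mulrC; have := ltn_ord j => jk.
apply: (OOZ V (d := 0) (e := 0)); last by apply: int_tw; apply: all_desc; lia.
by apply: (oiW V) (oi_qint_coef _).
Qed.

Lemma comm_lim i j : (i < m)%N -> (j < m)%N -> OO 1 (t i * t j - t j * t i).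
Proof.
move=> im jm; have [->|ne] := eqVneq i j; first by rewrite subrr; apply: (OO0 V).
have [E|n1] := eqVneq j i.+1; first by rewrite E in jm *; apply: (hecke_comm_lim H).
have [E|n2] := eqVneq i j.+1.
  by rewrite E in im *; rewrite -opprB; apply: (OON V); apply: (hecke_comm_lim H).
by rewrite far_comm ?subrr; [apply: (OO0 V)|lia|lia|lia].
Qed.

Lemma comm_lim_tw i w : (i < m)%N -> all (fun j => j < m)%N w ->
  OO 1 (t i * tw w - tw w * t i).
Proof.
move=> im; elim: w => [_|j w IH /= /andP[jm wm]].
  by rewrite tw_nil mulr1 mul1r subrr; apply: (OO0 V).
rewrite !tw_cons; apply: (OO_trans V (Y := t j * t i * tw w)).
  rewrite mulrA -mulrBl; apply: (OOMr V); first exact: comm_lim.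
  exact: int_tw.
by rewrite -!mulrA -mulrBr; apply: (OOMl V); [apply: (hecke_int H)|apply: IH].
Qed.

(** At s = oo the longest coset representative dominates the recursion, and the
    t_i commute, so it is absorbed except for its first letter. *)
Lemma qsym_lim b k : (b + k <= m)%N -> OO 1 (qsym b k.+1 - row_cross b k).
Proof.
elim: k => [|k IH] bk.
  rewrite row_cross0 qsymS qsym0 mul1r big_ord1 qint1 invr1 !scale1r tw_nil subrr.
  exact: (OO0 V).
rewrite row_crossSr; apply: (OO_trans V (Y := qsym b k.+1 * t (b + k))); last first.
  rewrite -mulrBl; apply: (OOMr V); first by apply: IH; lia.
  by apply: (hecke_int H); lia.
apply: (OO_trans V (Y := qsym b k.+1 * tw (desc b k.+1 k.+1))).
  rewrite qsymS -mulrBr; apply: (OOMl V); first by apply: int_qsym; lia.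
  have {1}-> : tw (desc b k.+1 k.+1) =
      \sum_(j < k.+2) (s ^+ (2 * j) / qint k.+2) *: tw (desc b k.+1 k.+1).
    by rewrite -scaler_suml qint_coef_sum scale1r.
  rewrite scaler_sumr -sumrB; apply: (OO_sum V) => j _.
  rewrite scalerA [_^-1 * _]mulrC -scalerBr; have := ltn_ord j => jk.
  have [->|ne] := eqVneq (j : nat) k.+1; first by rewrite subrr scaler0; apply: (OO0 V).
  apply: (OOZ V (d := 1) (e := 0)); first by apply: (oiW V) (oi_qint_coef _); lia.
  by apply: (OOB V); apply: int_tw; apply: all_desc; lia.
have -> : desc b k.+1 k.+1 = (b + k)%N :: desc b k k.
  rewrite /desc /= subn0; congr (_ :: _); rewrite -[1%N]addn0 iotaDl -map_comp.
  by apply/eq_in_map => i; rewrite mem_iota /=; lia.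
have E : qsym b k.+1 * tw (desc b k k) = qsym b k.+1.
  apply: qsym_tw_absr; first by lia.
  by apply/allP => l /mapP[l']; rewrite mem_iota => hl ->; lia.
rewrite tw_cons -{2}E -[X in _ - X]mulrA -mulrBr.
apply: (OOMl V); first by apply: int_qsym; lia.
apply: comm_lim_tw; first by lia.
by apply: all_desc; lia.
Qed.

(** In the limit each projector is the product of the commuting idempotents t_i
    of its window, so overlapping windows combine. *)
Lemma qsym_overlap b a k : (b + a + k <= m)%N ->
  OO 1 (qsym b a.+1 * qsym (b + a) k.+1 - qsym b (a + k).+1).
Proof.
move=> h; apply: (OO_trans V (Y := row_cross b (a + k))); last first.
  by rewrite -opprB; apply: (OON V); apply: qsym_lim; lia.
rewrite row_crossD.
apply: (OO_trans V (Y := row_cross b a * qsym (b + a) k.+1)).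
  by rewrite -mulrBl; apply: (OOMr V); [apply: qsym_lim; lia|apply: int_qsym; lia].
by rewrite -mulrBr; apply: (OOMl V); [apply: int_row; lia|apply: qsym_lim; lia].
Qed.

Lemma qsym_comm_far b k i : (b + k <= i)%N -> (i < m)%N ->
  t i * qsym b k = qsym b k * t i.
Proof.
move=> bi im; apply: carries_qsym => j jk.
by apply: far_comm; lia.
Qed.

(** All coset representatives but the trivial one lie in the double coset of
    t_(b+k), so only their total weight enters. *)
Lemma qsym_sandwich b k : (b + k.+1 <= m)%N ->
  qint k.+2 *: qsym b k.+2 =
  qsym b k.+1 + (qint k.+2 - 1) *: (qsym b k.+1 * t (b + k) * qsym b k.+1).
Proof.
move=> bk; set p := qsym b k.+1.
have -> : qsym b k.+2 = qsym b k.+2 * p by rewrite qsym_absr //; lia.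
rewrite qsymS scMr -scMl scalerA divff ?qint_neq0 // scale1r -mulrA mulr_suml.
rewrite big_ord_recl expr0 scale1r tw_nil mul1r mulrDr qsym_idem; last by lia.
congr (_ + _); rewrite (_ : qint k.+2 - 1 = \sum_(j < k.+1) s ^+ (2 * j.+1)); last first.
  by rewrite /qint big_ord_recl expr0 addrC addKr.
rewrite scaler_suml mulr_sumr; apply: eq_bigr => j _; rewrite scMl scMr.
congr (_ *: _); rewrite -mulrA; congr (_ * _).
have -> : desc b k.+1 (lift ord0 j) = (b + k)%N :: desc b k j.
  rewrite /desc /= subn0; congr (_ :: _); rewrite -[1%N]addn0 iotaDl -map_comp.
  by apply/eq_in_map => i; rewrite mem_iota /=; lia.
rewrite tw_cons -mulrA; congr (_ * _); apply: (fixes_tw (b := b) (k := k.+1)).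
  by apply: qsym_fixes; lia.
by apply/allP => l /mapP[l']; rewrite mem_iota => hl ->; have := ltn_ord j; lia.
Qed.

(** One strand encircling [k] symmetrized ones: on Sym^k V (x) V this has the
    eigenvalues 1 and s^-(2k+2).  In the induction on [k] the inner strands are
    replaced by their projector, and [qsym_sandwich] evaluates the products of
    p and t that are left. *)
Lemma encircle b k : (b + k <= m)%N ->
  qsym b k * (row_cross b k)^T * row_cross b k * qsym b k =
  (1 - z ^+ (2 * k.+1)) *: qsym b k.+1 + z ^+ (2 * k.+1) *: qsym b k.
Proof.
elim: k => [|k IH] bk.
  rewrite row_cross0 tr1 qsymS qsym0 !mulr1 mul1r big_ord1 qint1 invr1 !scale1r tw_nil.
  by rewrite -scalerDl subrK scale1r.
have {}IH := IH ltac:(lia).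
set p := qsym b k.+1 in IH *; set p0 := qsym b k in IH; set tt := t (b + k).
have pp0 : p * p0 = p by rewrite qsym_absr //; lia.
have p0p : p0 * p = p by rewrite qsym_absl //; lia.
have tp0 : tt * p0 = p0 * tt by apply: qsym_comm_far; lia.
have pp : p * p = p by apply: qsym_idem; lia.
rewrite row_crossSr trM (hecke_sym H); last by lia.
rewrite -{1}pp0 -{2}p0p -/tt.
have -> : p * p0 * (tt * (row_cross b k)^T) * (row_cross b k * tt) * (p0 * p) =
   p * tt * (p0 * (row_cross b k)^T * row_cross b k * p0) * tt * p.
  have L Y : p * p0 * (tt * Y) = p * tt * p0 * Y by rewrite -(mulrA p tt) tp0 !mulrA.
  have R Y : Y * tt * (p0 * p) = Y * p0 * tt * p.
    by rewrite -(mulrA Y tt) (mulrA tt) tp0 !mulrA.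
  by rewrite L (mulrA _ (row_cross b k) tt) R !mulrA.
rewrite IH mulrDr !mulrDl !scMr !scMl.
have -> : p * tt * p0 * tt * p = p * (tt * tt) * p.
  by rewrite -[p * tt * p0]mulrA tp0 mulrA pp0 !mulrA.
have S0 : qint k.+2 - 1 != 0.
  by rewrite qintS addrC addKr mulf_neq0 ?(oi_neq0X V) ?qint_neq0.
have sw := qsym_sandwich (b := b) (k := k) bk.
have {}sw : p * tt * p = (qint k.+2 - 1)^-1 *: (qint k.+2 *: qsym b k.+2 - p).
  by rewrite sw addrAC subrr add0r scalerA mulVf // scale1r.
have pp' : qsym b k.+2 * (tt * p) = qsym b k.+2.
  by rewrite mulrA qsym_fixesR ?qsym_absr //; lia.
have -> : p * tt * p * tt * p = p * tt * p * (tt * p) by rewrite !mulrA.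
rewrite {1}sw scMl mulrBl scMl pp' (mulrA p tt p) sw (hecke_sqr H); last by lia.
rewrite mulrDr mulrDl !scMr !scMl mulr1 pp sw.
move: (qsym b k.+2) => P.
have s0 := oi_neq0 V.
have s2 : s ^+ 2 - 1 != 0 := oi_sqr_neq1 V.
have w0 : s ^+ (2 * k.+1) != 0 := oi_neq0X V _.
have S1 : qint k.+1 = (s ^+ (2 * k.+1) - 1) / (s ^+ 2 - 1).
  by rewrite -qint_geom mulrC mulKf.
have w1 : s ^+ (2 * k.+1) - 1 != 0 by rewrite -qint_geom mulf_neq0 ?qint_neq0.
rewrite [(2 * k.+2)%N]mulnS exprD !exprVn qintS S1.
move: (s ^+ (2 * k.+1)) w0 w1 => w w0 w1.
apply/matrixP => i j; rewrite !mxE; field.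
rewrite w0 s0 s2 /=; have -> : s ^+ 2 - 1 + s ^+ 2 * (w - 1) + -1 * (s ^+ 2 - 1) = s ^+ 2 * (w - 1) by ring.
by rewrite mulf_neq0 ?expf_neq0.
Qed.

End HeckeTheory.

(** * Crossings of symmetrized blocks *)

Section Crossings.
Variables (F : fieldType) (s : F) (v : nat -> F -> Prop).
Hypothesis V : order_at_infinity s v.
Variables (D m : nat) (t : nat -> 'M[F]_D).
Hypothesis H : hecke_rep s v m t.
Local Notation z := (s^-1).
Local Notation OO := (mx_ord_ge v).

Local Notation tw := (tw t).
Local Notation row_cross := (row_cross t).
Local Notation block_cross := (block_cross t).
Local Notation qsym := (qsym s t).
Local Notation fixes := (fixes t).
Local Notation carries := (carries t).

Lemma qsym_row_absr b k c l : (b + k <= m.+1)%N -> (b <= c)%N -> (c + l < b + k)%N ->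
  qsym b k * row_cross c l = qsym b k.
Proof.
move=> bk bc le; apply: (qsym_tw_absr V H) => //.
by apply/allP => i; rewrite mem_iota; lia.
Qed.

Lemma qsym_commute b k c l : (b + k <= c)%N -> (c + l <= m.+1)%N ->
  qsym b k * qsym c l = qsym c l * qsym b k.
Proof.
move=> bc cl; apply: carries_qsym => i il.
by apply: esym; apply: (qsym_comm_far H); lia.
Qed.

(** The Gram matrix of the difference is, by [encircle], s^-(2k+2) times the
    difference of the two projectors. *)
Lemma row_cross_qsym b k : (b + k <= m)%N ->
  OO k.+1 (row_cross b k * qsym b k - qsym b k.+1).
Proof.
move=> bk; apply: (OO_gram V); set p := qsym b k; set p' := qsym b k.+1.
set x := row_cross b k.
have pp' : p * p' = p' by apply: (qsym_absl V H); lia.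
have p'p : p' * p = p' by apply: (qsym_absr V H); lia.
have p'x : p' * x = p' by apply: qsym_row_absr; lia.
have xp' : x^T * p' = p'.
  have := congr1 trmx p'x; rewrite /p' trM (tr_qsym V H) //; lia.
have -> : (x * p - p')^T * (x * p - p') = z ^+ (2 * k.+1) *: (p - p').
  have pT : p^T = p by apply: (tr_qsym V H); lia.
  have p'T : p'^T = p' by apply: (tr_qsym V H); lia.
  have pp : p * p = p by apply: (qsym_idem V H); lia.
  have p'p' : p' * p' = p' by apply: (qsym_idem V H); lia.
  rewrite trB trM pT p'T mulrBl !mulrBr !mulrA (encircle V H) //.
  rewrite -[p * _ * p']mulrA xp' pp' p'x p'p p'p'.
  by apply/matrixP => i j; rewrite !mxE; ring.
have h : OO 0 (p - p') by apply: (OOB V); apply: (int_qsym V H); lia.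
by have := OOZ V (oi_invX V (2 * k.+1)) h; rewrite addn0 mul2n.
Qed.

(** On Sym^a (x) Sym^k the positive crossing has eigenvalue 1 on Sym^(a+k) and is
    small on the other summands.

    In the induction on [k], the crossing with one strand more is the crossing of
    all a + k symmetrized strands with one strand, up to the error Y of the
    preceding step.  The main part is estimated by [row_cross_qsym].  The error is
    carried one strand further, to a Y' with Y' P' = 0 for the full projector P';
    hence it is only multiplied by the difference of P' and a product of
    operators that agrees with P' at s = oo, and gains one order. *)
Lemma block_cross_qsym b a k : (0 < a)%N -> (b + a + k <= m.+1)%N ->
  OO (a + k) (block_cross b a k * (qsym b a * qsym (b + a) k) - qsym b (a + k)).
Proof.
move=> a0; elim: k b => [|k IH] b h.
  by rewrite addn0 block_cross0 qsym0 mul1r mulr1 subrr; apply: (OO0 V).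
pose Y c := block_cross c a k * (qsym c a * qsym (c + a) k) - qsym c (a + k).
have Yb : OO (a + k) (Y b.+1) by apply: IH; lia.
rewrite addnS; set P' := qsym b (a + k).+1.
set pa := qsym b a; set q := qsym (b + a) k.+1; set q0 := qsym (b + a) k.
set po := qsym b k.+1; set R := row_cross b (a + k); set P := qsym b (a + k).
have paq : pa * q = q * pa by apply: qsym_commute; lia.
have paq0 : pa * q0 = q0 * pa by apply: qsym_commute; lia.
have q0q : q0 * q = q by apply: (qsym_absl V H); lia.
have qq : q * q = q by apply: (qsym_idem V H); lia.
have papa : pa * pa = pa by apply: (qsym_idem V H); lia.
have Ppa : P * pa = P by apply: (qsym_absr V H); lia.
have YE : block_cross b a k * (pa * q0) = P + Y b by rewrite /Y addrC subrK.
(* The crossings of the new strand with the [k] others are absorbed by po; what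
   is left of R is its crossing with the [a] strands. *)
have VE : block_cross b a k.+1 * (pa * q) = po * R * ((P + Y b) * q).
  have C : block_cross b a k.+1 * q = po * block_cross b a k.+1.
    by apply: carries_qsym; apply: (block_carries_under H).
  rewrite -YE -(mulrA _ _ q) -(mulrA pa) q0q /R [(a + k)%N]addnC row_crossD !mulrA.
  rewrite [po * _]qsym_row_absr; try lia.
  rewrite -(mulrA po) -block_crossS -C -!mulrA; congr (_ * _).
  by rewrite paq mulrA qq.
(* Y b.+1 is a difference of two operators that fix P'. *)
have YP : Y b.+1 * P' = 0.
  have fixP := qsym_fixes V H (b := b) (k := (a + k).+1) ltac:(lia).
  rewrite /Y mulrBl -!mulrA.
  rewrite (fixes_qsym (qint_neq0 V) (b := b) (k := (a + k).+1) (c := b.+1 + a)) //; try lia.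
  rewrite (fixes_qsym (qint_neq0 V) (b := b) (k := (a + k).+1) (l := a)) //; try lia.
  rewrite (fixes_block (b := b) (k := (a + k).+1)) //; try lia.
  by rewrite (fixes_qsym (qint_neq0 V) (b := b) (k := (a + k).+1)) ?subrr //; lia.
have RC : carries R b b.+1 (a + k) by apply: (row_carries H); lia.
have RY : R * Y b = Y b.+1 * R.
  have RCk : carries R (b + a) (b.+1 + a) k by apply: carries_shift RC; lia.
  have RCa : carries R b b.+1 a by apply: carriesW RC; lia.
  rewrite /Y mulrBr mulrBl (carries_qsym s RC) (mulrA R) (carries_block RC).
  rewrite -(mulrA _ R) (mulrA R) (carries_qsym s RCa) -(mulrA _ R).
  by rewrite (carries_qsym s RCk) !mulrA.
have Yq : R * (Y b * q) = Y b.+1 * (row_cross b a * pa * q).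
  have Yqp : Y b * q = Y b * q * pa.
    rewrite -mulrA -paq mulrA; congr (_ * _).
    by rewrite /Y mulrBl Ppa -!mulrA -/q0 -/pa -paq0 (mulrA pa pa) papa.
  have Rq : R * q = row_cross b a * q.
    rewrite /R row_crossD -mulrA; congr (_ * _).
    apply: (fixes_row (b := b + a) (k := k.+1)); try lia.
    by apply: (qsym_fixes V H); lia.
  by rewrite Yqp !mulrA RY -(mulrA (Y _)) Rq !mulrA -(mulrA _ q) -paq !mulrA.
rewrite VE mulrDl mulrDr addrAC; apply: (OOD V).
  have -> : po * R * (P * q) - P' = po * (R * P - P') * q.
    rewrite mulrBr mulrBl !mulrA; congr (_ - _).
    rewrite [po * P'](qsym_absl V H); try lia.
    by rewrite (qsym_absr V H) //; lia.
  apply: (OOMr V); last by apply: (int_qsym V H); lia.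
  apply: (OOMl V); first by apply: (int_qsym V H); lia.
  by apply: row_cross_qsym; lia.
rewrite -mulrA Yq; apply: (OOMl V); first by apply: (int_qsym V H); lia.
have -> : row_cross b a * pa * q =
    (row_cross b a * pa - qsym b a.+1) * q + (qsym b a.+1 * q - P') + P'.
  by rewrite mulrBl !addrA !subrK.
rewrite mulrDr YP addr0 -addn1; apply: (OOM V) => //; apply: (OOD V).
  apply: (OOMr V); last by apply: (int_qsym V H); lia.
  by apply: (OOW V) (row_cross_qsym _); lia.
by apply: (qsym_overlap V H); lia.
Qed.

End Crossings.

(** * Words in the cabled generators *)

(** Rewriting with the relations of the 0-Hecke monoid: those of the braid group
    and the idempotence of the generators. *)
Inductive demazure : seq nat -> seq nat -> Prop :=
| dem_refl w : demazure w w
| dem_trans w1 w2 w3 : demazure w1 w2 -> demazure w2 w3 -> demazure w1 w3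
| dem_idem u w i : demazure (u ++ i :: i :: w) (u ++ i :: w)
| dem_braid u w i :
    demazure (u ++ [:: i.+1, i, i.+1 & w]) (u ++ [:: i, i.+1, i & w])
| dem_far u w i j : (i.+1 < j)%N || (j.+1 < i)%N ->
    demazure (u ++ [:: i, j & w]) (u ++ [:: j, i & w]).

Lemma demazure_cat u w w' v : demazure w w' -> demazure (u ++ w ++ v) (u ++ w' ++ v).
Proof.
elim=> {w w'} [w|w1 w2 w3 _ h1 _ h2|x y i|x y i|x y i j ij].
- exact: dem_refl.
- exact: dem_trans h1 h2.
- by rewrite -!catA !catA -!(catA (u ++ x)); apply: dem_idem.
- by rewrite -!catA !catA -!(catA (u ++ x)); apply: dem_braid.
- by rewrite -!catA !catA -!(catA (u ++ x)); apply: dem_far.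
Qed.

Lemma demazure_catl u w w' : demazure w w' -> demazure (u ++ w) (u ++ w').
Proof. by move/(demazure_cat u [::]); rewrite !cats0. Qed.

Lemma demazure_catr w w' v : demazure w w' -> demazure (w ++ v) (w' ++ v).
Proof. by move/(demazure_cat [::] v). Qed.

Lemma demazure_mem w w' : demazure w w' -> w =i w'.
Proof.
elim=> {w w'} [w|w1 w2 w3 _ h1 _ h2|x y i|x y i|x y i j ij] k //.
- by rewrite h1 h2.
- by rewrite !mem_cat !inE; case: (k == i); rewrite ?orbT.
- by rewrite !mem_cat !inE; case: (k == i); case: (k == i.+1); rewrite ?orbT.
- by rewrite !mem_cat !inE; case: (k == i); case: (k == j); rewrite ?orbT.
Qed.

Lemma demazure_far_word u i : all (fun j => (j.+1 < i)%N) u ->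
  demazure (i :: u) (rcons u i) /\ demazure (rcons u i) (i :: u).
Proof.
elim: u => [_|j u IH /= /andP[ji ui]]; first by split; apply: dem_refl.
have [h1 h2] := IH ui; split.
  apply: dem_trans (demazure_catl [:: j] h1).
  by apply: (@dem_far [::] u i j); rewrite ji orbT.
apply: dem_trans (demazure_catl [:: j] h2) _.
by apply: (@dem_far [::] u j i); rewrite ji.
Qed.

(** Between two occurrences of the last generator there is a word in the smaller
    ones, where by induction the one before the last occurs at most once; after
    commutations, an idempotence or a braid relation merges the two. *)
Lemma demazure_last_once n w : all (fun i => i < n.+1)%N w ->
  (exists2 w', demazure w w' & all (fun i => i < n)%N w') \/
  (exists u v, [/\ demazure w (u ++ n :: v), all (fun i => i < n)%N u
                 & all (fun i => i < n)%N v]).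
Proof.
elim: n w => [|n IHn] w.
  elim: w => [_|l w IHw /= /andP[l0 wn]]; first by left; exists [::] => //; apply: dem_refl.
  have -> : l = 0%N by lia.
  right; exists [::], [::]; split=> //=.
  have nil0 x : all (fun i => i < 0)%N x -> x = [::] by case: x.
  have [[w' h /nil0 w'0]|[u [v [h /nil0 u0 /nil0 v0]]]] := IHw wn.
    by rewrite w'0 in h; apply: (demazure_catl [:: 0%N] h).
  rewrite u0 v0 in h.
  by apply: dem_trans (demazure_catl [:: 0%N] h) (@dem_idem [::] [::] 0%N).
elim: w => [_|l w IHw /= /andP[ln wn]]; first by left; exists [::] => //; apply: dem_refl.
have {IHw wn} [[w' hw wn]|[u [v [hw un vn]]]] := IHw wn.
  have [e|ne] := eqVneq l n.+1.
    by right; exists [::], w'; split=> //; rewrite e; apply: (demazure_catl [:: n.+1] hw).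
  left; exists (l :: w'); first exact: (demazure_catl [:: l] hw).
  by rewrite /= wn andbT; lia.
right; have [e|ne] := eqVneq l n.+1; last first.
  exists (l :: u), v; split=> //; first exact: (demazure_catl [:: l] hw).
  by rewrite /= un andbT; lia.
have {e hw} hl : demazure (l :: w) (n.+1 :: u ++ n.+1 :: v).
  by rewrite e; apply: (demazure_catl [:: n.+1] hw).
(* u stands between the two occurrences of n.+1. *)
have [[u' hu u'n]|[u1 [u2 [hu u1n u2n]]]] := IHn u un.
  have [_ far] := @demazure_far_word u' n.+1 u'n.
  exists u', v; split=> //; last by apply: sub_all u'n => i; lia.
  apply: dem_trans hl _.
  apply: dem_trans (demazure_cat [:: n.+1] (n.+1 :: v) hu) _.
  have [far' _] := @demazure_far_word u' n.+1 u'n.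
  have := demazure_catr (n.+1 :: v) far'; rewrite cat_rcons => h.
  by apply: dem_trans h _; apply: dem_idem.
have [far1 _] := @demazure_far_word u1 n.+1 u1n.
have [far2 back2] := @demazure_far_word u2 n.+1 u2n.
exists (u1 ++ [:: n]), (n :: u2 ++ v); split.
- apply: dem_trans hl _.
  apply: dem_trans (demazure_cat [:: n.+1] (n.+1 :: v) hu) _.
  have h1 := demazure_catr (n :: u2 ++ n.+1 :: v) far1.
  rewrite cat_rcons /= in h1; rewrite -!catA /=.
  apply: dem_trans h1 _.
  have h2 := demazure_catl (u1 ++ [:: n.+1; n]) (demazure_catr v back2).
  rewrite cat_rcons -!catA /= in h2.
  by apply: dem_trans h2 _; apply: dem_braid.
- by rewrite all_cat /= ltnSn !andbT; apply: sub_all u1n => i; lia.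
- by rewrite /= ltnSn all_cat vn andbT /=; apply: sub_all u2n => i; lia.
Qed.

Section CabledWords.
Variables (F : fieldType) (s : F) (v : nat -> F -> Prop).
Hypothesis V : order_at_infinity s v.
Variables (D m : nat) (t : nat -> 'M[F]_D).
Hypothesis H : hecke_rep s v m t.
Variable r : nat.
Hypothesis r0 : (0 < r)%N.
Local Notation OO := (mx_ord_ge v).
Local Notation block_cross := (block_cross t).
Local Notation qsym := (qsym s t).
Local Notation carries := (carries t).
Local Notation row_cross := (row_cross t).

Definition cable_gen i := block_cross (i * r) r r.
Definition cable_word w := \prod_(i <- w) cable_gen i.
Definition block_proj n := \prod_(i <- iota 0 n) qsym (i * r) r.

Lemma block_crossD b a k l :
  block_cross b a (k + l) = block_cross (b + k) a l * block_cross b a k.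
Proof.
elim: l => [|l IH]; first by rewrite addn0 block_cross0 mul1r.
by rewrite addnS !block_crossS IH mulrA addnA.
Qed.

Lemma far_comm_block_low j b a k : (j.+1 < b)%N -> (b + a + k <= m.+1)%N ->
  t j * block_cross b a k = block_cross b a k * t j.
Proof.
move=> jb; elim: k => [|k IH] h; first by rewrite block_cross0 mul1r mulr1.
rewrite block_crossS mulrA (far_comm_tw H); [|lia|]; last first.
  by apply/allP => i; rewrite mem_iota; lia.
by rewrite -[LHS]mulrA IH ?mulrA //; lia.
Qed.

Lemma cable_braid i : (i.+3 * r <= m.+1)%N ->
  cable_gen i.+1 * cable_gen i * cable_gen i.+1 =
  cable_gen i * cable_gen i.+1 * cable_gen i.
Proof.
move=> h; have e : (i.+1 * r)%N = (i * r + r)%N by rewrite mulSn addnC.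
rewrite /cable_gen e -block_crossD -[RHS]mulrA -block_crossD.
by apply: carries_block; apply: (block_carries_under H); rewrite !mulSn in h; lia.
Qed.

Lemma cable_far i j : (i.+1 < j)%N -> (j.+2 * r <= m.+1)%N ->
  cable_gen j * cable_gen i = cable_gen i * cable_gen j.
Proof.
move=> ij h; apply: carries_block => k kr; apply: esym.
have : (i.+2 * r <= j * r)%N by rewrite leq_mul2r ij orbT.
by move=> le; rewrite !mulSn in h le; apply: far_comm_block_low; lia.
Qed.

Lemma cable_qsym_far i j : (j != i)%N -> (j != i.+1)%N -> (i.+2 * r <= m.+1)%N ->
  (j.+1 * r <= m.+1)%N -> cable_gen i * qsym (j * r) r = qsym (j * r) r * cable_gen i.
Proof.
move=> n1 n2 h1 h2; apply: carries_qsym => k kr; apply: esym.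
have [lt|ge] := ltnP j i.
  have le : (j.+1 * r <= i * r)%N by rewrite leq_mul2r lt orbT.
  by rewrite !mulSn in h1 h2 le; apply: far_comm_block_low; lia.
have le : (i.+2 * r <= j * r)%N by rewrite leq_mul2r; lia.
by rewrite !mulSn in h1 h2 le; apply: (far_comm_block H); lia.
Qed.

Lemma block_proj_split n i : (i.+1 < n)%N -> block_proj n =
  \prod_(j <- iota 0 i) qsym (j * r) r * (qsym (i * r) r * qsym (i * r + r) r) *
  \prod_(j <- iota i.+2 (n - i.+2)) qsym (j * r) r.
Proof.
move=> le; rewrite /block_proj -{1}(subnKC le) -[i.+2]addn2 !iotaD !big_cat /=.
by rewrite big_cons big_seq1 mulSn [(r + _)%N]addnC addn2.
Qed.

Lemma cable_qsym2 i : (i.+2 * r <= m.+1)%N ->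
  cable_gen i * (qsym (i * r) r * qsym (i * r + r) r) =
  qsym (i * r) r * qsym (i * r + r) r * cable_gen i.
Proof.
rewrite !mulSn => h; rewrite mulrA.
have -> : cable_gen i * qsym (i * r) r = qsym (i * r + r) r * cable_gen i.
  by apply: carries_qsym; apply: (block_carries H); lia.
rewrite -mulrA.
have -> : cable_gen i * qsym (i * r + r) r = qsym (i * r) r * cable_gen i.
  by apply: carries_qsym; apply: (block_carries_under H); lia.
by rewrite mulrA [in RHS](qsym_commute H) //; lia.
Qed.

Lemma comm_prod (X : 'M[F]_D) (I : eqType) (l : seq I) (f : I -> 'M[F]_D) :
  (forall i, i \in l -> X * f i = f i * X) ->
  X * \prod_(i <- l) f i = \prod_(i <- l) f i * X.
Proof.
elim: l => [|i l IH] h; first by rewrite big_nil mulr1 mul1r.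
rewrite big_cons mulrA h ?mem_head // -!mulrA IH // => j jl.
by rewrite h // inE jl orbT.
Qed.

Lemma cable_proj n i : (i.+1 < n)%N -> (n * r <= m.+1)%N ->
  cable_gen i * block_proj n = block_proj n * cable_gen i.
Proof.
move=> lt h.
have bnd j : (j < n)%N -> (j.+1 * r <= m.+1)%N.
  by move=> jn; apply: leq_trans h; rewrite leq_mul2r jn orbT.
have far (l : seq nat) : all (fun j => [&& j != i, j != i.+1 & j < n])%N l ->
    cable_gen i * \prod_(j <- l) qsym (j * r) r = \prod_(j <- l) qsym (j * r) r * cable_gen i.
  move=> /allP ln; apply: comm_prod => j /ln /and3P[n1 n2 jn].
  by apply: cable_qsym_far => //; apply: bnd.
rewrite (block_proj_split lt) -(mulrA (_ * _)) [in LHS]mulrA.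
rewrite [in LHS]mulrA far; last by apply/allP => j; rewrite mem_iota; lia.
rewrite -(mulrA _ (cable_gen i)) cable_qsym2; last exact: bnd.
rewrite -!mulrA far //; by apply/allP => j; rewrite mem_iota; lia.
Qed.

Lemma cable_word_proj n w : all (fun i => i.+1 < n)%N w -> (n * r <= m.+1)%N ->
  cable_word w * block_proj n = block_proj n * cable_word w.
Proof.
move=> /allP wn h; apply: esym; apply: comm_prod => i iw; apply: esym.
by apply: cable_proj => //; apply: wn.
Qed.

Lemma int_cable_word n w : all (fun i => i.+1 < n)%N w -> (n * r <= m.+1)%N ->
  OO 0 (cable_word w).
Proof.
move=> /allP wn h; apply: (OO_prod V) => i /wn lt; apply: (int_block V H).
have : (i.+2 * r <= n * r)%N by rewrite leq_mul2r lt orbT.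
by rewrite !mulSn; lia.
Qed.

Lemma int_proj_part n (l : seq nat) : all (fun i => i < n)%N l -> (n * r <= m.+1)%N ->
  OO 0 (\prod_(i <- l) qsym (i * r) r).
Proof.
move=> /allP wn h; apply: (OO_prod V) => i /wn lt; apply: (int_qsym V H).
have : (i.+1 * r <= n * r)%N by rewrite leq_mul2r lt orbT.
by rewrite !mulSn; lia.
Qed.

(** To the order s^(-2r) = q^-r a crossing of two symmetrized blocks of [r]
    strands is a projector, by [block_cross_qsym], hence idempotent. *)
Lemma cable_idem n i : (i.+1 < n)%N -> (n * r <= m.+1)%N ->
  OO r.*2 ((cable_gen i * cable_gen i - cable_gen i) * block_proj n).
Proof.
move=> lt h.
have bnd j : (j < n)%N -> (j.+1 * r <= m.+1)%N.
  by move=> jn; apply: leq_trans h; rewrite leq_mul2r jn orbT.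
have h2 := bnd _ lt; rewrite !mulSn in h2.
rewrite (block_proj_split lt) !mulrA.
set A := \prod_(j <- iota 0 i) _; set B := \prod_(j <- _) _.
have cA : cable_gen i * A = A * cable_gen i.
  apply: comm_prod => j; rewrite mem_iota => ji.
  by apply: (@cable_qsym_far i j); [lia|lia|exact: bnd|apply: bnd; lia].
have -> : (cable_gen i * cable_gen i - cable_gen i) * A =
          A * (cable_gen i * cable_gen i - cable_gen i).
  by rewrite mulrBl mulrBr -mulrA cA mulrA cA -mulrA.
apply: (OOMr V); last first.
  by apply: (int_proj_part (n := n)) => //; apply/allP => j; rewrite mem_iota; lia.
rewrite -!mulrA; apply: (OOMl V).
  by apply: (int_proj_part (n := n)) => //; apply/allP => j; rewrite mem_iota; lia.
have Y := @block_cross_qsym _ _ _ V _ _ _ H (i * r) r r r0 ltac:(lia).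
rewrite addnn in Y; rewrite -/(cable_gen i) in Y.
set pp := qsym _ _ * qsym _ _ in Y *; set P := qsym _ _ in Y.
have cP : cable_gen i * P = P.
  apply: (fixes_block (b := (i * r)%N) (k := r.*2)); try lia.
  by apply: (qsym_fixes V H); lia.
have -> : (cable_gen i * cable_gen i - cable_gen i) * pp =
    cable_gen i * (cable_gen i * pp - P) - (cable_gen i * pp - P).
  by rewrite mulrBl mulrBr cP -mulrA opprB addrA subrK.
apply: (OOB V) => //; apply: (OOMl V) => //.
by apply: (int_block V H); lia.
Qed.

(** Cabling preserves the braid relations exactly; only the idempotence of the
    generators costs an error. *)
Lemma cable_demazure n w w' : demazure w w' -> all (fun i => i.+1 < n)%N w ->
  (n * r <= m.+1)%N ->
  OO r.*2 ((cable_word w - cable_word w') * block_proj n).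
Proof.
move=> h wn nm; elim: h wn => {w w'}
  [w|w1 w2 w3 h12 IH1 h23 IH2|u w i|u w i|u w i j far] wn.
- by rewrite subrr mul0r; apply: (OO0 V).
- have w2n : all (fun i => i.+1 < n)%N w2.
    apply/allP => i iw; apply: (allP wn); by rewrite (demazure_mem h12).
  have := OOD V (IH1 wn) (IH2 w2n).
  by rewrite -mulrDl addrA subrK.
- move: wn; rewrite all_cat /= => /andP[un /andP[lt /andP[_ wn]]].
  rewrite /cable_word !big_cat !big_cons /= -/(cable_word u) -/(cable_word w).
  have -> : cable_word u * (cable_gen i * (cable_gen i * cable_word w)) -
      cable_word u * (cable_gen i * cable_word w) =
      cable_word u * (cable_gen i * cable_gen i - cable_gen i) * cable_word w.
    by rewrite mulrBr mulrBl !mulrA.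
  rewrite -mulrA (cable_word_proj wn nm) mulrA; apply: (OOMr V).
    rewrite -mulrA; apply: (OOMl V); last exact: cable_idem.
    exact: int_cable_word un nm.
  exact: int_cable_word wn nm.
- move: wn; rewrite all_cat /= => /andP[un /andP[lt _]].
  rewrite /cable_word !big_cat !big_cons /=.
  have E W : cable_gen i.+1 * (cable_gen i * (cable_gen i.+1 * W)) =
             cable_gen i * (cable_gen i.+1 * (cable_gen i * W)).
    by rewrite !mulrA cable_braid //; apply: leq_trans nm; rewrite leq_mul2r lt orbT.
  by rewrite E subrr mul0r; apply: (OO0 V).
- move: wn; rewrite all_cat /= => /andP[un /and3P[it jt _]].
  rewrite /cable_word !big_cat !big_cons /=.
  have E : cable_gen i * cable_gen j = cable_gen j * cable_gen i.
    have bi : (i.+2 * r <= m.+1)%N by apply: leq_trans nm; rewrite leq_mul2r it orbT.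
    have bj : (j.+2 * r <= m.+1)%N by apply: leq_trans nm; rewrite leq_mul2r jt orbT.
    by case/orP: far => far; [apply: esym|]; apply: cable_far.
  by rewrite (mulrA (cable_gen i)) E -mulrA subrr mul0r; apply: (OO0 V).
Qed.

End CabledWords.

(** * The tensor representation *)

Notation states N m := {ffun 'I_m.+1 -> 'I_N}.

Section Kernels.
Variables (F : fieldType) (T : finType).

Definition ent (X : 'M[F]_#|T|) (f g : T) := X (enum_rank f) (enum_rank g).

Definition mxker (k : T -> T -> F) : 'M[F]_#|T| :=
  \matrix_(i, j) k (enum_val i) (enum_val j).

Definition mxact (X : 'M[F]_#|T|) (v : T -> F) (f : T) := \sum_g ent X f g * v g.

Lemma ent_ker k f g : ent (mxker k) f g = k f g.
Proof. by rewrite /ent mxE !enum_rankK. Qed.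

Lemma entM (X Y : 'M_#|T|) f g : ent (X * Y) f g = \sum_h ent X f h * ent Y h g.
Proof.
rewrite /ent mxME (reindex (@enum_rank T)) //.
by apply: onW_bij; apply: enum_rank_bij.
Qed.

Lemma ent1 f g : ent 1 f g = (f == g)%:R.
Proof. by rewrite /ent mxE (inj_eq enum_rank_inj). Qed.

Lemma entD X Y f g : ent (X + Y) f g = ent X f g + ent Y f g.
Proof. by rewrite /ent mxE. Qed.

Lemma entB X Y f g : ent (X - Y) f g = ent X f g - ent Y f g.
Proof. by rewrite /ent !mxE. Qed.

Lemma entZ a X f g : ent (a *: X) f g = a * ent X f g.
Proof. by rewrite /ent mxE. Qed.

Lemma ent_inj X Y : (forall f g, ent X f g = ent Y f g) -> X = Y.
Proof.
by move=> h; apply/matrixP => i j; have := h (enum_val i) (enum_val j); rewrite /ent !enum_valK.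
Qed.

Lemma eq_mxact X v w f : v =1 w -> mxact X v f = mxact X w f.
Proof. by move=> e; apply: eq_bigr => g _; rewrite e. Qed.

Lemma mxactM X Y v f : mxact (X * Y) v f = mxact X (mxact Y v) f.
Proof.
rewrite /mxact; under eq_bigr => g _ do rewrite entM mulr_suml.
rewrite exchange_big; apply: eq_bigr => h _ /=.
by rewrite mulr_sumr; apply: eq_bigr => g _; rewrite mulrA.
Qed.

Lemma mxact_delta X f g : mxact X (fun h => (h == g)%:R) f = ent X f g.
Proof.
rewrite /mxact (bigD1 g) //= eqxx mulr1 big1 ?addr0 // => h /negPf ->.
by rewrite mulr0.
Qed.

Lemma mxact1 v f : mxact 1 v f = v f.
Proof.
rewrite /mxact (bigD1 f) //= ent1 eqxx mul1r big1 ?addr0 // => h; rewrite eq_sym => /negPf ne.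
by rewrite ent1 ne mul0r.
Qed.

Lemma mxactD X Y v f : mxact (X + Y) v f = mxact X v f + mxact Y v f.
Proof. by rewrite /mxact -big_split; apply: eq_bigr => g _; rewrite entD mulrDl. Qed.

Lemma mxactB X Y v f : mxact (X - Y) v f = mxact X v f - mxact Y v f.
Proof.
by rewrite /mxact -sumrB; apply: eq_bigr => g _; rewrite entB mulrBl.
Qed.

Lemma mxactZ a X v f : mxact (a *: X) v f = a * mxact X v f.
Proof. by rewrite /mxact mulr_sumr; apply: eq_bigr => g _; rewrite entZ mulrA. Qed.

Lemma mxact_scale X a v f : mxact X (fun g => a * v g) f = a * mxact X v f.
Proof. by rewrite /mxact mulr_sumr; apply: eq_bigr => g _; rewrite mulrCA. Qed.

Lemma mxact0 v f : mxact 0 v f = 0.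
Proof. by rewrite /mxact big1 // => g _; rewrite /ent mxE mul0r. Qed.

Lemma mxact_sum (I : Type) (l : seq I) (P : pred I) (X : I -> 'M_#|T|) v f :
  mxact (\sum_(i <- l | P i) X i) v f = \sum_(i <- l | P i) mxact (X i) v f.
Proof.
elim/big_rec2: _ => [|i x y _ <-]; first exact: mxact0.
by rewrite mxactD.
Qed.

Lemma mxact_inj X Y : (forall v f, mxact X v f = mxact Y v f) -> X = Y.
Proof. by move=> h; apply: ent_inj => f g; rewrite -!mxact_delta h. Qed.

End Kernels.

Section TensorRep.
Variables (F : fieldType) (s : F).
Hypothesis s0 : s != 0.
Local Notation z := (s^-1).

Section Fixed.
Variables (N m : nat).
Local Notation T := (states N m).

Definition swap p (f : T) : T := [ffun k => f (tperm (inord p) (inord p.+1) k)].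

(** The braiding divided by s, as [hecke_rep] wants it. *)
Definition braid_ker p (f g : T) : F :=
  if f (inord p) == f (inord p.+1) then (g == f)%:R
  else z * (g == swap p f)%:R
       + (if (f (inord p) < f (inord p.+1))%N then (1 - z ^+ 2) * (g == f)%:R else 0).

Definition braid_mx p := mxker (braid_ker p).

Lemma mxact_braid p v f : mxact (braid_mx p) v f =
  if f (inord p) == f (inord p.+1) then v f
  else z * v (swap p f)
       + (if (f (inord p) < f (inord p.+1))%N then (1 - z ^+ 2) * v f else 0).
Proof.
have sumd (h : T) (a : F) : \sum_g a * (g == h)%:R * v g = a * v h.
  rewrite (bigD1 h) //= eqxx mulr1 big1 ?addr0 // => g /negPf ->.
  by rewrite mulr0 mul0r.
rewrite /mxact; under eq_bigr => g _ do rewrite ent_ker /braid_ker.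
case: eqP => _; first by under eq_bigr => g _ do rewrite -[_%:R]mul1r; rewrite sumd mul1r.
case: ifP => _; under eq_bigr => g _ do rewrite mulrDl.
  by rewrite big_split /= !sumd.
by rewrite big_split /= sumd; congr (_ + _); rewrite big1 // => g _; rewrite mul0r.
Qed.

Lemma swapK p : involutive (swap p).
Proof. by move=> f; apply/ffunP => k; rewrite !ffunE tpermK. Qed.

(** The braid relation is checked on the three letters that it involves, by
    comparing their order. *)
Definition upd p (f : T) (a b c : 'I_N) : T :=
  [ffun k => if k == inord p then a else if k == inord p.+1 then b
             else if k == inord p.+2 then c else f k].

Lemma upd_id p f : f = upd p f (f (inord p)) (f (inord p.+1)) (f (inord p.+2)).
Proof.
apply/ffunP => k; rewrite ffunE.
by case: eqP => [->//|_]; case: eqP => [->//|_]; case: eqP => [->|].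
Qed.

Section ThreePositions.
Variables (p : nat) (f : T).
Hypothesis pm : (p.+1 < m)%N.

Let n01 : (inord p.+1 : 'I_m.+1) == inord p = false.
Proof. by rewrite -val_eqE /= !inordK; lia. Qed.
Let n02 : (inord p.+2 : 'I_m.+1) == inord p = false.
Proof. by rewrite -val_eqE /= !inordK; lia. Qed.
Let n12 : (inord p.+2 : 'I_m.+1) == inord p.+1 = false.
Proof. by rewrite -val_eqE /= !inordK; lia. Qed.

Lemma upd_at a b c :
  [/\ upd p f a b c (inord p) = a, upd p f a b c (inord p.+1) = b
    & upd p f a b c (inord p.+2) = c].
Proof. by rewrite !ffunE !eqxx n01 n02 n12. Qed.

Lemma swap_upd1 a b c : swap p (upd p f a b c) = upd p f b a c.
Proof.
apply/ffunP => k; rewrite !ffunE; case: tpermP => [->|->|n0 n1].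
- by rewrite n01 !eqxx.
- by rewrite !eqxx n01.
by rewrite (introF eqP n0) (introF eqP n1).
Qed.

Lemma swap_upd2 a b c : swap p.+1 (upd p f a b c) = upd p f a c b.
Proof.
apply/ffunP => k; rewrite !ffunE; case: tpermP => [->|->|n1 n2].
- by rewrite n01 n02 n12 !eqxx.
- by rewrite n01 n02 n12 !eqxx.
by rewrite (introF eqP n1) (introF eqP n2).
Qed.

Lemma mxact_upd1 v a b c : mxact (braid_mx p) v (upd p f a b c) =
  if a == b then v (upd p f a b c)
  else z * v (upd p f b a c)
       + (if (a < b)%N then (1 - z ^+ 2) * v (upd p f a b c) else 0).
Proof. by have [e1 e2 _] := upd_at a b c; rewrite mxact_braid e1 e2 swap_upd1. Qed.

Lemma mxact_upd2 v a b c : mxact (braid_mx p.+1) v (upd p f a b c) =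
  if b == c then v (upd p f a b c)
  else z * v (upd p f a c b)
       + (if (b < c)%N then (1 - z ^+ 2) * v (upd p f a b c) else 0).
Proof. by have [_ e1 e2] := upd_at a b c; rewrite mxact_braid e1 e2 swap_upd2. Qed.

End ThreePositions.

Lemma braid_rel p : (p.+1 < m)%N ->
  braid_mx p * braid_mx p.+1 * braid_mx p = braid_mx p.+1 * braid_mx p * braid_mx p.+1.
Proof.
move=> pm; apply: mxact_inj => v f; rewrite (upd_id p f).
move: (f _) (f (inord p.+1)) (f (inord p.+2)) => a b c.
rewrite !mxactM !(mxact_upd1 f pm, mxact_upd2 f pm) -!val_eqE /=.
case: (ltngtP a b) => ab; case: (ltngtP b c) => bc; case: (ltngtP a c) => ac;
  try lia; try move/val_inj: ab => ab; try move/val_inj: bc => bc;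
  try move/val_inj: ac => ac; subst; rewrite ?ltnn ?eqxx; try by field.
all: try by [].
Qed.

Lemma braid_sqr p : (p < m)%N ->
  braid_mx p * braid_mx p = (1 - z ^+ 2) *: braid_mx p + z ^+ 2 *: (1 : 'M[F]_#|T|).
Proof.
move=> pm; apply: mxact_inj => v f; rewrite mxactM mxactD !mxactZ mxact1 !mxact_braid swapK.
have ne : (inord p.+1 : 'I_m.+1) != inord p by rewrite -val_eqE /= !inordK; lia.
have e0 : swap p f (inord p) = f (inord p.+1) by rewrite ffunE tpermL.
have e1 : swap p f (inord p.+1) = f (inord p) by rewrite ffunE tpermR.
rewrite e0 e1 -!val_eqE /=.
by case: (ltngtP (f (inord p)) (f (inord p.+1))) => _; field.
Qed.

Lemma swap_far p q f : (p.+1 < q)%N -> (q < m)%N ->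
  [/\ swap q f (inord p) = f (inord p), swap q f (inord p.+1) = f (inord p.+1),
      swap p f (inord q) = f (inord q), swap p f (inord q.+1) = f (inord q.+1)
    & swap p (swap q f) = swap q (swap p f)].
Proof.
move=> pq qm.
have n1 : (inord q : 'I_m.+1) != inord p by rewrite -val_eqE /= !inordK; lia.
have n2 : (inord q.+1 : 'I_m.+1) != inord p by rewrite -val_eqE /= !inordK; lia.
have n3 : (inord q : 'I_m.+1) != inord p.+1 by rewrite -val_eqE /= !inordK; lia.
have n4 : (inord q.+1 : 'I_m.+1) != inord p.+1 by rewrite -val_eqE /= !inordK; lia.
have tn (i j k : 'I_m.+1) : i != k -> j != k -> tperm i j k = k by exact: tpermD.
split; rewrite ?ffunE ?tn // 1?eq_sym //.
apply/ffunP => k; rewrite !ffunE; congr (f _).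
have [->|kp] := eqVneq k (inord p); first by rewrite tpermL (tn _ _ _ n3 n4) (tn _ _ _ n1 n2) tpermL.
have [->|kp1] := eqVneq k (inord p.+1); first by rewrite tpermR (tn _ _ _ n1 n2) (tn _ _ _ n3 n4) tpermR.
have pk : inord p != k by rewrite eq_sym.
have p1k : inord p.+1 != k by rewrite eq_sym.
rewrite (tn _ _ _ pk p1k) [RHS]tn //.
  by case: tpermP => [_|_|_ _] //; rewrite eq_sym.
by case: tpermP => [_|_|_ _] //; rewrite eq_sym.
Qed.

Lemma braid_far p q : (p.+1 < q)%N -> (q < m)%N ->
  braid_mx p * braid_mx q = braid_mx q * braid_mx p.
Proof.
move=> pq qm; apply: mxact_inj => v f; have [e1 e2 e3 e4 e5] := swap_far f pq qm.
rewrite !mxactM !mxact_braid e1 e2 e3 e4 e5 -!val_eqE /=.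
by case: (ltngtP (f (inord p)) _) => _; case: (ltngtP (f (inord q)) _) => _; ring.
Qed.

Lemma braid_sym p : (braid_mx p)^T = braid_mx p.
Proof.
apply: ent_inj => f g; rewrite {1}/ent mxE -/(ent _ g f) !ent_ker /braid_ker.
have swE (h h' : T) : (h == swap p h') = (h' == swap p h).
  by rewrite eq_sym -{1}(swapK p h) (inj_eq (can_inj (swapK p))).
rewrite [f == g]eq_sym swE.
have [->//|ne] := eqVneq g f; rewrite !mulr0 !if_same !addr0.
have [E|_] := eqVneq g (swap p f); last by rewrite !mulr0 !if_same.
have gp : g (inord p) = f (inord p.+1) by rewrite E ffunE tpermL.
have gp1 : g (inord p.+1) = f (inord p) by rewrite E ffunE tpermR.
by rewrite mulr1 gp gp1 eq_sym.
Qed.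

End Fixed.

Variable v : nat -> F -> Prop.
Hypothesis V : order_at_infinity s v.
Local Notation OO := (mx_ord_ge v).

Lemma oi_inv0 : v 0 z.
Proof. by apply: (oiW V) (oi_inv V). Qed.

Lemma oi_one_sub : v 0 (1 - z ^+ 2).
Proof.
apply: (oiD V); first exact: (oi1 V).
by apply: (oiN V); apply: (oiW V) (oi_invX V 2).
Qed.

Lemma OO_ker d N m (k : states N m -> states N m -> F) :
  (forall f g, v d (k f g)) -> OO d (mxker k).
Proof. by move=> h i j; rewrite mxE. Qed.

Lemma braid_int N m p : OO 0 (braid_mx N m p).
Proof.
apply: OO_ker => f g; rewrite /braid_ker; case: ifP => _; first exact: (oi_natr V).
apply: (oiD V).
  by have := oiM V oi_inv0 (oi_natr V (g == swap p f)); rewrite addn0.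
case: ifP => _; last exact: (oi0 V).
by have := oiM V oi_one_sub (oi_natr V (g == f)); rewrite addn0.
Qed.

(** At s = oo the braiding becomes the indicator of f p <= f p.+1, so that braid
    generators commute in the limit. *)
Lemma braid_lim N m p : exists2 d : 'rV[F]_#|states N m|,
  OO 0 (diag_mx d) & OO 1 (braid_mx N m p - diag_mx d).
Proof.
pose d : 'rV[F]_#|states N m| :=
  \row_i (let f : states N m := enum_val i in (f (inord p) <= f (inord p.+1))%N)%:R.
have dE (f g : states N m) : ent (diag_mx d) f g =
    (f (inord p) <= f (inord p.+1))%N%:R * (f == g)%:R.
  by rewrite /ent !mxE enum_rankK (inj_eq enum_rank_inj) mulr_natr.
exists d.
  move=> i j; rewrite !mxE; case: (i == j); last by rewrite mulr0n; apply: (oi0 V).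
  by rewrite mulr1n; apply: (oi_natr V).
move=> i j; rewrite -[i]enum_valK -[j]enum_valK; set f := enum_val i; set g := enum_val j.
rewrite -/(ent _ f g) entB ent_ker dE /braid_ker eq_sym -!val_eqE /= [g == f]eq_sym.
have vf b : v 0 (b : bool)%:R by apply: (oi_natr V).
have h1 : v 1 (z * (g == swap p f)%:R) by have := oiM V (oi_inv V) (vf (g == swap p f)).
case: (ltngtP (f (inord p)) _) => _; rewrite ?mul1r ?mul0r ?subrr ?subr0 ?addr0 //.
  rewrite (_ : _ - _ = z * (g == swap p f)%:R - z ^+ 2 * (f == g)%:R); last by ring.
  apply: (oiD V) => //.
  apply: (oiN V); apply: (oiW V (d := 2)) => //.
  by have := oiM V (oi_invX V 2) (vf (f == g)); rewrite addn0.
exact: (oi0 V).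
Qed.

Lemma braid_comm_lim N m p q :
  OO 1 (braid_mx N m p * braid_mx N m q - braid_mx N m q * braid_mx N m p).
Proof.
have [d d0 h] := braid_lim N m p; have [d' d0' h'] := braid_lim N m q.
set X := braid_mx N m p in h *; set Y := braid_mx N m q in h' *.
have -> : X * Y - Y * X = (X - diag_mx d) * Y + diag_mx d * (Y - diag_mx d')
    - (Y - diag_mx d') * X - diag_mx d' * (X - diag_mx d).
  have C : diag_mx d * diag_mx d' = diag_mx d' * diag_mx d by apply: diag_mxC.
  rewrite !mulrBl !mulrBr C addrA subrK -addrA -opprD addrA subrK opprB.
  by rewrite addrA subrK.
have iX : OO 0 X := @braid_int N m p; have iY : OO 0 Y := @braid_int N m q.
apply: (OOB V); first apply: (OOB V); first apply: (OOD V).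
- exact: (OOMr V h iY).
- exact: (OOMl V d0 h').
- exact: (OOMr V h' iX).
- exact: (OOMl V d0' h).
Qed.

Lemma braid_hecke N m : hecke_rep s v m (braid_mx N m).
Proof.
split=> [p pm|p pm|p q pq qm|p pm|p pm|p pm].
- exact: braid_sqr.
- exact: braid_rel.
- exact: braid_far.
- exact: braid_sym.
- exact: braid_int.
- exact: braid_comm_lim.
Qed.

End TensorRep.

(** * The quantum trace and its Markov property *)

Section AppendLetter.
Variable N : nat.
Local Notation S m := (states N m).

Definition snoc m (f : S m) (a : 'I_N) : S m.+1 :=
  [ffun k => if unlift ord_max k is Some j then f j else a].

Lemma snoc_max m (f : S m) a : snoc f a ord_max = a.
Proof. by rewrite ffunE unlift_none. Qed.

Lemma snoc_lift m (f : S m) a j : snoc f a (lift ord_max j) = f j.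
Proof. by rewrite ffunE liftK. Qed.

Lemma lift_max_inord m p : (p <= m)%N ->
  (inord p : 'I_m.+2) = lift ord_max (inord p : 'I_m.+1).
Proof. by move=> pm; apply: val_inj; rewrite /= /bump !inordK; lia. Qed.

Lemma snoc_inord m (f : S m) a p : (p <= m)%N -> snoc f a (inord p) = f (inord p).
Proof. by move=> pm; rewrite lift_max_inord // snoc_lift. Qed.

Lemma inord_max m : (inord m : 'I_m.+1) = ord_max.
Proof. by apply: val_inj; rewrite /= inordK. Qed.

Lemma snoc_inj m (f g : S m) a b : (snoc f a == snoc g b) = (f == g) && (a == b).
Proof.
apply/eqP/andP => [e|[/eqP-> /eqP->]//]; split; apply/eqP.
  by apply/ffunP => j; have := congr1 (fun h : S m.+1 => h (lift ord_max j)) e; rewrite !snoc_lift.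
by have := congr1 (fun h : S m.+1 => h ord_max) e; rewrite !snoc_max.
Qed.

Lemma sum_snoc (F : fieldType) m (G : S m.+1 -> F) : \sum_f G f = \sum_(f : S m) \sum_a G (snoc f a).
Proof.
rewrite pair_big /= (reindex (fun fa : S m * 'I_N => snoc fa.1 fa.2)) //=.
exists (fun g : S m.+1 => ([ffun j => g (lift ord_max j)] : S m, g ord_max)) => [[f a]|g] _ /=.
  by rewrite snoc_max; congr (_, _); apply/ffunP => j; rewrite ffunE snoc_lift.
apply/ffunP => k; rewrite ffunE; case: unliftP => [j ->|->] //.
by rewrite ffunE.
Qed.

Lemma swap_snoc m p (f : S m) a : (p < m)%N -> swap p (snoc f a) = snoc (swap p f) a.
Proof.
move=> pm; apply/ffunP => k; rewrite !ffunE.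
rewrite (@lift_max_inord m p) 1?(@lift_max_inord m p.+1); try lia.
case: (unliftP ord_max k) => [j ->|->]; last first.
  by rewrite tpermD ?unlift_none // eq_sym neq_lift.
rewrite ffunE; case: tpermP => [/lift_inj->|/lift_inj->|n1 n2].
- by rewrite liftK tpermL.
- by rewrite liftK tpermR.
by rewrite liftK tpermD //; apply/eqP => e; [apply: n1|apply: n2]; rewrite e.
Qed.

End AppendLetter.

Section QuantumTrace.
Variables (F : fieldType) (s : F) (v : nat -> F -> Prop).
Hypothesis V : order_at_infinity s v.
Local Notation z := (s^-1).
Let s0 : s != 0 := oi_neq0 V.

Variable N : nat.
Local Notation S m := (states N m).
Local Notation t m := (braid_mx s N m).

(** The eigenvalue of K_(2 rho) on a state. *)
Definition wt m (f : S m) : F := \prod_p (s ^+ (2 * f p) / s ^+ N.-1).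

Definition wt_mx m : 'M[F]_#|S m| := diag_mx (\row_i wt (enum_val i)).

Definition qtr m (X : 'M[F]_#|S m|) := \sum_f wt f * ent X f f.

Definition balanced m (X : 'M[F]_#|S m|) := wt_mx m * X = X * wt_mx m.

Lemma ent_wtl m (X : 'M_#|S m|) f g : ent (wt_mx m * X) f g = wt f * ent X f g.
Proof.
rewrite entM (bigD1 f) //= big1 => [|h ne].
  by rewrite addr0 /ent !mxE eqxx mulr1n enum_rankK.
by rewrite /ent !mxE (inj_eq enum_rank_inj) eq_sym (negPf ne) mulr0n mul0r.
Qed.

Lemma ent_wtr m (X : 'M_#|S m|) f g : ent (X * wt_mx m) f g = ent X f g * wt g.
Proof.
rewrite entM (bigD1 g) //= big1 => [|h ne].
  by rewrite addr0 /ent !mxE eqxx mulr1n enum_rankK.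
by rewrite /ent !mxE (inj_eq enum_rank_inj) (negPf ne) mulr0n mulr0.
Qed.

Lemma qtrE m (X : 'M_#|S m|) : qtr X = \tr (wt_mx m * X).
Proof.
rewrite /mxtrace (reindex (@enum_rank (S m))) /=; last first.
  by apply: onW_bij; apply: enum_rank_bij.
by apply: eq_bigr => f _; rewrite -/(ent _ f f) ent_wtl.
Qed.

Lemma qtrC m (X Y : 'M_#|S m|) : balanced Y -> qtr (X * Y) = qtr (Y * X).
Proof.
move=> h; rewrite !qtrE mulrA [LHS](mxtrace_mulC (wt_mx m * X) Y).
by congr (\tr _); rewrite [RHS]mulrA h -mulrA.
Qed.

Lemma qtrD m (X Y : 'M_#|S m|) : qtr (X + Y) = qtr X + qtr Y.
Proof. by rewrite /qtr -big_split; apply: eq_bigr => f _; rewrite entD mulrDr. Qed.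

Lemma qtrB m (X Y : 'M_#|S m|) : qtr (X - Y) = qtr X - qtr Y.
Proof. by rewrite /qtr -sumrB; apply: eq_bigr => f _; rewrite entB mulrBr. Qed.

Lemma qtrZ m a (X : 'M_#|S m|) : qtr (a *: X) = a * qtr X.
Proof. by rewrite /qtr mulr_sumr; apply: eq_bigr => f _; rewrite entZ mulrCA. Qed.

Lemma qtr_sum m (I : Type) (l : seq I) (P : pred I) (X : I -> 'M_#|S m|) :
  qtr (\sum_(i <- l | P i) X i) = \sum_(i <- l | P i) qtr (X i).
Proof.
elim/big_rec2: _ => [|i x y _ <-]; last exact: qtrD.
by rewrite /qtr big1 // => f _; rewrite /ent mxE mulr0.
Qed.

Lemma wt_swap m p (f : S m) : wt (swap p f) = wt f.
Proof.
rewrite /wt [RHS](reindex_inj (@perm_inj _ (tperm (inord p) (inord p.+1)))) /=.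
by apply: eq_bigr => k _; rewrite ffunE.
Qed.

Lemma balanced_braid m p : balanced (t m p).
Proof.
apply: ent_inj => f g; rewrite ent_wtl ent_wtr ent_ker /braid_ker.
have [->|ne] := eqVneq g f; first by rewrite mulrC.
have [->|ne'] := eqVneq g (swap p f); first by rewrite wt_swap mulrC.
by rewrite !mulr0 !if_same addr0 if_same mulr0 mul0r.
Qed.

Lemma balancedM m (X Y : 'M_#|S m|) : balanced X -> balanced Y -> balanced (X * Y).
Proof. by rewrite /balanced => hX hY; rewrite mulrA hX -mulrA hY mulrA. Qed.

Lemma balanced_exp m (X : 'M_#|S m|) k : balanced X -> balanced (X ^+ k).
Proof.
move=> h; elim: k => [|k IH]; first by rewrite /balanced expr0 mulr1 mul1r.
by rewrite exprS; apply: balancedM.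
Qed.

Lemma balanced_tw m w : balanced (tw (t m) w).
Proof. by apply: comm_prod => i _; apply: balanced_braid. Qed.

Lemma balanced_carries m b k : carries (t m) (wt_mx m) b b k.
Proof. by move=> i _; apply: balanced_braid. Qed.

Lemma balanced_qsym m b k : balanced (qsym s (t m) b k).
Proof. by apply: carries_qsym; apply: balanced_carries. Qed.

Lemma balanced_block m b a k : balanced (block_cross (t m) b a k).
Proof. by apply: carries_block; apply: balanced_carries. Qed.

Lemma balanced_cable m r w : balanced (cable_word (t m) r w).
Proof. by apply: comm_prod => i _; apply: balanced_block. Qed.

Lemma balanced_proj m r n : balanced (block_proj s (t m) r n).
Proof. by apply: comm_prod => i _; apply: balanced_qsym. Qed.

Lemma wt_snoc m (f : S m) a : wt (snoc f a) = wt f * (s ^+ (2 * a) / s ^+ N.-1).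
Proof.
rewrite /wt big_ord_recr /=; congr (_ * _); last by rewrite snoc_max.
apply: eq_bigr => j _; congr (s ^+ (2 * _) / _).
have -> : widen_ord (leqnSn m.+1) j = lift ord_max j by apply: val_inj; rewrite /= /bump; have := ltn_ord j; lia.
by rewrite snoc_lift.
Qed.

(** [X'] is the tensor product of [X] with the identity of the last factor. *)
Definition extends m (X' : 'M[F]_#|S m.+1|) (X : 'M[F]_#|S m|) :=
  forall w f a, mxact X' w (snoc f a) = mxact X (fun g => w (snoc g a)) f.

Lemma extends1 m : @extends m 1 1.
Proof. by move=> w f a; rewrite !mxact1. Qed.

Lemma extendsM m X' X Y' Y : @extends m X' X -> extends Y' Y -> extends (X' * Y') (X * Y).
Proof. by move=> hX hY w f a; rewrite !mxactM hX; apply: eq_mxact => g; rewrite hY. Qed.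

Lemma extendsZ m c X' X : @extends m X' X -> extends (c *: X') (c *: X).
Proof. by move=> hX w f a; rewrite !mxactZ hX. Qed.

Lemma extends_sum m (I : Type) (l : seq I) (P : pred I) X' X :
  (forall i, P i -> @extends m (X' i) (X i)) ->
  extends (\sum_(i <- l | P i) X' i) (\sum_(i <- l | P i) X i).
Proof.
by move=> h w f a; rewrite !mxact_sum; apply: eq_bigr => i Pi; rewrite h.
Qed.

Lemma extends_prod m (I : eqType) (l : seq I) X' X :
  (forall i, i \in l -> @extends m (X' i) (X i)) ->
  extends (\prod_(i <- l) X' i) (\prod_(i <- l) X i).
Proof.
elim: l => [|i l IH] h; first by rewrite !big_nil; apply: extends1.
rewrite !big_cons; apply: extendsM; first by apply: h; rewrite mem_head.
by apply: IH => j jl; apply: h; rewrite inE jl orbT.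
Qed.

Lemma extends_exp m X' X k : @extends m X' X -> extends (X' ^+ k) (X ^+ k).
Proof.
move=> h; elim: k => [|k IH]; first by rewrite !expr0; apply: extends1.
by rewrite !exprS; apply: extendsM.
Qed.

Lemma extends_braid m p : (p < m)%N -> extends (t m.+1 p) (t m p).
Proof.
move=> pm w f a; rewrite !mxact_braid swap_snoc // !snoc_inord //; lia.
Qed.

Lemma extends_tw m w : all (fun p => p < m)%N w -> extends (tw (t m.+1) w) (tw (t m) w).
Proof.
by move=> /allP wm; apply: extends_prod => p /wm pm; apply: extends_braid.
Qed.

Lemma extends_row m b k : (b + k <= m)%N ->
  extends (row_cross (t m.+1) b k) (row_cross (t m) b k).
Proof. by move=> h; apply: extends_tw; apply/allP => i; rewrite mem_iota; lia. Qed.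

Lemma extends_block m b a k : (b + a + k <= m.+1)%N ->
  extends (block_cross (t m.+1) b a k) (block_cross (t m) b a k).
Proof.
elim: k => [|k IH] h; first by rewrite !block_cross0; apply: extends1.
by rewrite !block_crossS; apply: extendsM; [apply: extends_row|apply: IH]; lia.
Qed.

Lemma extends_qsym m b k : (b + k <= m.+1)%N ->
  extends (qsym s (t m.+1) b k) (qsym s (t m) b k).
Proof.
elim: k => [|k IH] h; first by rewrite !qsym0; apply: extends1.
rewrite !qsymS; apply: extendsM; first by apply: IH; lia.
apply: extendsZ; apply: extends_sum => j _; apply: extendsZ.
by apply: extends_tw; apply: all_desc; have := ltn_ord j; lia.
Qed.

Lemma extends_cable m r n w : all (fun i => i.+1 < n)%N w -> (n * r <= m.+1)%N ->
  extends (cable_word (t m.+1) r w) (cable_word (t m) r w).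
Proof.
move=> /allP wn nm; apply: extends_prod => i /wn lt; apply: extends_block.
have : (i.+2 * r <= n * r)%N by rewrite leq_mul2r lt orbT.
by rewrite !mulSn; lia.
Qed.

Lemma extends_proj m r n : (n * r <= m.+1)%N ->
  extends (block_proj s (t m.+1) r n) (block_proj s (t m) r n).
Proof.
move=> nm; apply: extends_prod => i; rewrite mem_iota => /andP[_ lt]; apply: extends_qsym.
have : (i.+1 * r <= n * r)%N by rewrite leq_mul2r lt orbT.
by rewrite !mulSn; lia.
Qed.

Definition qdim : F := \sum_(a < N) s ^+ (2 * a) / s ^+ N.-1.

Lemma qtr_extends m X' X : @extends m X' X -> qtr X' = qdim * qtr X.
Proof.
move=> h; rewrite /qtr sum_snoc mulr_sumr; apply: eq_bigr => f _.
rewrite /qdim !mulr_suml; apply: eq_bigr => a _.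
have E : ent X' (snoc f a) (snoc f a) = ent X f f.
  by rewrite -mxact_delta h -mxact_delta; apply: eq_mxact => g; rewrite snoc_inj eqxx andbT.
by rewrite wt_snoc E mulrAC mulrC -!mulrA mulrCA.
Qed.

(** The partial trace of a crossing does not see the letter [b] on the strand that
    is not closed. *)
Lemma curl_sum (M b : nat) : (b < M)%N ->
  \sum_(a < M) s ^+ (2 * a) * (if b == a then 1 else if (b < a)%N then 1 - z ^+ 2 else 0)
  = s ^+ (2 * M.-1).
Proof.
elim: M => // M IH bM; rewrite big_ord_recr /=.
have [E|ne] := eqVneq b M.
  rewrite big1 => [|a _]; first by rewrite add0r mulr1.
  by have := ltn_ord a => aM; rewrite (_ : b == a = false) 1?(_ : b < a = false)%N ?mulr0 //; lia.
have lt : (b < M)%N by lia.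
rewrite lt IH //; case: M lt {IH bM ne} => // M _ /=.
by rewrite mulnS exprD; field.
Qed.

(** Closing the last strand removes a positive crossing at the price of the
    framing factor of V. *)
Lemma qtr_markov m X' X : @extends m X' X -> qtr (X' * t m.+1 m) = s ^+ N.-1 * qtr X.
Proof.
move=> h; rewrite /qtr sum_snoc mulr_sumr; apply: eq_bigr => f _.
pose kap (b a : 'I_N) : F :=
  if (b : nat) == a then 1 else if (b < a)%N then 1 - z ^+ 2 else 0.
have E a : ent (X' * t m.+1 m) (snoc f a) (snoc f a) = ent X f f * kap (f ord_max) a.
  rewrite -mxact_delta mxactM h -mxact_delta [RHS]mulrC -mxact_scale; apply: eq_mxact => g.
  rewrite mxact_braid inord_max snoc_inord // inord_max snoc_max snoc_inj eqxx andbT.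
  have -> : (swap m (snoc g a) == snoc f a) = (g ord_max == a) && (g == f).
    have e1 : swap m (snoc g a) ord_max = g ord_max.
      by rewrite ffunE -[in tperm _ _ _]inord_max tpermR snoc_inord // inord_max.
    have [e|ne] := eqVneq (g ord_max) a; last first.
      by apply: contraNF ne => /eqP e2; rewrite -e1 e2 snoc_max.
    have -> : swap m (snoc g a) = snoc g a; last by rewrite snoc_inj eqxx andbT.
    apply/ffunP => k; rewrite ffunE inord_max; case: tpermP => [->|->|//].
      by rewrite snoc_max snoc_inord // inord_max.
    by rewrite snoc_max snoc_inord // inord_max.
  rewrite /kap -val_eqE; have [->|ne] := eqVneq g f.
    rewrite mulr1; case: eqP => _; first by rewrite mulr1.
    by rewrite mulr0 add0r; case: ifP; rewrite ?mulr1.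
  by rewrite andbF !mulr0 !if_same addr0 if_same.
rewrite (eq_bigr (fun a : 'I_N => wt f * ent X f f / s ^+ N.-1 *
     (s ^+ (2 * a) * kap (f ord_max) a))) => [|a _]; last first.
  by rewrite E wt_snoc; ring.
rewrite -mulr_sumr curl_sum // mulnC exprM expr2; field.
by rewrite expf_neq0.
Qed.

(** * Closing a cabled strand *)

Section CloseBlock.
Variable r' : nat.
Local Notation r := r'.+1.

Lemma row_exp_slide m b k : (b + r <= m)%N ->
  row_cross (t m) b.+1 r' ^+ k * row_cross (t m) b r =
  row_cross (t m) b r * row_cross (t m) b r' ^+ k.
Proof.
move=> h; elim: k => [|k IH]; first by rewrite !expr0 mulr1 mul1r.
have C := carries_row (row_carries (braid_hecke s0 V N m) h).
by rewrite !exprS -mulrA IH mulrA -C mulrA.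
Qed.

(** Closing one by one the strands of the block that is crossed over, each
    contributes its framing factor, and the kinks they leave build up a full
    twist on the crossing block. *)
Lemma close_block (A : forall m, 'M[F]_#|S m|) b j k :
  (forall m, (b + r' <= m)%N -> extends (A m.+1) (A m)) ->
  (forall m, balanced (A m)) ->
  let m := (j + (b + r'))%N in
  qtr (A m * row_cross (t m) (b + j) r' ^+ k * block_cross (t m) b r j) =
  s ^+ (N.-1 * j) * qtr (A (b + r')%N * row_cross (t (b + r')%N) b r' ^+ (k + j)).
Proof.
move=> eA bA; elim: j k => [|j IH] k.
  by rewrite /= block_cross0 mulr1 muln0 expr0 mul1r !addn0.
rewrite [(j.+1 + _)%N]addSn; set m := (j + (b + r'))%N in IH *.
cbv zeta; rewrite block_crossS [(b + j.+1)%N]addnS mulrA -[A _ * _ * _]mulrA row_exp_slide; last first.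
  by rewrite /m; lia.
rewrite row_crossSr (_ : (b + j + r')%N = m); last by rewrite /m; lia.
set R := row_cross (t m.+1) (b + j) r'.
set B := block_cross (t m.+1) b r j.
have bR : balanced R by apply: balanced_tw.
have -> : A m.+1 * (R * t m.+1 m * R ^+ k) * B = A m.+1 * R * t m.+1 m * (R ^+ k * B).
  by rewrite !mulrA.
have bY : balanced (R ^+ k * B).
  by apply: balancedM; [apply: balanced_exp|apply: balanced_block].
rewrite qtrC //.
have -> : R ^+ k * B * (A m.+1 * R * t m.+1 m) = R ^+ k * B * (A m.+1 * R) * t m.+1 m.
  by rewrite !mulrA.
rewrite (@qtr_markov m _ (row_cross (t m) (b + j) r' ^+ k * block_cross (t m) b r j *
   (A m * row_cross (t m) (b + j) r'))); last first.
  apply: extendsM; apply: extendsM.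
  - by apply: extends_exp; apply: extends_row; rewrite /m; lia.
  - by apply: extends_block; rewrite /m; lia.
  - by apply: eA; rewrite /m; lia.
  - by apply: extends_row; rewrite /m; lia.
rewrite -[in LHS]qtrC; last first.
  apply: balancedM; last exact: balanced_block.
  by apply: balanced_exp; apply: balanced_tw.
have -> : A m * row_cross (t m) (b + j) r' *
     (row_cross (t m) (b + j) r' ^+ k * block_cross (t m) b r j) =
   A m * row_cross (t m) (b + j) r' ^+ k.+1 * block_cross (t m) b r j.
  by rewrite exprS !mulrA.
by rewrite IH mulrA -exprD mulnS addSn addnS.
Qed.

Lemma mul_block n : (n.+1 * r = n * r + r)%N.
Proof. by rewrite mulSn addnC. Qed.

(** The last block meets the others only in the single occurrence of its
    crossing.  Its projector passes through that crossing to the neighbouring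
    block, [close_block] then removes its strands, and the projector of the
    neighbour absorbs the full twist. *)
Lemma cable_markov n u w :
  all (fun i => i < n)%N u -> all (fun i => i < n)%N w ->
  let m := (n.+1 * r).-1 in let m' := (n.+2 * r).-1 in
  qtr (cable_word (t m') r (u ++ n :: w) * block_proj s (t m') r n.+2) =
  s ^+ (N.-1 * r) * qtr (cable_word (t m) r (w ++ u) * block_proj s (t m) r n.+1).
Proof.
move=> un wn m m'.
have mE : m = (n * r + r')%N by rewrite /m mul_block addnS.
have m'E : m' = (r + m)%N by rewrite /m' mul_block addnS /m mul_block !addnS !addSn addnC.
have Hm' := braid_hecke s0 V N m'.
have r0 : (0 < r)%N by [].
have sz : (n.+2 * r <= m'.+1)%N by rewrite /m' mul_block !addnS.
have wun : all (fun i => i < n)%N (w ++ u) by rewrite all_cat wn un.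
set BP := block_proj s (t m') r.
set q := qsym s (t m') (n.+1 * r) r.
have BPS : BP n.+2 = BP n.+1 * q.
  by rewrite /BP /block_proj -[n.+2]addn1 iotaD big_cat /= big_seq1.
pose c := cable_gen (t m') r n.
pose q0 := qsym s (t m') (n * r) r.
have BP0 : BP n.+1 = BP n.+1 * q0.
  rewrite /BP /block_proj -[n.+1]addn1 iotaD big_cat /= big_seq1 add0n -mulrA.
  by rewrite [q0 * q0](qsym_idem V Hm') //; move: sz; rewrite !mul_block; lia.
have q0c : q0 * c = c * q.
  have h : (n * r + r + r <= m'.+1)%N by rewrite -!mul_block.
  by apply: esym; rewrite /q mul_block; apply: carries_qsym; apply: (block_carries_under Hm').
pose Y := cable_word (t m') r (w ++ u).
have YBP k : (n < k)%N -> (k * r <= m'.+1)%N -> Y * BP k = BP k * Y.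
  move=> nk kr; apply: (cable_word_proj Hm' r0) => //.
  by apply: sub_all wun => i; lia.
have qBP : q * BP n.+1 = BP n.+1 * q.
  apply: comm_prod => i; rewrite mem_iota => /andP[_ lt].
  apply: esym; apply: (qsym_commute Hm').
    by rewrite -mul_block leq_mul2r lt orbT.
  by rewrite -mul_block.
have qY : q * Y = Y * q.
  apply: comm_prod => i iw; have lt : (i < n)%N by apply: (allP wun).
  apply: esym; apply: (cable_qsym_far Hm' r0); try lia.
  apply: leq_trans sz; rewrite leq_mul2r; lia.
have -> : qtr (cable_word (t m') r (u ++ n :: w) * BP n.+2) = qtr (Y * BP n.+1 * c).
  have -> : cable_word (t m') r (u ++ n :: w) =
      cable_word (t m') r u * c * cable_word (t m') r w.
    by rewrite /cable_word big_cat big_cons /= mulrA.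
  rewrite -mulrA qtrC; last first.
    by apply: balancedM; [apply: balanced_cable|apply: balanced_proj].
  have wBP : cable_word (t m') r w * BP n.+2 = BP n.+2 * cable_word (t m') r w.
    apply: (cable_word_proj Hm' r0) => //; by apply: sub_all wn => i; lia.
  rewrite wBP mulrA -(mulrA (BP n.+2)) (_ : cable_word _ _ w * _ = Y); last first.
    by rewrite /Y /cable_word big_cat.
  rewrite -YBP // BPS mulrA -(mulrA _ q c).
  have -> : Y * BP n.+1 * (q * c) = Y * (BP n.+1 * q) * c by rewrite !mulrA.
  rewrite -qBP (_ : Y * (q * BP n.+1) * c = q * (Y * BP n.+1 * c)); last first.
    by rewrite !mulrA -qY.
  rewrite qtrC; last first.
    apply: balancedM; last exact: balanced_block.
    by apply: balancedM; [apply: balanced_cable|apply: balanced_proj].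
  by rewrite -(mulrA _ c q) -q0c mulrA -(mulrA Y) -BP0.
(* [close_block] takes the number of positions in the form j + (b + r'). *)
suff closed M : M = (r + (n * r + r'))%N ->
    qtr (cable_word (t M) r (w ++ u) * block_proj s (t M) r n.+1 * cable_gen (t M) r n) =
    s ^+ (N.-1 * r) * qtr (cable_word (t m) r (w ++ u) * block_proj s (t m) r n.+1).
  by apply: closed; rewrite m'E mE.
move=> ->; have h : (n.+1 * r = (n * r + r').+1)%N by rewrite mul_block addnS.
have eA k : (n * r + r' <= k)%N ->
    extends (cable_word (t k.+1) r (w ++ u) * block_proj s (t k.+1) r n.+1)
            (cable_word (t k) r (w ++ u) * block_proj s (t k) r n.+1).
  move=> mk; apply: extendsM; last by apply: extends_proj; rewrite h.
  by apply: (extends_cable (n := n.+1)); [apply: sub_all wun => i; lia|rewrite h].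
have bA k : balanced (cable_word (t k) r (w ++ u) * block_proj s (t k) r n.+1).
  by apply: balancedM; [apply: balanced_cable|apply: balanced_proj].
have := @close_block _ (n * r) r 0 eA bA; cbv zeta.
rewrite expr0 mulr1 add0n -mE => ->.
congr (_ * qtr _); rewrite -mulrA; congr (_ * _).
have Hm := braid_hecke s0 V N m.
have -> : block_proj s (t m) r n.+1 = block_proj s (t m) r n * qsym s (t m) (n * r) r.
  by rewrite /block_proj -[n.+1]addn1 iotaD big_cat /= big_seq1 add0n.
rewrite -mulrA; congr (_ * _).
suff absorb j : qsym s (t m) (n * r) r * row_cross (t m) (n * r) r' ^+ j =
                qsym s (t m) (n * r) r by exact: absorb.
elim: j => [|k IH]; first by rewrite expr0 mulr1.
by rewrite exprS mulrA (qsym_row_absr V Hm) ?IH //; rewrite ?mE; lia.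
Qed.

End CloseBlock.

(** A nontrivial coset representative starts with the crossing of the last
    strand, which [qtr_markov] removes; the projector absorbs what is left. *)
Lemma qtr_qsymS k : qtr (qsym s (t k.+1) 0 k.+2) =
  qtr (qsym s (t k) 0 k.+1) *
  ((qdim + s ^+ N.-1 * (s ^+ 2 * qint s k.+1)) / qint s k.+2).
Proof.
set p := qsym s (t k) 0 k.+1; rewrite qsymS; set p' := qsym s (t k.+1) 0 k.+1.
have pE : extends p' p by apply: extends_qsym.
have H := braid_hecke s0 V N k.
rewrite scMr qtrZ [RHS]mulrA [RHS]mulrC; congr (_ * _); rewrite mulr_sumr qtr_sum big_ord_recl.
rewrite expr0 scale1r tw_nil mulr1 (qtr_extends pE) mulrDr [qdim * _]mulrC; congr (_ + _).
rewrite /qint !mulr_sumr; apply: eq_bigr => j _.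
have -> : desc 0 k.+1 (lift ord0 j) = k :: desc 0 k j.
  rewrite /desc /= subn0; congr (_ :: _); rewrite -[1%N]addn0 iotaDl -map_comp.
  by apply/eq_in_map => i; rewrite mem_iota /=; lia.
have jk := ltn_ord j.
rewrite scMr qtrZ tw_cons [p' * _]mulrA qtrC; last exact: balanced_tw.
rewrite [tw _ _ * _]mulrA (@qtr_markov k _ (tw (t k) (desc 0 k j) * p)); last first.
  by apply: extendsM pE; apply: extends_tw; apply: all_desc; lia.
rewrite (fixes_tw (b := 0) (k := k.+1)); first last.
- by apply/allP => l /mapP[l']; rewrite mem_iota => hl ->; lia.
- by apply: (qsym_fixes V H); lia.
rewrite (_ : (2 * lift ord0 j)%N = (2 + 2 * j)%N); last by rewrite -mulnS.
by rewrite exprD; ring.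
Qed.

Lemma qtr_one : qtr (1 : 'M[F]_#|S 0|) = qdim.
Proof.
rewrite /qtr (reindex (fun a : 'I_N => [ffun=> a] : S 0)) /=; last first.
  exists (fun f : S 0 => f ord0) => [a|f] _; first by rewrite ffunE.
  by apply/ffunP => k; rewrite ffunE [k]ord1.
apply: eq_bigr => a _; rewrite ent1 eqxx mulr1 /wt big_ord1 ffunE.
by [].
Qed.

(** The quantum dimension of the symmetric power. *)
Lemma qtr_qsym k : (0 < N)%N -> qtr (qsym s (t k) 0 k.+1) =
  \prod_(i < k.+1) (s ^+ N / s * (1 - (s ^+ N) ^- 2 * z ^+ (2 * i)) / (1 - z ^+ (2 * i.+1))).
Proof.
move=> N0; have sA : s ^+ N.-1 = s ^+ N / s by rewrite -{2}(prednK N0) exprS mulrC mulKf.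
have s2 := oi_sqr_neq1 V.
have A0 : s ^+ N != 0 := oi_neq0X V N.
have G l : qint s l = (s ^+ (2 * l) - 1) / (s ^+ 2 - 1) by rewrite -qint_geom mulrC mulKf.
have qd : qdim = (s ^+ N ^+ 2 - 1) / (s ^+ 2 - 1) / (s ^+ N / s).
  by rewrite /qdim -mulr_suml -/(qint s N) G sA mulnC exprM.
elim: k => [|k IH].
  rewrite big_ord1 qsymS qsym0 mul1r big_ord1 qint1 invr1 !scale1r tw_nil qtr_one qd.
  by rewrite muln0 expr0 muln1; field; rewrite s0 A0 s2.
rewrite qtr_qsymS IH [RHS]big_ord_recr /=; congr (_ * _).
have q1 := qint_neq0 V k.+1; have w0 := oi_neq0X V (2 * k.+1).
rewrite qd sA; move: q1; rewrite !G ![(2 * k.+2)%N]mulnS exprD !exprVn exprD.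
move: (s ^+ (2 * k.+1)) w0 (s ^+ N) A0 => w w0 A A0 q1.
have ws : s ^+ 2 * w - 1 != 0 by move: q1; apply: contraNneq => ->; rewrite mul0r.
by field; rewrite s0 A0 s2 w0 ws.
Qed.

End QuantumTrace.

(** * Dependence of traces on N *)

Section OrderPatterns.
Variable m : nat.

Definition order_iso N N' (f : states N m) (u : states N' m) :=
  [forall i, forall j, (f i <= f j)%N == (u i <= u j)%N].

Lemma order_isoP N N' (f : states N m) (u : states N' m) :
  reflect (forall i j, (f i <= f j)%N = (u i <= u j)%N) (order_iso f u).
Proof.
exact: 'forall_'forall_eqP.
Qed.

Lemma order_iso_lt N N' (f : states N m) (u : states N' m) i j :
  order_iso f u -> (f i < f j)%N = (u i < u j)%N.
Proof. by move/order_isoP => h; rewrite !ltnNge h. Qed.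

Lemma order_iso_eq N N' (f : states N m) (u : states N' m) i j :
  order_iso f u -> (f i == f j) = (u i == u j).
Proof. by move/order_isoP => h; rewrite -!val_eqE /= !eqn_leq !h. Qed.

Lemma order_iso_sym N N' (f : states N m) (u : states N' m) :
  order_iso f u = order_iso u f.
Proof. by apply/order_isoP/order_isoP => h i j. Qed.

(** The canonical representative of the order pattern of [f]; [m.+1] letters are
    enough for [m.+1] positions. *)
Definition rank N (f : states N m) : states m.+1 m :=
  [ffun i => inord #|[pred j | (f j < f i)%N]|].

Lemma rankE N (f : states N m) i : rank f i = #|[pred j | (f j < f i)%N]| :> nat.
Proof.
rewrite ffunE inordK // -[X in (_ < X)%N]card_ord; apply: proper_card.
apply/properP; split; first by apply/subsetP => j.
by exists i => //; rewrite inE ltnn.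
Qed.

Lemma rank_iso N (f : states N m) : order_iso f (rank f).
Proof.
apply/order_isoP => i j; rewrite !rankE; have [le|gt] := leqP (f i) (f j).
  apply: esym; apply: subset_leq_card; apply/subsetP => k; rewrite !inE => lt.
  exact: leq_trans lt le.
apply: esym; apply: negbTE; rewrite -ltnNge; apply: proper_card; apply/properP; split.
  by apply/subsetP => k; rewrite !inE => lt; apply: ltn_trans lt gt.
by exists j; rewrite !inE ?ltnn.
Qed.

Lemma order_iso_rank N N' (f : states N m) (u : states N' m) :
  order_iso f u -> rank f = rank u.
Proof.
move=> h; apply/ffunP => i; apply: val_inj; rewrite /= !rankE.
by apply: eq_card => j; rewrite !inE (order_iso_lt _ _ h).
Qed.

Lemma rank_eq N (f : states N m) u : (rank f == u) = order_iso f u && (rank u == u).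
Proof.
apply/eqP/andP => [<-|[h /eqP <-]]; last exact: order_iso_rank.
by split; [apply: rank_iso|rewrite -(order_iso_rank (rank_iso f))].
Qed.

Definition pull N (f : states N m) (p : 'S_m.+1) : states N m := [ffun k => f (p k)].

Lemma pull1 N (f : states N m) : pull f 1 = f.
Proof. by apply/ffunP => k; rewrite ffunE perm1. Qed.

End OrderPatterns.

Section Natural.
Variables (F : fieldType) (s : F) (m : nat).
Local Notation fam := (forall N, 'M[F]_#|states N m|).

(** The families, indexed by N, of operators that permute the letters of a state
    with coefficients depending only on their relative order.  Stated through the
    action on the permutations of one state, the property passes to products. *)
Definition natural (X : fam) :=
  forall N N' (f : states N m) (u : states N' m) v v', order_iso f u ->
  (forall p, v (pull f p) = v' (pull u p)) ->
  forall p, mxact (X N) v (pull f p) = mxact (X N') v' (pull u p).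

Lemma naturalM (X Y : fam) : natural X -> natural Y -> natural (fun N => X N * Y N).
Proof.
move=> hX hY N N' f u v v' fu h p; rewrite !mxactM; apply: hX => // p'.
exact: hY.
Qed.

Lemma naturalB (X Y : fam) : natural X -> natural Y -> natural (fun N => X N - Y N).
Proof.
by move=> hX hY N N' f u v v' fu h p; rewrite !mxactB (hX _ _ _ _ _ _ fu h) (hY _ _ _ _ _ _ fu h).
Qed.

Lemma naturalZ a (X : fam) : natural X -> natural (fun N => a *: X N).
Proof. by move=> hX N N' f u v v' fu h p; rewrite !mxactZ (hX _ _ _ _ _ _ fu h). Qed.

Lemma natural_sum (I : Type) (l : seq I) (P : pred I) (X : I -> fam) :
  (forall i, natural (X i)) -> natural (fun N => \sum_(i <- l | P i) X i N).
Proof.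
move=> hX N N' f u v v' fu h p; rewrite !mxact_sum; apply: eq_bigr => i _.
exact: hX.
Qed.

Lemma natural_prod (I : Type) (l : seq I) (X : I -> fam) :
  (forall i, natural (X i)) -> natural (fun N => \prod_(i <- l) X i N).
Proof.
move=> hX; elim: l => [|i l IH] N N' f u v v' fu h p.
  by rewrite !big_nil !mxact1.
by rewrite !big_cons; apply: (naturalM (hX i) IH).
Qed.

Lemma natural_braid p : natural (fun N => braid_mx s N m p).
Proof.
move=> N N' f u v v' fu h p'; rewrite !mxact_braid !ffunE.
rewrite (order_iso_eq _ _ fu) (order_iso_lt _ _ fu) !h.
have sw N1 (g : states N1 m) : swap p (pull g p') = pull g (tperm (inord p) (inord p.+1) * p').
  by apply/ffunP => k; rewrite !ffunE permM.
by rewrite !sw h.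
Qed.

Lemma natural_tw w : natural (fun N => tw (braid_mx s N m) w).
Proof. by apply: natural_prod => i; apply: natural_braid. Qed.

Lemma natural_block b a k : natural (fun N => block_cross (braid_mx s N m) b a k).
Proof.
elim: k => [|k IH] N N' f u v v' fu h p.
  by rewrite !block_cross0 !mxact1.
rewrite !block_crossS.
exact: (naturalM (natural_tw _) IH).
Qed.

Lemma natural_qsym b k : natural (fun N => qsym s (braid_mx s N m) b k).
Proof.
elim: k => [|k IH] N N' f u v v' fu h p; first by rewrite !qsym0 !mxact1.
rewrite !qsymS.
apply: (naturalM IH (Y := fun N => (qint s k.+1)^-1 *:
   \sum_(j < k.+1) s ^+ (2 * j) *: tw (braid_mx s N m) (desc b k j))) => //.
by apply: naturalZ; apply: natural_sum => j; apply: naturalZ; apply: natural_tw.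
Qed.

Lemma natural_cable r w : natural (fun N => cable_word (braid_mx s N m) r w).
Proof. by apply: natural_prod => i; apply: natural_block. Qed.

Lemma natural_proj r n : natural (fun N => block_proj s (braid_mx s N m) r n).
Proof. by apply: natural_prod => i; apply: natural_qsym. Qed.

Lemma natural_diag (X : fam) N N' (f : states N m) (u : states N' m) :
  natural X -> order_iso f u -> ent (X N) f f = ent (X N') u u.
Proof.
move=> hX fu; rewrite -!mxact_delta -{2}(pull1 f) -{2}(pull1 u).
apply: hX => // p; congr (_%:R); congr (nat_of_bool _).
have key N1 N2 (a : states N1 m) (b : states N2 m) :
    order_iso a b -> pull a p = a -> pull b p = b.
  move=> ab /ffunP e; apply/ffunP => k; have := e k; rewrite !ffunE => /eqP.
  by rewrite (order_iso_eq _ _ ab) => /eqP.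
apply/eqP/eqP; first exact: key fu.
by apply: key; rewrite order_iso_sym.
Qed.

(** The quantum trace as a sum over order patterns: N enters only through the
    generating function of the states with a given pattern. *)
Lemma qtr_patterns (X : fam) N : natural X ->
  qtr s (X N) = \sum_(u : states m.+1 m)
    ent (X m.+1) u u * (if rank u == u then \sum_(f : states N m | order_iso f u) wt s f else 0).
Proof.
move=> hX; rewrite /qtr (partition_big (@rank m N) predT) //=.
apply: eq_bigr => u _; under eq_bigl => f do rewrite rank_eq.
case: ifP => _; last by rewrite mulr0 big1 // => f; rewrite andbF.
rewrite mulr_sumr; apply: eq_big => f; rewrite andbT // => fu.
by rewrite (natural_diag hX fu) mulrC.
Qed.

End Natural.

Section Parity.
Variables (F : fieldType) (s : F) (E : F -> Prop).
Hypothesis s0 : s != 0.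
Hypotheses (E1 : E 1) (EB : forall x y, E x -> E y -> E (x - y))
  (EM : forall x y, E x -> E y -> E (x * y)) (EV : forall x, E x -> E x^-1)
  (Es : E (s ^+ 2)).
Variables (N m : nat).
Local Notation S := (states N m).

Lemma even0 : E 0. Proof. by rewrite -(subrr 1); apply: EB. Qed.
Lemma evenN x : E x -> E (- x).
Proof. by move=> h; rewrite -[- x]add0r; apply: EB => //; apply: even0. Qed.
Lemma evenD x y : E x -> E y -> E (x + y).
Proof. by move=> hx hy; rewrite -[y]opprK; apply: EB => //; apply: evenN. Qed.
Lemma even_sum (I : Type) (l : seq I) (P : pred I) (f : I -> F) :
  (forall i, P i -> E (f i)) -> E (\sum_(i <- l | P i) f i).
Proof. by move=> h; apply: big_ind => //; [apply: even0|apply: evenD]. Qed.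
Lemma evenX k : E (s ^+ (2 * k)).
Proof.
elim: k => [|k IH]; first by rewrite expr0.
by rewrite mulnS exprD; apply: EM.
Qed.

(** The parity of the number of inversions.  The braiding has an odd power of s in
    its entries exactly when it exchanges two letters, which changes it. *)
Definition inv_odd (f : S) : bool :=
  \big[addb/false]_(ij : 'I_m.+1 * 'I_m.+1 | (ij.1 < ij.2)%N) (f ij.2 < f ij.1)%N.

Lemma inv_odd_swap p (f : S) : (p < m)%N -> f (inord p) != f (inord p.+1) ->
  inv_odd (swap p f) = ~~ inv_odd f.
Proof.
move=> pm ne; set p0 : 'I_m.+1 := inord p; set p1 : 'I_m.+1 := inord p.+1.
have p0E : p0 = p :> nat by rewrite inordK; lia.
have p1E : p1 = p.+1 :> nat by rewrite inordK; lia.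
have lt01 : (p0 < p1)%N by rewrite p0E p1E.
rewrite /inv_odd (bigD1 (p0, p1)) //= [in RHS](bigD1 (p0, p1)) //= -addNb.
have -> : (swap p f p1 < swap p f p0)%N = ~~ (f p1 < f p0)%N.
  rewrite !ffunE tpermL tpermR -/p0 -/p1; case: (ltngtP (f p0) (f p1)) => // /val_inj e.
  by rewrite e eqxx in ne.
congr (_ (+) _); pose h (ij : 'I_m.+1 * 'I_m.+1) := (tperm p0 p1 ij.1, tperm p0 p1 ij.2).
have hK : involutive h by case=> i j; rewrite /h /= !tpermK.
rewrite [RHS](reindex_inj (can_inj hK)) /=; apply: eq_big => [[i j]|[i j] _] /=; last first.
  by rewrite !ffunE.
rewrite !xpair_eqE.
have tv (k : 'I_m.+1) : tperm p0 p1 k = (if k == p :> nat then p.+1 else if k == p.+1 :> nat then p else k) :> nat.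
  case: tpermP => [->|->|n0 n1]; rewrite ?p0E ?p1E ?eqxx //.
    by rewrite (_ : p.+1 == p = false) //; lia.
  have -> : (k == p :> nat) = false by apply/eqP => e; apply: n0; apply: val_inj; rewrite /= p0E.
  by have -> : (k == p.+1 :> nat) = false by apply/eqP => e; apply: n1; apply: val_inj; rewrite /= p1E.
rewrite -!val_eqE /= !tv p0E p1E.
by do !case: eqP => ? //=; lia.
Qed.

(** The entries lie in E, which is to be Q(q), up to the factor s that a change of
    parity brings; so the diagonal entries lie in E. *)
Definition even_mx (X : 'M[F]_#|S|) :=
  forall f g, E (s ^+ (inv_odd f (+) inv_odd g) * ent X f g).

Lemma even_mx1 : even_mx 1.
Proof.
move=> f g; rewrite ent1; have [->|_] := eqVneq f g; first by rewrite addbb mulr1.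
by rewrite mulr0; apply: even0.
Qed.

Lemma even_mxM X Y : even_mx X -> even_mx Y -> even_mx (X * Y).
Proof.
move=> hX hY f g; rewrite entM mulr_sumr; apply: even_sum => h _.
have := EM (hX f h) (hY h g); rewrite mulrACA.
case: (inv_odd f) (inv_odd h) (inv_odd g) => [] [] [] /=; rewrite ?expr0 ?expr1 ?mul1r ?mulr1 //.
all: by move=> h'; have := EM (EV Es) h'; rewrite -expr2 mulKf ?expf_neq0.
Qed.

Lemma even_mxB X Y : even_mx X -> even_mx Y -> even_mx (X - Y).
Proof. by move=> hX hY f g; rewrite entB mulrBr; apply: EB. Qed.

Lemma even_mxZ a X : E a -> even_mx X -> even_mx (a *: X).
Proof. by move=> ha hX f g; rewrite entZ mulrCA; apply: EM. Qed.

Lemma even_mx_sum (I : Type) (l : seq I) (P : pred I) (X : I -> 'M[F]_#|S|) :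
  (forall i, P i -> even_mx (X i)) -> even_mx (\sum_(i <- l | P i) X i).
Proof.
move=> h; apply: big_ind => // [f g|X1 X2 h1 h2 f g].
  by rewrite /ent mxE mulr0; apply: even0.
by rewrite entD mulrDr; apply: evenD.
Qed.

Lemma even_mx_prod (I : eqType) (l : seq I) (X : I -> 'M[F]_#|S|) :
  (forall i, i \in l -> even_mx (X i)) -> even_mx (\prod_(i <- l) X i).
Proof.
elim: l => [|i l IH] h; first by rewrite big_nil; apply: even_mx1.
rewrite big_cons; apply: even_mxM; first by apply: h; rewrite mem_head.
by apply: IH => j jl; apply: h; rewrite inE jl orbT.
Qed.

Lemma even_braid p : (p < m)%N -> even_mx (braid_mx s N m p).
Proof.
move=> pm f g; rewrite ent_ker /braid_ker.
case: (eqVneq (f _)) => [_|ne].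
  have [->|_] := eqVneq g f; first by rewrite addbb mulr1.
  by rewrite mulr0; apply: even0.
have [->|ng] := eqVneq g (swap p f).
  have -> : (swap p f == f) = false.
    apply: contraNF ne => /eqP/ffunP/(_ (inord p)); rewrite ffunE tpermL => ->.
    exact: eqxx.
  rewrite inv_odd_swap // addbN addbb /= expr1 !mulr0 if_same addr0 mulr1 divff //.
rewrite mulr0 add0r; have [->|_] := eqVneq g f; last first.
  by rewrite !mulr0 if_same mulr0; apply: even0.
rewrite addbb mul1r mulr1; case: ifP => _; last exact: even0.
by rewrite exprVn; apply: EB => //; apply: EV.
Qed.

Lemma even_tw w : all (fun p => p < m)%N w -> even_mx (tw (braid_mx s N m) w).
Proof. by move=> /allP wm; apply: even_mx_prod => p /wm; apply: even_braid. Qed.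

Lemma even_block b a k : (b + a + k <= m.+1)%N -> even_mx (block_cross (braid_mx s N m) b a k).
Proof.
elim: k => [|k IH] h; first by rewrite block_cross0; apply: even_mx1.
rewrite block_crossS; apply: even_mxM; last by apply: IH; lia.
by apply: even_tw; apply/allP => i; rewrite mem_iota; lia.
Qed.

Lemma even_qsym b k : (b + k <= m.+1)%N -> even_mx (qsym s (braid_mx s N m) b k).
Proof.
elim: k => [|k IH] h; first by rewrite qsym0; apply: even_mx1.
rewrite qsymS; apply: even_mxM; first by apply: IH; lia.
apply: even_mxZ; first by apply: EV; apply: even_sum => j _; apply: evenX.
apply: even_mx_sum => j _; apply: even_mxZ; first exact: evenX.
by apply: even_tw; apply: all_desc; have := ltn_ord j; lia.
Qed.

Lemma even_cable r n w : all (fun i => i.+1 < n)%N w -> (n * r <= m.+1)%N ->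
  even_mx (cable_word (braid_mx s N m) r w).
Proof.
move=> /allP wn nm; apply: even_mx_prod => i /wn lt; apply: even_block.
have : (i.+2 * r <= n * r)%N by rewrite leq_mul2r lt orbT.
by rewrite !mulSn; lia.
Qed.

Lemma even_proj r n : (n * r <= m.+1)%N -> even_mx (block_proj s (braid_mx s N m) r n).
Proof.
move=> nm; apply: even_mx_prod => i; rewrite mem_iota => /andP[_ lt]; apply: even_qsym.
have : (i.+1 * r <= n * r)%N by rewrite leq_mul2r lt orbT.
by rewrite !mulSn; lia.
Qed.

Lemma even_diag X f : even_mx X -> E (ent X f f).
Proof. by move/(_ f f); rewrite addbb mul1r. Qed.

End Parity.

(** * States with a given order pattern *)

Section PatternSums.
Variables (F : fieldType) (s : F) (v : nat -> F -> Prop) (E : F -> Prop).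
Hypothesis V : order_at_infinity s v.
Hypotheses (E1 : E 1) (EB : forall x y, E x -> E y -> E (x - y))
  (EM : forall x y, E x -> E y -> E (x * y)) (EV : forall x, E x -> E x^-1)
  (Es : E (s ^+ 2)).

Section Chain.
Variable b : nat -> bool.

(** [b i] tells whether the pattern increases strictly from [i] to [i.+1]. *)
Definition step_rel i (c a : nat) := if b i then (c < a)%N else c == a.

Definition chain N m (f : states N m) :=
  [forall i : 'I_m, step_rel i (f (inord i)) (f (inord i.+1))].

Fixpoint chain_sum m a : F :=
  s ^+ (2 * a) *
  if m is m'.+1 then \sum_(c < a.+1 | step_rel m' c a) chain_sum m' c else 1.

Lemma chain_snoc N m (f : states N m) a :
  chain (snoc f a) = chain f && step_rel m (f ord_max) a.
Proof.
have sm : snoc f a (inord m) = f ord_max by rewrite snoc_inord // inord_max.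
apply/forallP/andP => [h|[/forallP h hm] i].
  split; last by have := h ord_max; rewrite /= sm inord_max snoc_max.
  apply/forallP => i; have := h (widen_ord (leqnSn m) i); have := ltn_ord i => im.
  by rewrite /= !snoc_inord //; lia.
have [lt|ge] := ltnP i m.
  by have := h (Ordinal lt); rewrite /= !snoc_inord //; lia.
have -> : i = m :> nat by have := ltn_ord i; lia.
by rewrite sm inord_max snoc_max.
Qed.

Lemma chain_sumE N m (G : nat -> F) :
  \sum_(f : states N m | chain f) (\prod_p s ^+ (2 * f p)) * G (f ord_max) =
  \sum_(a < N) chain_sum m a * G a.
Proof.
elim: m G => [|m IH] G.
  rewrite (reindex (fun a : 'I_N => [ffun=> a] : states N 0)) /=; last first.
    exists (fun f : states N 0 => f ord0) => [a|f] _; first by rewrite ffunE.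
    by apply/ffunP => k; rewrite ffunE [k]ord1.
  apply: eq_big => [a|a _]; first by apply/forallP => -[].
  by rewrite big_ord1 !ffunE mulr1.
rewrite big_mkcond sum_snoc /=.
have -> : \sum_(f : states N m) \sum_a (if chain (snoc f a)
      then (\prod_p s ^+ (2 * snoc f a p)) * G (snoc f a ord_max) else 0) =
    \sum_(f : states N m | chain f) (\prod_p s ^+ (2 * f p)) *
      \sum_(a : 'I_N | step_rel m (f ord_max) a) s ^+ (2 * a) * G a.
  rewrite [RHS]big_mkcond; apply: eq_bigr => f _; case: ifP => cf; last first.
    by rewrite big1 // => a _; rewrite chain_snoc cf.
  rewrite mulr_sumr [RHS]big_mkcond; apply: eq_bigr => a _.
  rewrite chain_snoc cf /= snoc_max; case: ifP => // _.
  rewrite big_ord_recr /= snoc_max mulrA; congr (_ * _ * _); apply: eq_bigr => j _.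
  have -> : widen_ord (leqnSn m.+1) j = lift ord_max j.
    by apply: val_inj; rewrite /= /bump; have := ltn_ord j; lia.
  by rewrite snoc_lift.
rewrite (IH (fun c => \sum_(a : 'I_N | step_rel m c a) s ^+ (2 * a) * G a)) /=.
under eq_bigr => c _ do rewrite mulr_sumr.
rewrite (exchange_big_dep predT) //=; apply: eq_bigr => a _.
rewrite (big_ord_widen_cond N (fun c => step_rel m c a) (chain_sum m)); last exact: ltn_ord.
rewrite mulr_sumr mulr_suml; apply: eq_big => [c|c _]; last by ring.
by rewrite /step_rel; case: ifP => _; lia.
Qed.

Definition exp_sum (l : seq (F * nat)) (a : nat) : F :=
  \sum_(cb <- l) cb.1 * s ^+ (2 * (cb.2 * a)).

Lemma geom_neq0 k : (0 < k)%N ->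
  s ^+ (2 * k) - 1 != 0 /\ v (2 * k)%N (s ^+ (2 * k) - 1)^-1.
Proof.
move=> k0; have z1 : v 1 (- s^-1 ^+ (2 * k)).
  by apply: (oiN V); apply: (oiW V) (oi_invX V _); lia.
have [h1 h2] := oi_unit V z1; have sk := oi_neq0X V (2 * k).
have e : s ^+ (2 * k) - 1 = s ^+ (2 * k) * (1 - s^-1 ^+ (2 * k)).
  by rewrite mulrBr mulr1 exprVn divff.
split; first by rewrite e mulf_neq0.
by rewrite e invfM -exprVn; have := oiM V (oi_invX V (2 * k)) h1; rewrite addn0.
Qed.

Lemma geom_sum k a : (0 < k)%N ->
  \sum_(c < a) s ^+ (2 * (k * c)) = (s ^+ (2 * (k * a)) - 1) / (s ^+ (2 * k) - 1).
Proof.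
move=> /geom_neq0 [n0 _]; elim: a => [|a IH]; first by rewrite big_ord0 muln0 expr0 subrr mul0r.
rewrite big_ord_recr /= IH mulnS mulnDr exprD.
by field.
Qed.

Lemma sum_exp_sum l a : (forall cb, cb \in l -> (0 < cb.2)%N) ->
  \sum_(c < a) exp_sum l c =
  \sum_(cb <- l) cb.1 / (s ^+ (2 * cb.2) - 1) * (s ^+ (2 * (cb.2 * a)) - 1).
Proof.
move=> pos; rewrite exchange_big /= !big_seq; apply: eq_bigr => cb /pos p0.
by rewrite -mulr_sumr geom_sum // mulrA mulrAC.
Qed.

(** Each chain sum is an exponential polynomial in its last letter, and the
    geometric summations keep its coefficients small. *)
Lemma chain_sum_exp m : exists l : seq (F * nat),
  (forall cb, cb \in l -> [/\ (0 < cb.2 <= m.+1)%N, E cb.1 & v (2 * (m.+1 - cb.2))%N cb.1]) /\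
  forall a, chain_sum m a = exp_sum l a.
Proof.
elim: m => [|m [l [hl IH]]].
  exists [:: (1, 1%N)]; split=> [cb|a].
    by rewrite inE => /eqP -> /=; split=> //; rewrite subnn; apply: (oi1 V).
  by rewrite /exp_sum big_seq1 /= mul1r mulr1 mul1n.
case bm: (b m).
  pose q (cb : F * nat) := cb.1 / (s ^+ (2 * cb.2) - 1).
  exists ([seq (q cb, cb.2.+1) | cb <- l] ++ [seq (- q cb, 1%N) | cb <- l]); split.
    have hq cb : cb \in l -> [/\ (0 < cb.2 <= m.+1)%N, E (q cb) & v (2 * m.+1)%N (q cb)].
      move=> /hl [/andP[h0 h1] h2 h3]; split; first by rewrite h0.
        by apply: EM => //; apply: EV; apply: EB => //; apply: evenX.
      have := oiM V h3 (geom_neq0 h0).2.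
      by rewrite -mulnDr subnK.
    move=> cb; rewrite mem_cat => /orP[] /mapP[cb' /hq [/andP[h0 h1] h2 h3] ->] /=.
      by split=> //; apply: (oiW V) h3; lia.
    split=> //; first by apply: (evenN E1 EB).
    by rewrite subSS subn0; apply: (oiN V).
  move=> a; have -> : chain_sum m.+1 a = s ^+ (2 * a) * \sum_(c < a) exp_sum l c.
    rewrite /=; congr (_ * _).
    rewrite big_mkcond big_ord_recr /= {2}/step_rel bm ltnn addr0.
    by apply: eq_bigr => c _; rewrite /step_rel bm ltn_ord IH.
  rewrite sum_exp_sum => [|cb /hl[/andP[]] //].
  rewrite /exp_sum big_cat !big_map /= -big_split /= mulr_sumr; apply: eq_bigr => cb _.
  rewrite -/(q cb) mul1n (mulSn cb.2 a) mulnDr exprD.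
  by move: (q cb) (s ^+ (2 * a)) (s ^+ _) => x y w; ring.
exists [seq (cb.1, cb.2.+1) | cb <- l]; split.
  by move=> cb /mapP[cb' /hl[/andP[h0 h1] h2 h3] ->] /=; split.
move=> a; rewrite /= big_mkcond big_ord_recr /= {2}/step_rel bm eqxx.
rewrite big1 => [|c _]; last first.
  by rewrite /step_rel bm; case: eqP => // e; have := ltn_ord c; rewrite e ltnn.
rewrite add0r IH /exp_sum big_map mulr_sumr; apply: eq_bigr => cb _ /=.
by rewrite (mulSn cb.2 a) mulnDr exprD; move: (cb.1) (s ^+ (2 * a)) (s ^+ _) => x y w; ring.
Qed.

End Chain.

Lemma sorted_perm N m (u : states N m) :
  exists p : 'S_m.+1, forall i j : 'I_m.+1, (i <= j)%N -> (u (p i) <= u (p j))%N.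
Proof.
pose le (i j : 'I_m.+1) := (u i <= u j)%N.
have le_tot : total le by move=> i j; apply: leq_total.
have le_tr : transitive le by move=> i j k; apply: leq_trans.
pose l := sort le (enum 'I_m.+1).
have sz : size l = m.+1 by rewrite size_sort size_enum_ord.
have un : uniq l by rewrite sort_uniq enum_uniq.
have inj : injective (fun i : 'I_m.+1 => nth ord0 l i).
  by move=> i j /eqP; rewrite nth_uniq ?sz // => /eqP e; apply: val_inj.
exists (perm inj) => i j ij; rewrite !permE.
have so : sorted le l by apply: sort_sorted.
have le_refl : reflexive le by move=> k; apply: leqnn.
by apply: (sorted_leq_nth le_tr le_refl ord0 so); rewrite ?inE ?sz.
Qed.

Lemma wt_pull N m (f : states N m) p : wt s (pull f p) = wt s f.
Proof.
rewrite /wt [RHS](reindex_inj (@perm_inj _ p)) /=.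
by apply: eq_bigr => k _; rewrite ffunE.
Qed.

Lemma order_iso_chain N N' m (f : states N m) (u : states N' m) :
  (forall i j : 'I_m.+1, (i <= j)%N -> (u i <= u j)%N) ->
  order_iso f u = chain (fun i => (u (inord i) < u (inord i.+1))%N) f.
Proof.
move=> so; apply/idP/forallP => [fu i|h].
  rewrite /step_rel -(order_iso_lt _ _ fu); case: ifP => // /negbT.
  rewrite -leqNgt => le; rewrite eqn_leq le andbT.
  rewrite (order_isoP _ _ fu) so //.
  by have := ltn_ord i => im; rewrite !inordK; lia.
have key d i : (i + d <= m)%N ->
    (f (inord i) <= f (inord (i + d)))%N /\
    (f (inord i) < f (inord (i + d)))%N = (u (inord i) < u (inord (i + d)))%N.
  elim: d => [|d IH] h1; first by rewrite addn0 leqnn !ltnn.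
  have [le e] := IH ltac:(lia).
  have lt : (i + d < m)%N by lia.
  have := h (Ordinal lt); rewrite /step_rel /= addnS.
  have su : (u (inord i) <= u (inord (i + d)))%N by apply: so; rewrite !inordK; lia.
  have su' : (u (inord (i + d)) <= u (inord (i + d).+1))%N by apply: so; rewrite !inordK; lia.
  by move: e su su' le; case: ifP; lia.
have key' (i j : 'I_m.+1) : (i <= j)%N -> (f i <= f j)%N /\ (f i < f j)%N = (u i < u j)%N.
  move=> ij; have := key (j - i)%N i; rewrite subnKC // !inord_val; apply.
  by have := ltn_ord j; lia.
apply/order_isoP => i j; have [ij|/ltnW ij] := leqP i j.
  by have [-> _] := key' i j ij; rewrite so.
by have [_] := key' j i ij; rewrite !ltnNge => /(congr1 negb); rewrite !negbK.
Qed.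

(** After sorting the positions, the states with a given pattern are chains.  The
    sum over their last letter is geometric, and its upper limit N gives powers of
    q^N = a. *)
Lemma pattern_sum N' m (u : states N' m) : exists l : seq (F * nat),
  (forall cb, cb \in l -> E cb.1 /\ v (2 * m.+1)%N cb.1) /\
  forall N, \sum_(f : states N m | order_iso f u) wt s f =
    (\sum_(cb <- l) cb.1 * (s ^+ (2 * (cb.2 * N)) - 1)) / s ^+ (N.-1 * m.+1).
Proof.
have [p so] := sorted_perm u; set u' := pull u p.
have so' (i j : 'I_m.+1) : (i <= j)%N -> (u' i <= u' j)%N by rewrite !ffunE; apply: so.
set b := fun i => (u' (inord i) < u' (inord i.+1))%N.
have [l [hl lE]] := chain_sum_exp b m.
exists [seq (cb.1 / (s ^+ (2 * cb.2) - 1), cb.2) | cb <- l]; split.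
  move=> cb /mapP[cb' /hl[/andP[h0 h1] h2 h3] ->] /=; split.
    by apply: EM => //; apply: EV; apply: EB => //; apply: evenX.
  by have := oiM V h3 (geom_neq0 h0).2; rewrite -mulnDr subnK.
move=> N; have pK : cancel (fun f : states N m => pull f p^-1) (fun f => pull f p).
  by move=> f; apply/ffunP => k; rewrite !ffunE permK.
rewrite (reindex_inj (can_inj pK)) /=.
have -> : \sum_(f : states N m | order_iso (pull f p^-1) u) wt s (pull f p^-1) =
    \sum_(f : states N m | chain b f) (\prod_k s ^+ (2 * f k)) * (s ^+ (N.-1 * m.+1))^-1.
  apply: eq_big => [f|f _].
    rewrite -(order_iso_chain f so'); apply/order_isoP/order_isoP => h i j.
      by have := h (p i) (p j); rewrite !ffunE !permK.
    by have := h (p^-1 i)%g (p^-1 j)%g; rewrite !ffunE !permKV.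
  by rewrite wt_pull /wt big_split /= prodr_const card_ord exprVn -exprM.
rewrite (chain_sumE b N m (fun=> (s ^+ (N.-1 * m.+1))^-1)) -mulr_suml; congr (_ / _).
rewrite (eq_bigr (fun a : 'I_N => exp_sum l a)) => [|a _]; last exact: lE.
by rewrite sum_exp_sum ?big_map // => cb /hl[/andP[]].
Qed.

End PatternSums.

(** * Functions of N interpolated by rational functions of a and q *)

Section Interpolation.
Variables (B : idomainType) (K : fieldType) (s : K) (ev : nat -> {poly B} -> K).
Hypotheses (ev1 : forall N, ev N 1 = 1)
  (evB : forall N u v, ev N (u - v) = ev N u - ev N v)
  (evM : forall N u v, ev N (u * v) = ev N u * ev N v).

(** With [ev N] the substitution a = q^N and q for the variable of u and v, the
    fraction q^(-d/2) u / v takes the values x N and lies in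
    q^(-d/2) Q(a^(1/2))[[q^-1]]. *)
Definition interpolated (d : nat) (x : nat -> K) :=
  exists u v : {poly B}, [/\ v != 0, (size u <= size v)%N &
    forall N, (2 <= N)%N -> x N * (s ^+ d * ev N v) = ev N u].

Lemma ev0 N : ev N 0 = 0.
Proof. by rewrite -(subrr 1) evB subrr. Qed.

Lemma evN N u : ev N (- u) = - ev N u.
Proof. by rewrite -sub0r evB ev0 sub0r. Qed.

Lemma evD N u v : ev N (u + v) = ev N u + ev N v.
Proof. by rewrite -{1}[v]opprK evB evN opprK. Qed.

Lemma interp0 d : interpolated d (fun=> 0).
Proof.
exists 0, 1; rewrite oner_eq0 size_poly0; split=> // N _.
by rewrite mul0r ev0.
Qed.

Lemma interp_ext d x y : (forall N, (2 <= N)%N -> x N = y N) ->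
  interpolated d x -> interpolated d y.
Proof. by move=> e [u [v [v0 le h]]]; exists u, v; split=> // N N2; rewrite -e ?h. Qed.

Lemma interp_quot (u v : {poly B}) x : v != 0 -> (size u <= size v)%N ->
  (forall N, (2 <= N)%N -> x N * ev N v = ev N u) -> interpolated 0 x.
Proof. by move=> v0 le h; exists u, v; split=> // N N2; rewrite expr0 mul1r h. Qed.

Lemma interp1 : interpolated 0 (fun=> 1).
Proof. by apply: (@interp_quot 1 1); rewrite ?oner_eq0 // => N _; rewrite mul1r. Qed.

Lemma interpN d x : interpolated d x -> interpolated d (fun N => - x N).
Proof.
move=> [u [v [v0 le h]]]; exists (- u), v; rewrite size_polyN; split=> // N N2.
by rewrite mulNr h // evN.
Qed.

Lemma interpD d x y : interpolated d x -> interpolated d y ->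
  interpolated d (fun N => x N + y N).
Proof.
move=> [u [v [v0 le h]]] [u' [v' [v0' le' h']]].
exists (u * v' + u' * v), (v * v'); split; first by rewrite mulf_neq0.
  apply: size_addL.
    by have := @size_mul_mono _ 0 u _ _ v0' v0; rewrite !addn0; apply.
  by have := @size_mul_mono _ 0 u' _ _ v0 v0'; rewrite !addn0 [v' * v]mulrC; apply.
by move=> N N2; rewrite evD !evM -h // -h' //; ring.
Qed.

Lemma interpB d x y : interpolated d x -> interpolated d y ->
  interpolated d (fun N => x N - y N).
Proof. by move=> hx hy; apply: interpD => //; apply: interpN. Qed.

Lemma interpM d e x y : interpolated d x -> interpolated e y ->
  interpolated (d + e) (fun N => x N * y N).
Proof.
move=> [u [v [v0 le h]]] [u' [v' [v0' le' h']]].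
exists (u * u'), (v * v'); split; first by rewrite mulf_neq0.
  have [->|u0'] := eqVneq u' 0; first by rewrite mulr0 size_poly0.
  apply: (@leq_trans (size (v * u')%R)).
    by have := @size_mul_mono _ 0 u _ _ u0' v0; rewrite !addn0; apply.
  have := @size_mul_mono _ 0 u' _ _ v0 v0'; rewrite !addn0 mulrC [v' * v]mulrC; apply.
  exact: le'.
by move=> N N2; rewrite !evM -h // -h' // exprD; ring.
Qed.

Lemma interp_sum d (I : eqType) (l : seq I) (x : I -> nat -> K) :
  (forall i, i \in l -> interpolated d (x i)) ->
  interpolated d (fun N => \sum_(i <- l) x i N).
Proof.
elim: l => [|i l IH] h.
  by apply: interp_ext (interp0 d) => N _; rewrite big_nil.
apply: interp_ext (interpD (h i (mem_head _ _)) (IH _)) => [N _|j jl].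
  by rewrite big_cons.
by apply: h; rewrite inE jl orbT.
Qed.

Lemma interp_mul_s d k x : interpolated (d + k) x ->
  interpolated d (fun N => s ^+ k * x N).
Proof.
move=> [u [v [v0 le h]]]; exists u, v; split=> // N N2.
by rewrite -h // exprD; ring.
Qed.

End Interpolation.

Local Notation s := rvar.
Local Notation z := (rvar^-1).

Lemma frac_sub (K : fieldType) (a b c d : K) : b != 0 -> d != 0 ->
  a / b - c / d = (a * d - c * b) / (b * d).
Proof. by move=> b0 d0; field; rewrite b0 d0. Qed.

Lemma frac_cross (K : fieldType) (a b u v : K) : b != 0 -> v != 0 ->
  u / v = a / b -> u * b = a * v.
Proof. by move=> b0 v0 /eqP; rewrite eqr_div // => /eqP. Qed.

Lemma frac_cancel (K : fieldType) (u v w : K) : v != 0 -> u / v * (w * v) = u * w.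
Proof. by move=> v0; rewrite mulrACA [u * w]mulrC [_ * v]mulrC divff // mulr1 mulrC. Qed.

Section EvenFunctions.
Local Notation sq u := (u \Po 'X^2).

(** Q(q) inside Q(q^(1/2)). *)
Definition evenf (x : ratfun) : Prop :=
  exists u v : {poly rat}, v != 0 /\ x = (sq u)%:F / (sq v)%:F.

Lemma sq_neq0 (R : idomainType) (v : {poly R}) : v != 0 -> sq v != 0.
Proof. by move=> v0; rewrite comp_poly_eq0 ?size_polyXn. Qed.

Lemma sqF_neq0 (v : {poly rat}) : v != 0 -> (sq v)%:F != 0 :> ratfun.
Proof. by move=> v0; rewrite tofrac_eq0; apply: sq_neq0. Qed.

Lemma evenf1 : evenf 1.
Proof.
exists 1, 1; rewrite oner_eq0; split=> //.
by rewrite (rmorph1 (comp_poly _)) rmorph1 divr1.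
Qed.

Lemma evenfB x y : evenf x -> evenf y -> evenf (x - y).
Proof.
move=> [u [v [v0 ->]]] [u' [v' [v0' ->]]].
exists (u * v' - u' * v), (v * v'); split; first by rewrite mulf_neq0.
rewrite comp_polyB !comp_polyM tofracB !tofracM.
by apply: frac_sub; apply: sqF_neq0.
Qed.

Lemma evenfM x y : evenf x -> evenf y -> evenf (x * y).
Proof.
move=> [u [v [v0 ->]]] [u' [v' [v0' ->]]].
exists (u * u'), (v * v'); split; first by rewrite mulf_neq0.
by rewrite !rmorphM /= mulf_div.
Qed.

Lemma evenfV x : evenf x -> evenf x^-1.
Proof.
move=> [u [v [v0 ->]]]; have [->|u0] := eqVneq u 0.
  exists 0, 1; rewrite oner_eq0; split=> //.
  by rewrite comp_poly0 rmorph0 !mul0r invr0.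
by exists v, u; rewrite invf_div.
Qed.

Lemma evenf_sqr : evenf (s ^+ 2).
Proof.
exists 'X, 1; rewrite oner_eq0; split=> //.
by rewrite comp_polyX (rmorph1 (comp_poly _)) rmorph1 divr1 rmorphXn.
Qed.

Lemma size_sq (R : idomainType) (u : {poly R}) : u != 0 ->
  (size (sq u)).+1 = (size u).*2.
Proof.
move=> u0; have h1 := size_pos (sq_neq0 u0); have h2 := size_pos u0.
rewrite -(prednK h1) size_comp_poly size_polyXn -[in RHS](prednK h2) doubleS.
by rewrite muln2.
Qed.

(** The order of a fraction at q = oo is half its order at s = oo. *)
Lemma even_ord (R : idomainType) d (u v a b : {poly R}) : u != 0 -> v != 0 -> b != 0 ->
  (size a + d.*2 <= size b)%N -> sq u * b = a * sq v -> (size u + d <= size v)%N.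
Proof.
move=> u0 v0 b0 le e.
have a0 : a != 0.
  by apply: contraNneq (mulf_neq0 (sq_neq0 u0) b0) => a0; rewrite e a0 mul0r.
have := congr1 (fun p : {poly R} => size p) e.
rewrite (size_mul (sq_neq0 u0) b0) (size_mul a0 (sq_neq0 v0)).
have := size_sq u0; have := size_sq v0; have := size_pos a0; have := size_pos b0.
have := size_pos u0; have := size_pos v0.
have := size_pos (sq_neq0 u0); have := size_pos (sq_neq0 v0).
lia.
Qed.

End EvenFunctions.

Section Specialization.
Local Notation sq u := (u \Po 'X^2).

Lemma specializeE N u :
  specialize N u = (map_poly (comp_poly 'X^N) u).['X].
Proof.
rewrite (@horner_coef_wide _ (size u)); last exact: size_poly.
by apply: eq_bigr => i _; rewrite coef_map.
Qed.

Lemma specialize1 N : specialize N 1 = 1.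
Proof. by rewrite specializeE rmorph1 hornerC. Qed.

Lemma specializeB N u v : specialize N (u - v) = specialize N u - specialize N v.
Proof. by rewrite !specializeE rmorphB hornerD hornerN. Qed.

Lemma specializeM N u v : specialize N (u * v) = specialize N u * specialize N v.
Proof. by rewrite !specializeE rmorphM hornerM. Qed.

Lemma specializeC N c : specialize N c%:P = c \Po 'X^N.
Proof. by rewrite specializeE map_polyC hornerC. Qed.

Lemma specializeX N k : specialize N 'X^k = 'X^k.
Proof. by rewrite specializeE map_polyXn hornerXn. Qed.

Lemma specialize_lift N (u : {poly rat}) : specialize N (map_poly polyC u) = u.
Proof.
rewrite specializeE -map_poly_comp -[RHS]comp_polyXr /comp_poly.
congr (_.[_]); apply: eq_map_poly => c /=.
by rewrite comp_polyC.
Qed.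

(** The substitution a = q^N, from polynomials in q over Q[a^(1/2)] to Q(q^(1/2)). *)
Definition evq N (u : {poly {poly rat}}) : ratfun := (specialize N (sq u))%:F.

Lemma evq1 N : evq N 1 = 1.
Proof. by rewrite /evq (rmorph1 (comp_poly _)) specialize1 rmorph1. Qed.

Lemma evqB N u v : evq N (u - v) = evq N u - evq N v.
Proof. by rewrite /evq (rmorphB (comp_poly _)) specializeB rmorphB. Qed.

Lemma evqM N u v : evq N (u * v) = evq N u * evq N v.
Proof. by rewrite /evq (rmorphM (comp_poly _)) specializeM rmorphM. Qed.

Lemma evqC N c : evq N c%:P = (c \Po 'X^N)%:F.
Proof. by rewrite /evq comp_polyC specializeC. Qed.

Lemma evqX N k : evq N 'X^k = s ^+ (2 * k).
Proof.
rewrite /evq rmorphXn /= comp_polyX -exprM specializeX rmorphXn.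
by [].
Qed.

Lemma evq_a N k : evq N ('X^k)%:P = (s ^+ N) ^+ k.
Proof. by rewrite evqC rmorphXn /= comp_polyX !rmorphXn. Qed.

Lemma evq_lift N u : evq N (map_poly polyC u) = (sq u)%:F.
Proof.
rewrite /evq -(specialize_lift N (sq u)); congr (specialize _ _)%:F.
rewrite map_comp_poly map_polyXn.
by [].
Qed.

End Specialization.

Local Notation interp := (interpolated s evq).

Lemma interp_a k : interp 0 (fun N => (s ^+ N) ^+ k).
Proof.
apply: (@interp_quot _ _ _ _ ('X^k)%:P 1); rewrite ?oner_eq0 //.
  by rewrite size_poly1; apply: size_polyC_leq1.
by move=> N _; rewrite evq1 mulr1 evq_a.
Qed.

Lemma interp_a_inv k : interp 0 (fun N => (s ^+ N) ^- k).
Proof.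
have X0 : 'X^k != 0 :> {poly rat} by rewrite monic_neq0 ?monicXn.
apply: (@interp_quot _ _ _ _ 1 ('X^k)%:P); first by rewrite polyC_eq0.
  by rewrite size_poly1 size_polyC X0.
by move=> N _; rewrite evq1 evq_a mulVf // !expf_neq0 ?rvar_neq0.
Qed.

Lemma interp_const e c : evenf c -> ord_ge (2 * e) c -> interp (2 * e) (fun=> c).
Proof.
move=> [u [v [v0 cE]]] [a [b [b0 cE' le]]].
have [u0|u0] := eqVneq u 0.
  apply: interp_ext (interp0 _ evqB _) => N _.
  by rewrite cE u0 comp_poly0 rmorph0 mul0r.
have lift0 : map_poly polyC v != 0 :> {poly {poly rat}}.
  by rewrite -size_poly_eq0 size_map_polyC size_poly_eq0.
exists (map_poly polyC u * 'X^e), (map_poly polyC v); split=> //.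
  rewrite size_mulXn ?size_map_polyC; last by rewrite -size_poly_eq0 size_map_polyC size_poly_eq0.
  rewrite addnC; apply: (@even_ord _ e u v a b) => //; first by rewrite -mul2n.
  apply/eqP; rewrite -tofrac_eq !rmorphM /=; apply/eqP; apply: frac_cross.
  - by rewrite tofrac_eq0.
  - exact: sqF_neq0.
  - by rewrite -cE.
move=> N _; rewrite evqM evqX !evq_lift cE.
by apply: frac_cancel; apply: sqF_neq0.
Qed.

Local Notation V := rvar_order_at_infinity.

Lemma inv_pred_pow (K : fieldType) (x w : K) N k : x != 0 -> (0 < N)%N ->
  w / x ^+ (N.-1 * k) = x ^+ k * w * (x ^+ N) ^- k.
Proof.
move=> x0 N0; rewrite -{2}(prednK N0) exprS exprMn exprM invfM.
by rewrite mulrA [x ^+ k * w]mulrC mulfK // expf_neq0.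
Qed.

(** By naturality the size of the operators on m.+1 letters controls their trace
    uniformly in N.  The sum of s^(2 f p) over the states of a pattern has order
    2 (m.+1), of which the normalization s^(1 - N) of the weights takes back half. *)
Lemma interp_qtr m (X : forall N, 'M[ratfun]_#|states N m|) d :
  natural X -> even_mx s evenf (X m.+1) -> mx_ord_ge (@ord_ge rat) (2 * d) (X m.+1) ->
  interp (2 * d + m.+1) (fun N => qtr s (X N)).
Proof.
move=> nX eX oX.
apply: (@interp_ext _ _ _ _ _ (fun N => \sum_(u <- index_enum (states m.+1 m))
    ent (X m.+1) u u *
    (if rank u == u then \sum_(f : states N m | order_iso f u) wt s f else 0))).
  by move=> N _; rewrite (qtr_patterns s N nX).
apply: (interp_sum evqB evqM) => u _; apply: (interpM evqM).
  by apply: interp_const (oX _ _); apply: even_diag.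
case: (rank u == u); last exact: (interp0 _ evqB).
have [l [hl lE]] := pattern_sum V evenf1 evenfB evenfM evenfV evenf_sqr u.
apply: (@interp_ext _ _ _ _ _ (fun N => s ^+ m.+1 *
    (\sum_(cb <- l) cb.1 * ((s ^+ N) ^+ (2 * cb.2) - 1)) * (s ^+ N) ^- m.+1)).
  move=> N N2; rewrite lE inv_pred_pow ?rvar_neq0 //; last by lia.
  congr (_ * _ * _); apply: eq_bigr => cb _.
  by rewrite -exprM [(N * _)%N]mulnC mulnA.
have := @interpM _ _ _ _ evqM m.+1 0; rewrite addn0; apply; last exact: interp_a_inv.
apply: interp_mul_s; rewrite addnn -mul2n; apply: (interp_sum evqB evqM) => cb cbl.
have [h1 h2] := hl _ cbl.
have := @interpM _ _ _ _ evqM (2 * m.+1) 0; rewrite addn0; apply.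
  exact: interp_const.
by apply: (interpB evqB evqM); [apply: interp_a|apply: interp1].
Qed.

Section PositiveWords.
Variable r' : nat.
Local Notation r := r'.+1.
Local Notation T n N := (braid_mx s N (n.+1 * r).-1).

Definition cable_trace n w N : ratfun :=
  qtr s (cable_word (T n N) r w * block_proj s (T n N) r n.+1).

Lemma block_size n : (n.+1 * r = (n.+1 * r).-1.+1)%N.
Proof. by rewrite prednK // muln_gt0. Qed.

(** The estimate on the operators becomes one on the traces, for a and q
    independent. *)
Lemma cable_trace_demazure n w w' : demazure w w' -> all (fun i => i < n)%N w ->
  interp (n.+1 * r + 2 * r) (fun N => cable_trace n w N - cable_trace n w' N).
Proof.
move=> h wn; set m := (n.+1 * r).-1.
have wn1 : all (fun i => i.+1 < n.+1)%N w by [].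
have wn1' : all (fun i => i.+1 < n.+1)%N w'.
  by apply/allP => i iw; apply: (allP wn1); rewrite (demazure_mem h).
have nm : (n.+1 * r <= m.+1)%N by rewrite -block_size.
pose X N := (cable_word (braid_mx s N m) r w - cable_word (braid_mx s N m) r w')
  * block_proj s (braid_mx s N m) r n.+1.
apply: (@interp_ext _ _ _ _ _ (fun N => qtr s (X N))).
  by move=> N _; rewrite /X mulrBl qtrB.
rewrite addnC [X in (_ + X)%N]block_size; apply: interp_qtr.
- apply: naturalM; last exact: natural_proj.
  by apply: naturalB; apply: natural_cable.
- apply: (even_mxM rvar_neq0 evenf1 evenfB evenfM evenfV evenf_sqr); last first.
    by apply: (even_proj rvar_neq0 evenf1 evenfB evenfM evenfV evenf_sqr).
  by apply: (even_mxB evenfB); apply: (even_cable rvar_neq0 evenf1 evenfB evenfM evenfV evenf_sqr (n := n.+1)).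
- have := cable_demazure V (braid_hecke rvar_neq0 V m.+1 m) (ltn0Sn r') h wn1 nm.
  by rewrite -mul2n.
Qed.

Lemma interp_zX k : interp k (fun=> z ^+ k).
Proof.
exists 1, 1; rewrite oner_eq0; split=> // N _.
by rewrite evq1 mulr1 -exprMn mulVf ?expr1n ?rvar_neq0.
Qed.

Lemma interp_framing k : interp k (fun N => (s ^+ N / s) ^+ k).
Proof.
apply: (@interp_ext _ _ _ _ _ (fun N => (s ^+ N) ^+ k * z ^+ k)).
  by move=> N _; rewrite exprMn.
by have := interpM evqM (interp_a k) (interp_zX k); rewrite add0n.
Qed.

(** Up to the error, the 0-Hecke relations leave one occurrence of the last
    generator, and the Markov property removes the last block.  Since every
    generator occurs, this goes on until the unknot is left. *)
Lemma cable_trace_head n w : all (fun i => i < n)%N w ->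
  (forall i, (i < n)%N -> i \in w) ->
  interp (n.+1 * r + 2 * r) (fun N => cable_trace n w N -
    (s ^+ N / s) ^+ (n * r) * cable_trace 0 [::] N).
Proof.
elim: n w => [|n IH] w wn full.
  have -> : w = [::] by case: w wn {full}.
  apply: interp_ext (interp0 _ evqB _) => N _.
  by rewrite mul0n expr0 mul1r subrr.
have [[w' h w'n]|[u [v [h un vn]]]] := demazure_last_once wn.
  have := full n (ltnSn n); rewrite (demazure_mem h) => nw.
  by have := allP w'n _ nw; rewrite ltnn.
have fvu i : (i < n)%N -> i \in v ++ u.
  move=> lt; have := full i (ltnW lt); rewrite (demazure_mem h) !mem_cat inE.
  by rewrite (ltn_eqF lt) orbC.
have vun : all (fun i => i < n)%N (v ++ u) by rewrite all_cat vn un.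
have e1 := cable_trace_demazure h wn.
have e2 := interpM evqM (interp_framing r) (IH _ vun fvu).
rewrite addnA [(r + _)%N](_ : _ = n.+2 * r)%N // in e2.
apply: interp_ext (interpD evqB evqM e1 e2) => N N2.
have -> : cable_trace n.+1 (u ++ n :: v) N = (s ^+ N / s) ^+ r * cable_trace n (v ++ u) N.
  rewrite /cable_trace (cable_markov V) // exprM; congr (_ ^+ _ * _).
  by rewrite -[in RHS](prednK (ltnW N2)) exprS mulrC mulKf ?rvar_neq0.
by rewrite mulrBr addrA subrK mulrA -exprD -mulSn.
Qed.

End PositiveWords.

(** * The invariants in terms of matrices *)

Section Represent.
Variables (N m : nat).
Local Notation t := (braid_mx s N m).

Definition represents (A : tensor N m -> tensor N m) (X : 'M[ratfun]_#|states N m|) :=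
  forall v f, A v f = mxact X v f.

Lemma represents_comp A X B Y : represents A X -> represents B Y ->
  represents (fun v => A (B v)) (X * Y).
Proof. by move=> hA hB v f; rewrite hA mxactM; apply: eq_mxact => g; apply: hB. Qed.

Lemma represents_Rmx p : represents (@Rmx N m p) (s *: t p).
Proof.
move=> v f; rewrite mxactZ mxact_braid /Rmx ffunE; case: ifP => // _.
rewrite mulrDr mulrA divff ?rvar_neq0 // mul1r; congr (_ + _).
case: ifP => _; last by rewrite mulr0.
by rewrite mulrA mulrBr mulr1 expr2 mulrA divff ?rvar_neq0 // mul1r.
Qed.

Lemma represents_word u : represents (@braid_act N m [seq (true, p) | p <- u])
  (s ^+ size u *: tw t u).
Proof.
elim: u => [|p u IH] v f; first by rewrite tw_nil expr0 scale1r mxact1.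
have := represents_comp (represents_Rmx p) IH v f; rewrite /= => ->.
by rewrite tw_cons scMl scMr scalerA -exprS.
Qed.

Lemma represents_qsym b k : represents (@symmetrizer N m b k) (qsym s t b k).
Proof.
elim: k => [|k IH] v f; first by rewrite qsym0 mxact1.
rewrite /= IH qsymS mxactM; apply: eq_mxact => g; rewrite ffunE mxactZ.
congr (_ * _).
rewrite mxact_sum; apply: eq_bigr => j _; rewrite mxactZ.
have -> : [seq (true, (b + k.-1 - i)%N) | i <- iota 0 j] = [seq (true, p) | p <- desc b k j].
  rewrite /desc -map_comp; apply/eq_in_map => i; rewrite mem_iota => ij /=.
  by have := ltn_ord j => jk; congr (_, _); lia.
rewrite represents_word mxactZ mulrA /desc size_map size_iota -exprD addnn.
by rewrite -mul2n.
Qed.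

Lemma represents_proj r n : represents
  (fun v : tensor N m => foldr (fun i => symmetrizer (i * r) r) v (iota 0 n))
  (block_proj s t r n).
Proof.
rewrite /block_proj; elim: (iota 0 n) => [|i l IH] v f.
  by rewrite big_nil mxact1.
by rewrite big_cons; apply: (represents_comp (represents_qsym _ _) IH).
Qed.

Lemma quantum_traceE A X : represents A X -> quantum_trace A = qtr s X.
Proof.
move=> h; apply: eq_bigr => f _; rewrite h; congr (_ * _).
  apply: eq_bigr => p _; rewrite expfzDr ?rvar_neq0 // -exprnP -mul2n.
  by rewrite -exprnN.
by rewrite -mxact_delta; apply: eq_mxact => g; rewrite ffunE.
Qed.

Definition letter_word r i :=
  flatten [seq [seq (i * r + (r.-1 - k) + j)%N | j <- iota 0 r] | k <- iota 0 r].

Lemma tw_letter r i : tw t (letter_word r i) = block_cross t (i * r) r r.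
Proof.
have row k : [seq (i * r + (r.-1 - k) + j)%N | j <- iota 0 r] = iota (i * r + (r.-1 - k)) r.
  by rewrite -{2}[(_ + (_ - _))%N]addn0 iotaDl.
rewrite /letter_word; under eq_map => k do rewrite row.
suff gen b K : tw t (flatten [seq iota (b + (K.-1 - k)) r | k <- iota 0 K]) =
    block_cross t b r K by apply: gen.
elim: K => [|K IH]; first by rewrite tw_nil block_cross0.
rewrite block_crossS -IH /= tw_cat subn0; congr (_ * tw _ (flatten _)).
rewrite -[1%N]addn0 iotaDl -map_comp; apply/eq_in_map => k; rewrite mem_iota => kK /=.
by congr (iota (_ + _) _); lia.
Qed.

Lemma size_letter r i : size (letter_word r i) = (r * r)%N.
Proof.
rewrite size_flatten /shape -map_comp sumnE big_map.
rewrite (eq_bigr (fun _ => r)) => [|k _]; last by rewrite /= size_map size_iota.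
by rewrite big_const_seq count_predT size_iota iter_addn_0.
Qed.

Definition gens n (w : braid_word n) : seq nat := [seq nat_of_ord l.2 | l <- w].

Lemma cable_positive n r (w : braid_word n) : positive_word w ->
  cable r w = [seq (true, p) | p <- flatten [seq letter_word r i | i <- gens w]].
Proof.
elim: w => //= -[[] i] w IH //= wp.
by rewrite /cable /= map_cat -/(cable r w) IH.
Qed.

Lemma represents_cable n r (w : braid_word n) : positive_word w ->
  represents (@braid_act N m (cable r w))
    (s ^+ (r * r * size w) *: cable_word t r (gens w)).
Proof.
move=> wp; rewrite cable_positive //.
have -> : s ^+ (r * r * size w) *: cable_word t r (gens w) =
    s ^+ size (flatten [seq letter_word r i | i <- gens w]) *:
    tw t (flatten [seq letter_word r i | i <- gens w]).
  elim: w {wp} => [|l w IH] /=; first by rewrite muln0 tw_nil /cable_word big_nil.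
  rewrite size_cat tw_cat size_letter tw_letter exprD mulnS exprD -!scalerA.
  rewrite -[X in _ = _ *: X]scMr -IH scMr /cable_word big_cons.
  by [].
exact: represents_word.
Qed.

End Represent.

Lemma writhe_positive n (w : braid_word n) : positive_word w -> writhe w = (size w)%:Z.
Proof.
elim: w => [|[[] i] w IH] //=; first by rewrite /writhe big_nil.
by move=> wp; rewrite /writhe big_cons /= -/(writhe w) IH // -intS.
Qed.

Lemma framing_cancel (K : fieldType) (x y : K) N r' L : x != 0 ->
  x ^- ((r'.+1 * N + r'.+1 * r') * L) * (x ^+ (r'.+1 * r'.+1 * L) * y) *
  (x ^+ N / x) ^+ (r'.+1 * L) = y.
Proof.
move=> x0.
have -> : (r'.+1 * r'.+1 * L = r'.+1 * r' * L + r'.+1 * L)%N by ring.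
have -> : ((r'.+1 * N + r'.+1 * r') * L = N * (r'.+1 * L) + r'.+1 * r' * L)%N by ring.
move: (r'.+1 * L)%N (r'.+1 * r' * L)%N => M P.
rewrite !exprD expr_div_n -!exprM.
move: (expf_neq0 (N * M) x0) (expf_neq0 P x0) (expf_neq0 M x0).
move: (x ^+ (N * M)) (x ^+ P) (x ^+ M) => a b c a0 b0 c0.
by field; rewrite b0 c0 a0.
Qed.

(** The r^2 crossings of a cabled generator each contribute a factor s, which
    leaves of the twist factor of Sym^r only (s^N / s)^r. *)
Lemma slN_cable_trace N r' n (w : braid_word n) : (0 < N)%N -> positive_word w ->
  slN_invariant N r'.+1 w * (s ^+ N / s) ^+ (r'.+1 * size w) =
  cable_trace r' n (gens w) N.
Proof.
move=> N0 wp; rewrite /slN_invariant /cable_trace.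
rewrite (quantum_traceE (represents_comp (@represents_cable N _ n r'.+1 w wp) (@represents_proj N _ r'.+1 n.+1))).
rewrite scMl qtrZ writhe_positive // -exprnN -exprM.
exact: framing_cancel rvar_neq0.
Qed.

(** * Power series *)

Section Series.
Variable K : fieldType.
Implicit Types (p q : {poly K}) (f g h : nat -> K).

Lemma size_series_quo_seq f g k : size (series_quo_seq f g k) = k.
Proof. by elim: k => //= k IH; rewrite size_rcons IH. Qed.

Lemma nth_series_quo_seq f g k i : (i < k)%N ->
  (series_quo_seq f g k)`_i = series_quo f g i.
Proof.
elim: k => // k IH ik; have [lt|ge] := ltnP i k.
  by rewrite /= nth_rcons size_series_quo_seq lt IH.
by have -> : i = k by lia.
Qed.

Lemma series_quoP f g k : g 0%N != 0 ->
  \sum_(i < k.+1) series_quo f g i * g (k - i)%N = f k.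
Proof.
move=> g0; rewrite big_ord_recr /= subnn.
have -> : series_quo f g k = (f k - \sum_(i < k) series_quo f g i * g (k - i)%N) / g 0%N.
  rewrite /series_quo /= nth_rcons size_series_quo_seq ltnn eqxx.
  congr ((_ - _) / _); apply: eq_bigr => i _; congr (_ * _).
  by rewrite nth_series_quo_seq.
by rewrite divfK // addrC subrK.
Qed.

Lemma series_unique f g h h' r : g 0%N != 0 ->
  (forall k, (k < r)%N -> \sum_(i < k.+1) h i * g (k - i)%N = f k) ->
  (forall k, (k < r)%N -> \sum_(i < k.+1) h' i * g (k - i)%N = f k) ->
  forall k, (k < r)%N -> h k = h' k.
Proof.
move=> g0 e e' k; elim/ltn_ind: k => k IH kr.
have := e k kr; rewrite -(e' k kr) !big_ord_recr /= subnn.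
rewrite (eq_bigr (fun i : 'I_k => h' i * g (k - i)%N)) => [|i _].
  by move/addrI/(mulIf g0).
by rewrite IH //; have := ltn_ord i; lia.
Qed.

Lemma coef_mul_low p p' q r k : (forall i, (i < r)%N -> p`_i = p'`_i) -> (k < r)%N ->
  (p * q)`_k = (p' * q)`_k.
Proof.
move=> e kr; rewrite !coefM; apply: eq_bigr => i _; rewrite e //.
by have := ltn_ord i; lia.
Qed.

Lemma qpoch_trunc (x : {poly K}) k r : (k < r)%N ->
  qpoch_inf x k = (\prod_(i < r) (1 - x * 'X^i))`_k.
Proof.
rewrite /qpoch_inf; elim: r => // r IH; rewrite ltnS leq_eqVlt => /orP[/eqP <- //|kr].
rewrite IH // big_ord_recr /= mulrBr mulr1 coefB mulrA coefMXn kr subr0.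
by [].
Qed.

(** The expansion of p / g at infinity is the quotient of the power series that
    read the coefficients of p and g from the top. *)
Definition rev_poly w p : {poly K} := \poly_(k < w.+1) p`_(w - k).

Lemma coef_rev w p k : (rev_poly w p)`_k = if (k <= w)%N then p`_(w - k) else 0.
Proof. by rewrite coef_poly ltnS. Qed.

Lemma rev_polyE w p : (size p <= w.+1)%N ->
  (rev_poly w p)%:F = ('X%:F) ^+ w * (map_poly (fun c => c%:P%:F) p).[('X%:F)^-1].
Proof.
move=> sp; have X0 : 'X%:F != 0 :> {fraction {poly K}} by rewrite tofrac_eq0 polyX_eq0.
rewrite (@horner_coef_wide _ w.+1); last by apply: leq_trans (size_poly _ _) sp.
rewrite mulr_sumr (reindex_inj rev_ord_inj) /= /rev_poly poly_def rmorph_sum /=.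
apply: eq_bigr => k _; rewrite coef_map_id0 ?rmorph0 // -mul_polyC rmorphM rmorphXn /=.
rewrite subSS mulrCA; congr (_ * _).
have kw : (k <= w)%N by rewrite -ltnS.
have -> : 'X%:F ^+ w = 'X%:F ^+ k * 'X%:F ^+ (w - k) :> {fraction {poly K}}.
  by rewrite -exprD subnKC.
by rewrite exprVn mulfK ?expf_neq0.
Qed.

Lemma rev_polyM w1 w2 p1 p2 : (size p1 <= w1.+1)%N -> (size p2 <= w2.+1)%N ->
  rev_poly (w1 + w2) (p1 * p2) = rev_poly w1 p1 * rev_poly w2 p2.
Proof.
move=> s1 s2; have s12 : (size (p1 * p2)%R <= (w1 + w2).+1)%N.
  by apply: leq_trans (size_polyMleq _ _) _; lia.
apply/eqP; rewrite -tofrac_eq rmorphM /= !rev_polyE //.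
have -> : map_poly (fun c => c%:P%:F) (p1 * p2) =
    map_poly (fun c => c%:P%:F) p1 * map_poly (fun c => c%:P%:F) p2 :> {poly {fraction {poly K}}}.
  exact: (rmorphM (map_poly (@FracField.tofrac _ \o polyC))).
by rewrite hornerM exprD mulrACA.
Qed.

Lemma rev_polyD w p1 p2 : rev_poly w (p1 + p2) = rev_poly w p1 + rev_poly w p2.
Proof.
apply/polyP => k; rewrite coefD !coef_rev coefD.
by case: ifP; rewrite ?addr0.
Qed.

Lemma rev_polyX w k p : (size p <= w.+1)%N -> rev_poly (w + k) ('X^k * p) = rev_poly w p.
Proof.
move=> sp; apply/polyP => i; rewrite !coef_rev coefXnM.
have [lt|ge] := leqP i w.
  rewrite (_ : (i <= w + k)%N); last by lia.
  by rewrite (_ : (w + k - i < k)%N = false) 1?(_ : (w + k - i - k)%N = (w - i)%N) //; lia.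
by case: ifP => // le; rewrite (_ : (w + k - i < k)%N) //; lia.
Qed.

Lemma coef_rev_small w p r k : (size p + r <= w.+1)%N -> (k < r)%N -> (rev_poly w p)`_k = 0.
Proof.
move=> sp kr; rewrite coef_rev; case: ifP => // kw.
have h : (size p <= w - k)%N by lia.
by rewrite nth_default.
Qed.

Lemma rev_poly_lead p : (rev_poly (size p).-1 p)`_0 = lead_coef p.
Proof. by rewrite coef_rev subn0. Qed.

End Series.

(** * Uniqueness of the coloured HOMFLY polynomial *)

Section Tofrac.
Variable R : idomainType.
Implicit Types a b u v : R.

Lemma tofrac_cross a b u v : b != 0 -> v != 0 ->
  u%:F / v%:F = a%:F / b%:F -> u * b = a * v.
Proof.
move=> b0 v0 e; apply/eqP; rewrite -tofrac_eq !tofracM; apply/eqP.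
by apply: frac_cross e; rewrite tofrac_eq0.
Qed.

Lemma tofrac_uncross a b u v : b != 0 -> v != 0 -> u * b = a * v ->
  u%:F / v%:F = a%:F / b%:F.
Proof.
move=> b0 v0 e; apply/eqP; rewrite eqr_div ?tofrac_eq0 //.
by rewrite -!tofracM e.
Qed.

Lemma tofrac_clear a b c d : b != 0 -> a%:F / b%:F * c%:F = d%:F -> a * c = d * b.
Proof.
move=> b0 e; apply/eqP; rewrite -tofrac_eq !tofracM -e mulrAC divfK //.
by rewrite tofrac_eq0.
Qed.

End Tofrac.

(** For N above the degree in q^(1/2), the substitution a^(1/2) = q^(N/2) sends
    distinct monomials to distinct powers. *)
Lemma specialize_inj (f : {poly {poly rat}}) :
  (forall N, (2 <= N)%N -> specialize N f = 0) -> f = 0.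
Proof.
move=> h; pose N := maxn 2 (size f).
have N2 : (2 <= N)%N by rewrite leq_maxl.
have fN : (size f <= N)%N by rewrite leq_maxr.
apply/polyP => i; rewrite coef0; have [lt|ge] := ltnP i (size f); last by rewrite nth_default.
apply/polyP => j; rewrite coef0.
have := congr1 (fun p : {poly rat} => p`_(N * j + i)) (h N N2).
rewrite coef0 /specialize coef_sum (bigD1 (Ordinal lt)) //= big1 ?addr0 => [|k ne].
  by rewrite coefMXn ltnNge leq_addl /= addnK coef_comp_poly_Xn ?dvdn_mulr ?mulKn //; lia.
rewrite coefMXn; case: ifP => // kle; rewrite coef_comp_poly_Xn; last by lia.
case: ifP => // /dvdnP[c e].
have iN := leq_trans lt fN; have kN : (k < N)%N := leq_trans (ltn_ord k) fN.
have e' : (N * j + i = c * N + k)%N by move: e kle => /=; lia.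
have := congr1 (fun x => x %% N)%N e'; rewrite mulnC !modnMDl !modn_small // => ik.
by case/eqP: ne; apply/val_inj.
Qed.

Lemma colored_homfly_unique r n (w : braid_word n) P (f g : {poly {poly rat}}) :
  colored_homfly r w P -> g != 0 ->
  (forall N, (2 <= N)%N -> slN_invariant N r w * (specialize N g)%:F = (specialize N f)%:F) ->
  P = f%:F / g%:F.
Proof.
move=> hP g0 h; have [u0 [v0 [v00 PE]]] := ratfunP P.
suff E : u0 * g = f * v0 by rewrite PE; exact: (tofrac_uncross g0 v00 E).
apply/eqP; rewrite -subr_eq0; apply/eqP; apply: specialize_inj => N N2.
have [u [v [sv Puv xE]]] := hP N N2.
have v_0 : v != 0.
  by apply: contraNneq sv => ->; rewrite -(subrr 1) specializeB subrr.
have uv : u * v0 = u0 * v := tofrac_cross v00 v_0 (etrans (esym Puv) PE).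
have uv' := congr1 (specialize N) uv; rewrite !specializeM in uv'.
have h' := h N N2; rewrite xE in h'; have {}h' := tofrac_clear sv h'.
apply: (mulfI sv); rewrite mulr0 specializeB !specializeM mulrBr; apply/eqP.
rewrite subr_eq0 [X in X == _]mulrA [specialize N v * _]mulrC -uv' [X in X == _]mulrAC h'.
by rewrite [X in X == _]mulrAC [specialize N v * _]mulrC.
Qed.

(** * The expansion at q = oo *)

(** Multiplying the series h by a polynomial whose coefficients, read from the
    top, are those of g. *)
Lemma conv_shift (K : fieldType) d (g h f : nat -> K) (e : int) :
  (forall m, (d < m)%N -> g m = 0) ->
  (forall k, \sum_(i < k.+1) h i * g (k - i)%N = f k) ->
  \sum_(k < d.+1) g (d - k)%N * (if e + k%:Z is Posz m then h m else 0) =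
  if d%:Z + e is Posz m then f m else 0.
Proof.
move=> gd hf; rewrite (reindex_inj rev_ord_inj) /=.
have -> : \sum_(k < d.+1) g (d - (d.+1 - k.+1))%N *
      (if e + (d.+1 - k.+1)%N%:Z is Posz m then h m else 0) =
    \sum_(k < d.+1) g k * (if d%:Z + e - k%:Z is Posz m then h m else 0).
  apply: eq_bigr => k _; have := ltn_ord k; rewrite ltnS => kd.
  rewrite subSS subKn //; congr (_ * _).
  by have -> : e + (d - k)%N%:Z = d%:Z + e - k%:Z by lia.
case: (d%:Z + e) => M; last first.
  rewrite big1 // => k _; case E: (_ - _) => [x|x]; last by rewrite mulr0.
  by exfalso; lia.
rewrite -hf [RHS](reindex_inj rev_ord_inj) /=.
rewrite (big_ord_widen (d.+1 + M.+1)%N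
  (fun k => g k * (if M%:Z - k%:Z is Posz m then h m else 0))) ?leq_addr //.
rewrite [RHS](eq_bigr (fun k : 'I_M.+1 => g k * h (M - k)%N)); last first.
  move=> k _; have := ltn_ord k; rewrite ltnS => kM.
  by rewrite subSS subKn // mulrC.
rewrite [RHS](big_ord_widen (d.+1 + M.+1)%N (fun k => g k * h (M - k)%N)) ?leq_addl //.
rewrite big_mkcond [RHS]big_mkcond /=; apply: eq_bigr => k _.
case: ltnP => kd; case: ltnP => kM //.
- by have -> : M%:Z - k%:Z = (M - k)%N%:Z by lia.
- case E: (_ - _) => [x|x]; last by rewrite mulr0.
  by exfalso; lia.
- by rewrite gd ?mul0r.
Qed.

Section Expansion.
Variables (R : idomainType) (c : R) (a b : nat).

(** The coefficients of s^(a - b) / c times the series h in s^-2, as a series in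
    s^-1. *)
Definition expansion (h : nat -> {fraction R}) (j : int) : {fraction R} :=
  match j - (b%:Z - a%:Z) with
  | Posz k => if odd k then 0 else h k./2 / c%:F
  | Negz _ => 0
  end.

Lemma expansion_lead h k : expansion h (b%:Z - a%:Z + k.*2%:Z) = h k / c%:F.
Proof. by rewrite /expansion addrAC subrr add0r odd_double half_double. Qed.

Lemma expansion_support h j : expansion h j != 0 ->
  exists k : nat, j = b%:Z - a%:Z + k.*2%:Z.
Proof.
rewrite /expansion; case E: (j - _) => [k|k]; last by rewrite eqxx.
case: ifP => [_|ok _]; first by rewrite eqxx.
by exists k./2; rewrite -[k](odd_double_half) ok in E; lia.
Qed.

Lemma expansion_below h j : j < b%:Z - a%:Z -> expansion h j = 0.
Proof.
move=> lt; apply/eqP; apply: contraT => /expansion_support [k e].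
by move: lt; rewrite e; lia.
Qed.

End Expansion.

Section ExpansionOfFraction.
Variables (R : idomainType) (p v : {poly R}) (c : R) (a b : nat).
Hypotheses (v0 : v != 0) (pv : (size p <= size v)%N) (c0 : c != 0).
Local Notation d := (size v).-1.
Local Notation f := (fun k => (rev_poly d (map_poly (@FracField.tofrac R) p))`_k).
Local Notation g := (fun k => (rev_poly d (map_poly (@FracField.tofrac R) v))`_k).

Lemma sum_coef_sq (phi : nat -> {fraction R}) (V := c%:P * 'X^b * (v \Po 'X^2)) :
  \sum_(i < size V) (V`_i)%:F * phi i =
  \sum_(k < d.+1) c%:F * (v`_k)%:F * phi (b + k.*2)%N.
Proof.
have vd : d.+1 = size v by rewrite prednK // size_poly_gt0.
pose M := maxn (size V) (b + (size v).*2).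
have VM : (size V <= M)%N by rewrite leq_maxl.
have -> : \sum_(i < size V) (V`_i)%:F * phi i = \sum_(i < M) (V`_i)%:F * phi i.
  rewrite (big_ord_widen _ (fun i => (V`_i)%:F * phi i) VM) big_mkcond /=.
  apply: eq_bigr => i _; case: ltnP => // le.
  by rewrite nth_default // rmorph0 mul0r.
have cV i : (V`_i)%:F = \sum_(k < d.+1) (c%:F * (v`_k)%:F) * (i == b + k.*2)%N%:R.
  rewrite /V -mulrA coefCM coefXnM comp_polyE vd tofracM; case: ltnP => ib.
    rewrite rmorph0 mulr0 big1 // => k _.
    by case: eqP => [e|_]; rewrite ?mulr0 //; move: ib; rewrite e; lia.
  rewrite coef_sum rmorph_sum /= mulr_sumr; apply: eq_bigr => k _.
  rewrite coefZ -exprM coefXn tofracM mulrA; congr (_ * _).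
  rewrite (_ : (i - b == 2 * k)%N = (i == b + k.*2)%N); last by lia.
  by case: eqP; rewrite ?rmorph1 ?rmorph0.
under eq_bigr => i _ do rewrite cV mulr_suml.
rewrite exchange_big /=; apply: eq_bigr => k _.
have kM : (b + k.*2 < M)%N.
  apply: (@leq_trans (b + (size v).*2)%N); last by rewrite leq_maxr.
  by have kd := leq_trans (ltn_ord k) (eq_leq vd); rewrite ltn_add2l ltn_double.
rewrite (bigD1 (Ordinal kM)) //= eqxx mulr1 big1 ?addr0 // => i ne.
rewrite (_ : (i == b + k.*2 :> nat)%N = false) ?mulr0 ?mul0r //.
by apply: contra_neqF ne => /eqP e; apply/val_inj.
Qed.

Let h := series_quo f g.

Lemma rev_lead_neq0 : g 0%N != 0.
Proof.
rewrite /= coef_rev subn0 coef_map /= tofrac_eq0 -/(lead_coef v).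
by rewrite lead_coef_eq0.
Qed.

(** The fraction is expanded at s = oo through its reversed coefficients; only the
    powers of s of the same parity as a - b occur. *)
Lemma expansionP (V := c%:P * 'X^b * (v \Po 'X^2)) (j : int) :
  \sum_(i < size V) (V`_i)%:F * expansion c a b h (j + i%:Z) =
  if j <= 0 then (('X^a * (p \Po 'X^2))`_(absz j))%:F else 0.
Proof.
rewrite (sum_coef_sq (fun i => expansion c a b h (j + i%:Z))).
have cF : c%:F != 0 :> {fraction R} by rewrite tofrac_eq0.
have vd : d.+1 = size v by rewrite prednK // size_poly_gt0.
have coef_sq i : (p \Po 'X^2)`_i = if odd i then 0 else p`_(i./2).
  rewrite coef_comp_poly_Xn // dvdn2; case: (odd i) => //=.
  by rewrite divn2.
have expE k e : j + a%:Z = 2 * e ->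
    expansion c a b h (j + (b + k.*2)%N%:Z) = if e + k%:Z is Posz m then h m / c%:F else 0.
  move=> je; rewrite /expansion.
  have -> : j + (b + k.*2)%N%:Z - (b%:Z - a%:Z) = 2 * (e + k%:Z) by lia.
  case: (e + k%:Z) => m.
    by rewrite -PoszM mul2n odd_double half_double.
  by case E: (2 * Negz m) => [x|x] //; exfalso; lia.
have [e [je|je]] : exists e : int, j + a%:Z = 2 * e \/ j + a%:Z = 2 * e + 1.
- have := divz_eq (j + a%:Z) 2; have := ltz_pmod (j + a%:Z) (isT : (0 < 2 :> int)).
  have := modz_ge0 (j + a%:Z) (isT : (2 != 0 :> int)).
  case: (modz _ _) => // -[|[|//]] _ _ ->; exists (divz (j + a%:Z) 2); [left|right]; lia.
- rewrite (eq_bigr (fun k : 'I_d.+1 => (v`_k)%:F *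
    (if e + k%:Z is Posz m then h m else 0))) => [|k _]; last first.
    rewrite (expE _ _ je); case: (e + _) => m; last by rewrite !mulr0.
    by rewrite [c%:F * _]mulrC -mulrA [c%:F * _]mulrC divfK.
  rewrite (eq_bigr (fun k : 'I_d.+1 => g (d - k)%N *
    (if e + k%:Z is Posz m then h m else 0))) => [|k _]; last first.
    by congr (_ * _); rewrite /= coef_rev leq_subr subKn ?coef_map // -ltnS.
  rewrite (@conv_shift _ d g h f e) => [|m dm|k]; first last.
  + exact: series_quoP rev_lead_neq0.
  + by rewrite /= coef_rev leqNgt dm.
  have rhs : (if j <= 0 then (('X^a * (p \Po 'X^2))`_(absz j))%:F else 0) =
      if e is Posz 0 then (p`_0)%:F else if e is Negz k then (p`_k.+1)%:F else 0.
    case: e je => [[|k]|k] je.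
    + rewrite (_ : j <= 0); last by lia.
      rewrite coefXnM (_ : absz j = a) ?ltnn ?subnn ?coef_sq //; lia.
    + case: ifP => // j0; rewrite coefXnM ifT ?rmorph0 //; lia.
    + rewrite (_ : j <= 0); last by lia.
      rewrite coefXnM (_ : absz j = (a + k.+1.*2)%N); last by lia.
      by rewrite ltnNge leq_addr /= addKn coef_sq odd_double half_double.
  rewrite {}rhs; case: e {je} => [[|k]|k].
  + by rewrite addr0 /= coef_rev leqnn subnn coef_map.
  + by rewrite -PoszD /= coef_rev leqNgt (_ : (d < d + k.+1)%N) //; lia.
  + case E : (d%:Z + Negz k) => [K|K].
      rewrite /= coef_rev (_ : (K <= d)%N); last by lia.
      by rewrite (_ : (d - K)%N = k.+1) ?coef_map //; lia.
    have h1 : (size v <= k.+1)%N by rewrite -vd; lia.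
    by rewrite nth_default ?rmorph0 // (leq_trans pv).
- rewrite big1 => [|k _].
    case: ifP => // j0; rewrite coefXnM; case: ltnP => // ja.
    rewrite coef_sq (_ : odd _) ?rmorph0 //.
    have -> : (absz j - a = (absz e).-1.*2.+1)%N by clear -je j0 ja; lia.
    by rewrite /= odd_double.
  rewrite /expansion.
  have -> : j + (b + k.*2)%N%:Z - (b%:Z - a%:Z) = 2 * (e + k%:Z) + 1 by lia.
  case E: (2 * (e + k%:Z) + 1) => [x|x]; last by rewrite mulr0.
  by rewrite (_ : odd x) ?mulr0 //; lia.
Qed.

End ExpansionOfFraction.

(** * The head *)

(** For x = a and the variable q, the fraction is up to a monomial the invariant
    of the unknot. *)
Definition unknot_num (R : nzRingType) (x : R) r : {poly R} :=
  \prod_(i < r) ((x%:P * 'X^i - 1) * 'X).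

Definition unknot_den (R : nzRingType) (x : R) r : {poly R} :=
  \prod_(i < r) (x%:P * ('X^(i.+1) - 1)).

Lemma map_unknot_num (R S : nzRingType) (f : {rmorphism R -> S}) x r :
  map_poly f (unknot_num x r) = unknot_num (f x) r.
Proof.
rewrite /unknot_num rmorph_prod /=; apply: eq_bigr => i _.
by rewrite rmorphM rmorphB rmorphM /= rmorph1 map_polyC map_polyXn map_polyX.
Qed.

Lemma map_unknot_den (R S : nzRingType) (f : {rmorphism R -> S}) x r :
  map_poly f (unknot_den x r) = unknot_den (f x) r.
Proof.
rewrite /unknot_den rmorph_prod /=; apply: eq_bigr => i _.
by rewrite rmorphM rmorphB /= rmorph1 map_polyC map_polyXn.
Qed.

(** Numerator and denominator of c times the unknot fraction plus u / (q^r v). *)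
Definition fraction_num (R : nzRingType) (x c : R) r (u v : {poly R}) : {poly R} :=
  c%:P * 'X^r * unknot_num x r * v + u * unknot_den x r.

Definition fraction_den (R : nzRingType) (x : R) r (v : {poly R}) : {poly R} :=
  'X^r * unknot_den x r * v.

Lemma map_fraction_num (R S : nzRingType) (f : {rmorphism R -> S}) x c r u v :
  map_poly f (fraction_num x c r u v) =
  fraction_num (f x) (f c) r (map_poly f u) (map_poly f v).
Proof.
by rewrite rmorphD !rmorphM /= map_polyC map_polyXn map_unknot_num map_unknot_den.
Qed.

Lemma map_fraction_den (R S : nzRingType) (f : {rmorphism R -> S}) x r v :
  map_poly f (fraction_den x r v) = fraction_den (f x) r (map_poly f v).
Proof. by rewrite !rmorphM /= map_polyXn map_unknot_den. Qed.

Section Sizes.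
Variables (R : idomainType) (x : R).

Lemma size_unknot_num_factor i : (size ((x%:P * 'X^i - 1) * 'X)%R <= i.+2)%N.
Proof.
apply: leq_trans (size_polyMleq _ _) _; rewrite size_polyX addn2 /= ltnS.
apply: leq_trans (size_polyD _ _) _; rewrite geq_max size_polyN size_poly1 andbT.
by rewrite mul_polyC (leq_trans (size_scale_leq _ _)) ?size_polyXn.
Qed.

Lemma size_unknot_den_factor i : (size (x%:P * ('X^(i.+1) - 1))%R <= i.+2)%N.
Proof.
by rewrite mul_polyC (leq_trans (size_scale_leq _ _)) ?size_XnsubC.
Qed.

Lemma size_mul_bound w1 w2 (p1 p2 : {poly R}) : (size p1 <= w1.+1)%N -> (size p2 <= w2.+1)%N ->
  (size (p1 * p2)%R <= (w1 + w2).+1)%N.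
Proof. by move=> s1 s2; apply: leq_trans (size_polyMleq _ _) _; lia. Qed.

Lemma size_prod_factors r (p : nat -> {poly R}) :
  (forall i, (size (p i) <= i.+2)%N) ->
  (size (\prod_(i < r) p i)%R <= (\sum_(i < r) i.+1).+1)%N.
Proof.
move=> h; elim: r => [|r IH]; first by rewrite !big_ord0 size_poly1.
by rewrite !big_ord_recr; apply: size_mul_bound.
Qed.

Lemma size_unknot_den r : x != 0 -> size (unknot_den x r) = (\sum_(i < r) i.+1).+1.
Proof.
move=> x0; rewrite /unknot_den; elim: r => [|r IH]; first by rewrite !big_ord0 size_poly1.
rewrite !big_ord_recr /=.
have Xn : 'X^(r.+1) - 1 != 0 :> {poly R} by rewrite monic_neq0 ?monicXnsubC.
have pn : \prod_(i < r) (x%:P * ('X^(i.+1) - 1)) != 0 by rewrite -size_poly_eq0 IH.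
by rewrite size_mul ?mulf_neq0 ?polyC_eq0 // IH mul_polyC size_scale // size_XnsubC // addnS.
Qed.

Lemma size_fraction r (c : R) (u v : {poly R}) : x != 0 -> v != 0 -> (size u <= size v)%N ->
  (size (fraction_den x r v)).-1 = (\sum_(i < r) i.+1 + (size v).-1 + r)%N /\
  (size (fraction_num x c r u v) <= size (fraction_den x r v))%N.
Proof.
move=> x0 v0 uv.
have vd : (size v <= (size v).-1.+1)%N by rewrite prednK // size_poly_gt0.
have sd := size_unknot_den r x0.
have sn := size_prod_factors r size_unknot_num_factor.
have d0 : unknot_den x r != 0 by rewrite -size_poly_eq0 sd.
have sg : size (fraction_den x r v) = (\sum_(i < r) i.+1 + (size v).-1 + r).+1.
  rewrite /fraction_den -mulrA mulrC size_mulXn ?mulf_neq0 // size_mul // sd.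
  by rewrite -[size v](prednK (size_pos v0)) addSn !addnS addnC.
rewrite sg; split=> //; apply: size_addL.
  rewrite [_%:P * _]mulrC -2!mulrA mulrC; apply: size_mul_bound; last by rewrite size_polyXn.
  by rewrite mul_polyC (leq_trans (size_scale_leq _ _)) // size_mul_bound.
rewrite mulrC -addSn; apply: leq_trans (leq_addr _ _).
by apply: size_mul_bound; rewrite ?sd // (leq_trans uv).
Qed.

End Sizes.

Section Head.
Variables (K : fieldType) (x : K).
Hypothesis x0 : x != 0.

Lemma rev_prod_factors r (p : nat -> {poly K}) :
  (forall i, (size (p i) <= i.+2)%N) ->
  rev_poly (\sum_(i < r) i.+1) (\prod_(i < r) p i) = \prod_(i < r) rev_poly i.+1 (p i).
Proof.
move=> h; elim: r => [|r IH].
  by rewrite !big_ord0; apply/polyP => k; rewrite coef_rev !coef1 leqn0; case: k.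
by rewrite !big_ord_recr /= rev_polyM ?IH //; apply: size_prod_factors.
Qed.

Lemma rev_polyCM w (c : K) (p : {poly K}) : rev_poly w (c%:P * p) = c%:P * rev_poly w p.
Proof. by apply/polyP => i; rewrite coefCM !coef_rev coefCM; case: ifP; rewrite ?mulr0. Qed.

Lemma rev_monomial w (c : K) k : (k <= w)%N ->
  rev_poly w (c%:P * 'X^k) = c%:P * 'X^(w - k).
Proof.
move=> kw; apply/polyP => i; rewrite coef_rev !coefCM !coefXn.
have [iw|iw] := leqP i w; last first.
  by rewrite (_ : (i == w - k)%N = false) ?mulr0 //; lia.
by rewrite (_ : (w - i == k)%N = (i == w - k)%N) //; lia.
Qed.

Lemma rev_unknot_num r : rev_poly (\sum_(i < r) i.+1) (unknot_num x r) =
  (x ^+ r)%:P * \prod_(i < r) (1 - (x^-1)%:P * 'X^i).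
Proof.
rewrite (rev_prod_factors _ (size_unknot_num_factor x)) polyC_exp -[in x%:P ^+ r](card_ord r) -prodrMl.
apply: eq_bigr => i _.
have -> : (x%:P * 'X^i - 1) * 'X = x%:P * 'X^(i.+1) + (-1)%:P * 'X^1 :> {poly K}.
  by rewrite mulrBl -mulrA -exprSr mul1r polyCN mulN1r expr1.
rewrite rev_polyD !rev_monomial // subnn subSS subn0 mulrBr !mulr1 [in RHS]mulrA -polyCM divff //.
by rewrite polyCN mulNr.
Qed.

Lemma rev_unknot_den r : rev_poly (\sum_(i < r) i.+1) (unknot_den x r) =
  (x ^+ r)%:P * \prod_(i < r) (1 - 'X * 'X^i).
Proof.
rewrite (rev_prod_factors _ (size_unknot_den_factor x)) polyC_exp -[in x%:P ^+ r](card_ord r) -prodrMl.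
apply: eq_bigr => i _.
have -> : x%:P * ('X^(i.+1) - 1) = x%:P * 'X^(i.+1) + (- x)%:P * 'X^0 :> {poly K}.
  by rewrite mulrBr polyCN mulNr expr0.
rewrite rev_polyD !rev_monomial // subnn subn0 mulrBr mulr1 -exprS.
by rewrite polyCN mulNr.
Qed.

Lemma unknot_seriesP r k : (k < r)%N ->
  ((\poly_(i < r) series_quo (qpoch_inf (x^-1)%:P) (qpoch_inf 'X) i) *
    \prod_(i < r) (1 - 'X * 'X^i))`_k = (\prod_(i < r) (1 - (x^-1)%:P * 'X^i))`_k.
Proof.
move=> kr; rewrite -(qpoch_trunc _ kr) coefM.
rewrite -(@series_quoP _ (qpoch_inf (x^-1)%:P) (qpoch_inf 'X)).
  apply: eq_bigr => i _; have := ltn_ord i; rewrite ltnS => ik.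
  by rewrite coef_poly (leq_ltn_trans ik kr) -(@qpoch_trunc _ 'X (k - i) r) //; lia.
by rewrite /qpoch_inf big_ord1 expr0 mulr1 coefB coef1 coefX subr0 oner_eq0.
Qed.

(** The term u / (q^r v) is of order q^-r, and the factors with i >= r of the
    infinite products do not affect the first r coefficients. *)
Lemma head_coefficients r (c : K) (u v : {poly K})
    (d := (size (fraction_den x r v)).-1) :
  v != 0 -> (size u <= size v)%N ->
  forall k, (k < r)%N ->
  series_quo (fun i => (rev_poly d (fraction_num x c r u v))`_i)
    (fun i => (rev_poly d (fraction_den x r v))`_i) k =
  c * series_quo (qpoch_inf (x^-1)%:P) (qpoch_inf 'X) k.
Proof.
move=> v0 uv; set p := fraction_num x c r u v; set g := fraction_den x r v.
have dE : d = (\sum_(i < r) i.+1 + (size v).-1 + r)%N := (size_fraction r c x0 v0 uv).1.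
move: (d) dE => {d} d dE.
have vd : (size v <= (size v).-1.+1)%N by rewrite prednK // size_poly_gt0.
set U := series_quo (qpoch_inf _) _.
have sn := size_prod_factors r (size_unknot_num_factor x).
have sd := size_prod_factors r (size_unknot_den_factor x).
pose Q := \prod_(i < r) (1 - 'X * 'X^i) : {poly K}.
pose rv := rev_poly (size v).-1 v.
have gE : rev_poly d g = (x ^+ r)%:P * Q * rv.
  rewrite /g dE /fraction_den -mulrA rev_polyX ?rev_polyM ?rev_unknot_den //.
  exact: size_mul_bound.
have pE k : (k < r)%N -> (rev_poly d p)`_k =
    c * x ^+ r * (\prod_(i < r) (1 - (x^-1)%:P * 'X^i) * rv)`_k.
  move=> kr; rewrite /p /fraction_num rev_polyD coefD [X in _ + X](@coef_rev_small _ _ _ r) ?addr0 //; last first.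
    by rewrite dE -addSn leq_add2r mulrC; apply: size_mul_bound sd (leq_trans uv vd).
  have -> : c%:P * 'X^r * unknot_num x r * v = 'X^r * (c%:P * (unknot_num x r * v)).
    by rewrite [c%:P * _]mulrC -!mulrA.
  rewrite dE rev_polyX; last first.
    by rewrite mul_polyC (leq_trans (size_scale_leq _ _)) ?size_mul_bound.
  rewrite rev_polyCM rev_polyM // rev_unknot_num coefCM -!mulrA coefCM.
  by rewrite mulrA.
pose Up := \poly_(i < r) U i.
have g0 : (rev_poly d g)`_0 != 0.
  rewrite gE -mulrA coefCM coef0M mulf_neq0 ?expf_neq0 // mulf_neq0 //; last first.
    by rewrite rev_poly_lead lead_coef_eq0.
  rewrite /Q -horner_coef0 horner_prod; apply/prodf_neq0 => i _.
  by rewrite -exprS !hornerE expr0n subr0 oner_eq0.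
apply: (@series_unique _ (fun i => (rev_poly d p)`_i) (fun i => (rev_poly d g)`_i)) => // k kr.
  exact: (@series_quoP _ (fun i => (rev_poly d p)`_i) (fun i => (rev_poly d g)`_i)).
rewrite pE // -(coef_mul_low rv (p := Up * Q) (r := r)) //; last first.
  by move=> i; apply: unknot_seriesP.
transitivity (c * (Up * rev_poly d g)`_k).
  rewrite coefM mulr_sumr; apply: eq_bigr => i _; have := ltn_ord i; rewrite ltnS => ik.
  by rewrite [Up`_i]coef_poly (leq_ltn_trans ik kr) mulrA.
rewrite gE -mulrA mulrCA coefCM mulrA; congr (_ * _).
by rewrite mulrA.
Qed.

End Head.

Lemma unknot_factor (K : fieldType) (s A w : K) : s != 0 -> A != 0 -> w != 0 ->
  s ^+ 2 * w - 1 != 0 ->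
  A / s * (1 - A ^- 2 * w^-1) / (1 - (s ^+ 2 * w)^-1) * (A ^+ 2 * (s ^+ 2 * w - 1)) =
  A / s * ((A ^+ 2 * w - 1) * s ^+ 2).
Proof. by move=> s0 A0 w0 ws; field; rewrite s0 A0 w0 ws. Qed.


Lemma unknot_trace r' N : (0 < N)%N ->
  cable_trace r' 0 [::] N * evq N (unknot_den 'X^2 r'.+1) =
  (s ^+ N / s) ^+ r'.+1 * evq N (unknot_num 'X^2 r'.+1).
Proof.
move=> N0; rewrite /cable_trace /cable_word /block_proj big_nil big_seq1 mul1r mul1n mul0n /=.
rewrite (qtr_qsym V) // /unknot_den /unknot_num !(big_morph _ (evqM N) (evq1 N)) -big_split /=.
rewrite -[in (s ^+ N / s) ^+ _](card_ord r'.+1) -prodrMl; apply: eq_bigr => i _.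
rewrite !(evqM, evqB, evq1, evq_a, evqX).
have w0 : s ^+ (2 * i) != 0 := oi_neq0X V _.
have w1 : s ^+ 2 * s ^+ (2 * i) - 1 != 0.
  by rewrite -exprD -mulnS; have [] := geom_neq0 V (ltn0Sn i).
rewrite !exprVn mulnS exprD.
rewrite [evq N 'X](evqX N 1); exact: (unknot_factor rvar_neq0 (oi_neq0X V N) w0 w1).
Qed.

Lemma combine_traces (K : fieldType) (s A x G c0 eu ev en ed : K) n r L :
  s != 0 -> A != 0 ->
  x * (A / s) ^+ (r * L) = G + (A / s) ^+ (n * r) * c0 ->
  c0 * ed = (A / s) ^+ r * en -> G * (s ^+ (n.+1 * r + 2 * r) * ev) = eu ->
  x * (A ^+ (r * L) * s ^+ (n.+1 * r) * (s ^+ (2 * r) * ed * ev)) =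
  s ^+ (r * L) * (A ^+ (n.+1 * r) * s ^+ (2 * r) * en * ev + eu * ed).
Proof.
move=> s0 A0 ex ec <-.
have -> : x * (A ^+ (r * L) * s ^+ (n.+1 * r) * (s ^+ (2 * r) * ed * ev)) =
    x * (A / s) ^+ (r * L) * s ^+ (r * L) * (s ^+ (n.+1 * r) * (s ^+ (2 * r) * ed * ev)).
  rewrite expr_div_n -[x * _ * s ^+ _](mulrA x) divfK ?expf_neq0 //.
  by rewrite !mulrA.
have -> : A ^+ (n.+1 * r) = (A / s) ^+ (n * r) * (A / s) ^+ r * s ^+ (n.+1 * r).
  by rewrite -exprD addnC -mulSn expr_div_n divfK ?expf_neq0.
rewrite {}ex exprD.
transitivity (s ^+ (r * L) * ((A / s) ^+ (n * r) * (c0 * ed) * s ^+ (n.+1 * r) * s ^+ (2 * r) * ev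
   + G * (s ^+ (n.+1 * r) * s ^+ (2 * r) * ev) * ed)); first by ring.
by rewrite ec; ring.
Qed.

Lemma normalize_monomial (K : fieldType) (x y : K) a b : x != 0 ->
  x ^ (- (b%:Z - a%:Z)) * (x ^+ b * y / x ^+ a) = y.
Proof.
move=> x0; rewrite opprB expfzDr // -exprnN -exprnP.
move: (expf_neq0 a x0) (expf_neq0 b x0); move: (x ^+ a) (x ^+ b) => c d c0 d0.
by field; rewrite c0 d0.
Qed.

Lemma unknot_series_0 (K : fieldType) (c : K) :
  series_quo (qpoch_inf c%:P) (qpoch_inf 'X) 0 = 1 - c.
Proof.
rewrite /series_quo /= big_ord0 subr0 /qpoch_inf !big_ord1 expr0 !mulr1.
by rewrite !coefB !coef1 coefC coefX subr0 divr1.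
Qed.

Lemma one_sub_inv (K : fieldType) (y : K) : y != 0 -> 1 - y^-1 = (y - 1) / y.
Proof. by move=> y0; rewrite mulrBl divff // mul1r. Qed.

Lemma unknot_series0_leading : leading_term_one (unknot_series 0).
Proof.
exists ('X^2 - 1); first exact: monicXnsubC.
have -> : unknot_series 0 = 1 - s ^- 2 := unknot_series_0 _.
by rewrite size_XnsubC // (one_sub_inv (oi_neq0X V 2)) tofracB tofracXn.
Qed.

Lemma unknot_series0_neq0 : unknot_series 0 != 0.
Proof.
have [u um ->] := unknot_series0_leading.
by rewrite mulf_neq0 ?tofrac_eq0 ?monic_neq0 // invr_eq0 (oi_neq0X V).
Qed.

Section Main.
Variables (n r' : nat) (w : braid_word n).
Local Notation r := r'.+1.
Local Notation L := (size w).
Hypotheses (wp : positive_word w) (wc : connected_closure w).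

(** Here u / v is the error of [cable_trace_head]. *)
Lemma colored_homfly_fraction P : colored_homfly r w P ->
  exists u v : {poly {poly rat}}, [/\ v != 0, (size u <= size v)%N &
    P = ('X^(r * L) * (fraction_num 'X^2 'X^(n.+1 * r) r u v \Po 'X^2))%:F /
        ('X^(r * L)%:P * 'X^(n.+1 * r) * (fraction_den 'X^2 r v \Po 'X^2))%:F].
Proof.
move=> hP.
have wn : all (fun i => i < n)%N (gens w).
  by apply/allP => i /mapP[l _ ->].
have full i : (i < n)%N -> i \in gens w.
  move=> lt; have := forallP wc (Ordinal lt) => /mapP[l lw e].
  by apply/mapP; exists l; rewrite // -e.
have [u [v [v0 uv h]]] := cable_trace_head r' wn full.
exists u, v; split=> //; apply: (colored_homfly_unique hP).
  rewrite !mulf_neq0 ?polyC_eq0 ?expf_neq0 ?polyX_eq0 // sq_neq0 //.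
  rewrite !mulf_neq0 ?expf_neq0 ?polyX_eq0 //; apply/prodf_neq0 => i _.
  by rewrite mulf_neq0 ?polyC_eq0 ?expf_neq0 ?polyX_eq0 // monic_neq0 ?monicXnsubC.
move=> N N2; have N0 := ltnW N2.
have e : slN_invariant N r w * (s ^+ N / s) ^+ (r * L) =
    (cable_trace r' n (gens w) N - (s ^+ N / s) ^+ (n * r) * cable_trace r' 0 [::] N) +
    (s ^+ N / s) ^+ (n * r) * cable_trace r' 0 [::] N by rewrite subrK slN_cable_trace.
have := combine_traces rvar_neq0 (oi_neq0X V N) e (unknot_trace r' N0) (h N N2).
rewrite !specializeM !specializeX specializeC -!/(evq N _) !tofracM -!/(evq N _).
rewrite -evqC !tofracXn -/rvar (evD evqB) !evqM !evq_a !evqX.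
by [].
Qed.


Lemma fraction_head c (u v : {poly {poly rat}}) k (g := fraction_den 'X^2 r v) :
  v != 0 -> (size u <= size v)%N -> (k < r)%N ->
  series_quo
    (fun i => (rev_poly (size g).-1 (map_poly (@FracField.tofrac _) (fraction_num 'X^2 c r u v)))`_i)
    (fun i => (rev_poly (size g).-1 (map_poly (@FracField.tofrac _) g))`_i) k =
  c%:F * unknot_series k.
Proof.
move=> v0 uv kr.
have inj : injective (@FracField.tofrac {poly rat}).
  by move=> y y' /eqP; rewrite tofrac_eq => /eqP.
have sm (q : {poly {poly rat}}) : size (map_poly (@FracField.tofrac _) q) = size q.
  by apply: size_map_inj_poly inj _ _; rewrite rmorph0.
rewrite -(sm g) /g map_fraction_num map_fraction_den.
have X0 : ('X^2)%:F != 0 :> ratfun by rewrite tofracXn; exact: (oi_neq0X V 2).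
have := @head_coefficients _ _ X0 r c%:F (map_poly (@FracField.tofrac _) u)
  (map_poly (@FracField.tofrac _) v).
rewrite -size_poly_eq0 !sm size_poly_eq0 => /(_ v0 uv k kr) ->.
by rewrite /unknot_series tofracXn.
Qed.

(** Scaled by a power of a, the first r coefficients of the unknot series and of
    the coloured polynomial agree; the leading one is 1 - 1/a. *)
Lemma positive_is_head P : colored_homfly r w P -> is_head r P unknot_series.
Proof.
move=> /colored_homfly_fraction [u [v [v0 uv PE]]].
have X0 : 'X^2 != 0 :> {poly rat} by rewrite expf_neq0 ?polyX_eq0.
have c0 : 'X^(r * L) != 0 :> {poly rat} by rewrite expf_neq0 ?polyX_eq0.
set c := 'X^(n.+1 * r) : {poly rat}.
have g0 : fraction_den 'X^2 r v != 0.
  by rewrite !mulf_neq0 ?expf_neq0 ?polyX_eq0 // -size_poly_eq0 size_unknot_den.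
have [_ pg] := size_fraction r c X0 v0 uv.
pose h := series_quo
  (fun i => (rev_poly (size (fraction_den 'X^2 r v)).-1
      (map_poly (@FracField.tofrac _) (fraction_num 'X^2 c r u v)))`_i)
  (fun i => (rev_poly (size (fraction_den 'X^2 r v)).-1
      (map_poly (@FracField.tofrac _) (fraction_den 'X^2 r v)))`_i).
have hU k : (k < r)%N -> h k = c%:F * unknot_series k by apply: fraction_head.
pose C := expansion 'X^(r * L) (r * L) (n.+1 * r) h.
(* The fraction is a power series in q^-1 with invertible constant term, times
   the power s^(- D) that its monomials contribute. *)
pose D : int := (n.+1 * r)%N%:Z - (r * L)%N%:Z.
have CE k : (k < r)%N -> (-1) ^+ false * s ^ (- D) * C (D + k.*2%:Z) = unknot_series k.
  move=> kr; rewrite /C expansion_lead hU // expr0 mul1r /c !tofracXn.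
  exact: (normalize_monomial _ _ _ rvar_neq0).
have C0 : C D = C (D + 0.*2%:Z) by rewrite addr0.
exists C, D, false, (- D); split.
- split; first by exists D => j; apply: expansion_below.
  exists ('X^(r * L) * (fraction_num 'X^2 c r u v \Po 'X^2)),
    ('X^(r * L)%:P * 'X^(n.+1 * r) * (fraction_den 'X^2 r v \Po 'X^2)); split=> //.
    by rewrite !mulf_neq0 ?polyC_eq0 ?expf_neq0 ?polyX_eq0 // sq_neq0.
  exact: expansionP.
- split; last by move=> j; apply: expansion_support.
  have := CE 0%N isT; rewrite -C0 => e; apply: contraNneq unknot_series0_neq0 => C0'.
  by rewrite -e C0' mulr0.
- rewrite C0 CE //; exact: unknot_series0_leading.
- by move=> k kr; rewrite CE.
Qed.

End Main.

Theorem theorem2 (n r : nat) (w : braid_word n) (P U : ratfun2) :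
  (1 <= r)%N ->
  positive_word w -> connected_closure w ->
  colored_homfly r w P -> colored_homfly r unknot_word U ->
  is_head r P unknot_series /\ is_head r U unknot_series.
Proof.
case: r => // r _ wp wc hP hU; split; first exact: positive_is_head hP.
by apply: (positive_is_head _ _ hU) => //; apply/forallP => -[].
Qed.
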